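(* Let $Y_t=A_{E_t}$ and, for $t_0>0$, let $Y_t^{t_0}=Y_{t+t_0}-Y_{t_0}$. Let $t>0$ and let $B\subseteq\mathbb{R}$ be a Borel set such that $0\notin B$ and $P(Y_t^{t_0}\in B)\neq 0$ for $t_0>0$. Then $$P\left(Y_t^{t_0}\in B\right)\sim C\,t_0^{\alpha-1}\qquad \text{as } t_0\to\infty,$$ where $$C=\frac{\sin(\pi\alpha)}{\pi}\int_0^tP\left(Y_{t-r}\in B\right)r^{-\alpha}\,dr .$$
   Context: Let $0<\alpha<1$ and $c>0$. $(A_t)_{t\ge0}$ is a real-valued Lévy process with $A_0=0$. $(D_t)_{t\ge 0}$ is a stable subordinator of index $\alpha$ with $D_0=0$ and $E(e^{-uD_t})=e^{-tcu^{\alpha}}$ for $u\ge 0$, independent of $(A_t)$. Its inverse is $E_t=\inf\{s: D_s>t\}$. The notation $f(t_0)\sim g(t_0)$ as $t_0\to\infty$ means $f(t_0)/g(t_0)\to1$. *)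

(* Defs.v *)
From HB Require Import structures.
From mathcomp Require Import all_boot all_order all_algebra.
From mathcomp Require Import all_classical all_reals all_analysis.

Set Implicit Arguments.
Unset Strict Implicit.
Unset Printing Implicit Defensive.

Import Order.TTheory GRing.Theory Num.Theory.
Import numFieldNormedType.Exports.

Local Open Scope classical_set_scope.
Local Open Scope ring_scope.

Definition asymp_equiv_pinfty (R : realType) (f g : R -> R) : Prop :=
  (f x / g x) @[x --> +oo%R] --> (1 : R).

Definition cadlag (R : realType) (x : R -> R) : Prop :=
  (forall s, 0 <= s -> x r @[r --> s^'+] --> x s) /\
  (forall s, 0 < s -> cvg (x r @[r --> s^'-])).

(* Processes are families indexed by all of [R], but only the times in
   [0, +oo) are ever constrained or used. *)

Section processes.
Context (d : measure_display) (T : measurableType d) (R : realType).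
Variable P : probability T R.
Implicit Types X Y : R -> {RV P >-> R}.

Definition increment X (s t : R) (w : T) : R := X t w - X s w.

(* Taking some of the [U k] to be [setT], the product rule yields the mutual
   independence of the increments over consecutive intervals. *)
Definition independent_increments X : Prop :=
  forall (n : nat) (t : nat -> R) (U : nat -> set R),
    0 <= t 0%N -> (forall k, t k < t k.+1) -> (forall k, measurable (U k)) ->
    P (\big[setI/setT]_(k < n) (increment X (t k) (t k.+1) @^-1` U k)) =
    (\prod_(k < n) P (increment X (t k) (t k.+1) @^-1` U k))%E.

Definition stationary_increments X : Prop :=
  forall (s t : R) (U : set R), 0 <= s -> 0 <= t -> measurable U ->
    P (increment X s (s + t) @^-1` U) = P (increment X 0 t @^-1` U).

Definition stochastically_continuous X : Prop :=
  forall (t e : R), 0 <= t -> 0 < e ->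
    P [set w | e < `|X s w - X t w|]
      @[s --> within [set s : R | 0 <= s] (nbhs t)] --> 0%E.

Record levy_process X : Prop := LevyProcess {
  levy_start : {ae P, forall w, X 0 w = 0};
  levy_independent : independent_increments X;
  levy_stationary : stationary_increments X;
  levy_continuous : stochastically_continuous X;
  levy_cadlag : {ae P, forall w, cadlag (fun s => X s w)} }.

Record stable_subordinator (alpha c : R) X : Prop := StableSubordinator {
  stable_levy : levy_process X;
  stable_nondecreasing : {ae P, forall w,
    forall s t : R, 0 <= s -> s <= t -> X s w <= X t w};
  stable_laplace : forall t u : R, 0 <= t -> 0 <= u ->
    'E_P[fun w => expR (- (u * X t w))]%E =
    (expR (- (t * c * u `^ alpha)))%:E }.

Definition process_sigma_algebra X : set (set T) :=
  <<s [set S | exists t : R, 0 <= t /\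
       exists U : set R, measurable U /\ S = X t @^-1` U] >>.

Definition independent_processes X Y : Prop :=
  forall S S' : set T, process_sigma_algebra X S ->
    process_sigma_algebra Y S' -> P (S `&` S') = (P S * P S')%E.

(* The value is junk when the set is empty, i.e. when the path of [X] stays
   below [t]; for a stable subordinator this has probability zero. *)
Definition inverse_process X (t : R) (w : T) : R :=
  inf [set s : R | 0 <= s /\ t < X s w].

(* [Y t] is a random variable equal to [X] at the random time [E t], outside a
   null set because the path properties of [X] and [E] only hold almost
   surely. *)
Definition time_changed X (E : R -> T -> R) Y : Prop :=
  forall t, 0 <= t -> {ae P, forall w, Y t w = X (E t w) w}.

End processes.

(* Main.v *)
(* The heart of the proof is the identity, valid for x, t > 0 and 0 not in B,
     P(Y_{x+t} - Y_x in B) = \int_0^t kappa k_x(r) P(Y_{t-r} in B) dr,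
   where kappa = sin(pi alpha) / pi and k_x(r) = (x / r)^alpha / (x + r):
   kappa k_x is the density of the overshoot of D over the level x.
   Since k_x(r) = r^(-alpha) x^(alpha - 1) x / (x + r) and
   x / (x + t) <= x / (x + r) <= 1 for 0 < r < t, the asymptotics follow.

   For a continuous g with 0 <= g <= 1 and g(0) = 0 in place of the indicator of
   B, round the first passage times of D up to multiples of a mesh. By the
   independence and stationarity of increments, the double Laplace transform
   in (x, t) of the mean of g over the rounded increment is a geometric series,
   equal to a factor times the Laplace transform of the mean of g at the rounded
   position; as the mesh shrinks, this factor tends to
   (1 - (q / p)^alpha) / (p - q), which is also the double Laplace transform of
   kappa k_x. Both sides being right-continuous, uniqueness of the Laplace
   transform in x and then in t gives the identity. *)
Require Import Defs.
From HB Require Import structures.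
From mathcomp Require Import all_boot all_order all_algebra.
From mathcomp Require Import all_classical all_reals all_analysis.
From mathcomp Require Import measurable_realfun.
From mathcomp Require Import ring lra.

Set Implicit Arguments.
Unset Strict Implicit.
Unset Printing Implicit Defensive.

Import Order.TTheory GRing.Theory Num.Theory.
Import numFieldNormedType.Exports.

Local Open Scope classical_set_scope.
Local Open Scope ring_scope.


(** * The integral of v^(-alpha) / (1 + v) *)

(** The law of the overshoot is never derived as such: only the double transform of the increment of
    [Y] is computed. [Y t] agrees with [A] at the random time outside a null set that may depend on
    [t], so measurability in time and right-continuity of the means have to come from limits along
    sequences. Rounding provides these limits, and it also makes the independence of [A] and [D],
    given for events, usable: on a lattice the random time takes countably many values, each on a
    [cell] event of [D], and [A] is observed at fixed times. Rounding up makes the lattice times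
    approach the passage times from the right, where the paths of [A] are continuous. The condition
    q < p comes from exp (- p x - q t) = exp (- (p - q) x) exp (- q (x + t)): integrating over the
    cells of x and of x + t gives Laplace transforms of [D] with positive parameters p - q and q.
    That B misses 0 enters as g 0 = 0: when x and x + t share a cell, the rounded increment is 0. *)

Definition image_measure d d' (T1 : measurableType d) (T2 : measurableType d')
  (R : realType) (m : {measure set T1 -> \bar R}) (f : T1 -> T2)
  (mf : measurable_fun [set: T1] f) : {measure set T2 -> \bar R} :=
  measure_function_pushforward__canonical__measure_function_Measure m mf.

Lemma ge0_integral_image d d' (T1 : measurableType d) (T2 : measurableType d')
  (R : realType) (m : {measure set T1 -> \bar R}) (f : T1 -> T2)
  (mf : measurable_fun [set: T1] f) (h : T2 -> \bar R) :
  measurable_fun [set: T2] h -> (forall y, 0 <= h y)%E ->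
  (\int[image_measure m mf]_y h y = \int[m]_x h (f x))%E.
Proof.
by move=> mh h0; rewrite [LHS](ge0_integral_pushforward mf).
Qed.

Section affine.
Context {R : realType}.
Local Open Scope ereal_scope.
Notation mu := (@lebesgue_measure R).

Lemma measurable_affine (c d : R) : measurable_fun [set: R] (fun x : R => c * x + d)%R.
Proof. by apply: measurable_funD => //; exact: measurable_funM. Qed.

(** The scaled image measure agrees with Lebesgue measure on half-open intervals, which determine
    it. *)
Lemma lebesgue_measure_affine (c d : R) (A : set R) : (0 < c)%R -> measurable A ->
  c%:E * mu ((fun x : R => c * x + d)%R @^-1` A) = mu A.
Proof.
move=> c0 mA.
have mphi : measurable_fun [set: R] ((fun x => c * x + d)%R : R -> measurableTypeR R).
  exact: measurable_affine.
pose c' : {nonneg R} := NngNum (ltW c0).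
pose nu : {measure set (measurableTypeR R) -> \bar R} := mscale c' (image_measure mu mphi).
have := @lebesgue_measure_unique R nu.
move=> /(_ _ _ mA) -> // => _ [[a b]] _ <-.
rewrite /nu/= /mscale/= /pushforward/=.
rewrite (_ : _ @^-1` _ = `](a - d) / c, (b - d) / c]%classic)%R; last first.
  apply/seteqP; split => x /=; rewrite !in_itv/= ltr_pdivrMr// ler_pdivlMr//;
  by rewrite ltrBlDr lerBrDr mulrC.
rewrite !lebesgue_measure_itv/= !lte_fin ltr_pM2r ?invr_gt0// ltrD2r.
case: ifPn => _; last by rewrite mule0.
rewrite -EFinM; congr EFin; field; exact: lt0r_neq0.
Qed.

Lemma ge0_integral_affine (c d : R) (f : R -> \bar R) : (0 < c)%R ->
  measurable_fun [set: R] f -> (forall x, 0 <= f x) ->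
  \int[mu]_x f x = c%:E * \int[mu]_x f (c * x + d)%R.
Proof.
move=> c0 mf f0.
have mphi : measurable_fun [set: R] ((fun x => c * x + d)%R : R -> measurableTypeR R).
  exact: measurable_affine.
pose c' : {nonneg R} := NngNum (ltW c0).
rewrite (eq_measure_integral (mscale c' (image_measure mu mphi))); last first.
  by move=> A mA _; exact/esym/(@lebesgue_measure_affine c d).
rewrite ge0_integral_mscale//=.
congr (_ * _).
by rewrite [LHS]ge0_integral_image.
Qed.
End affine.

(** * Partial fraction expansion of pi / sin (pi alpha) *)

Section reflection.
Context {R : realType}.
Implicit Types (x s alpha : R).

(* An antiderivative of [cos (s x)], with the removable singularity at [s = 0]. *)
Let prim s x := if s == 0 then x else sin (s * x) / s.

Let is_derive_prim s x : is_derive x 1 (prim s) (cos (s * x)).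
Proof.
rewrite /prim; have [->|s0] := eqVneq s 0.
  by rewrite mul0r cos0; exact: is_derive_id.
apply: is_derive_eq.
by rewrite /GRing.scale/=; field.
Qed.

(** A Dirichlet kernel with half-integer frequencies, equal to sin (n x) / sin (x / 2). Summed over
    n it becomes a kernel of Fejer type, with bounded numerator over 2 sin (x / 2) ^ 2. *)
Let Delta n x := \sum_(k < n) 2 * cos ((k%:R + 2^-1) * x).

Let sin_sub x y : 2 * cos x * sin y = sin (x + y) - sin (x - y).
Proof. by rewrite sinD sinB; ring. Qed.

Let Delta_sin n x : Delta n x * sin (x / 2) = sin (n%:R * x).
Proof.
rewrite /Delta; elim: n => [|n IH]; first by rewrite big_ord0 !mul0r sin0.
rewrite big_ord_recr/= mulrDl IH sin_sub.
rewrite (_ : (n%:R + 2^-1) * x + x / 2 = n.+1%:R * x); last first.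
  by rewrite -natr1; field.
rewrite (_ : (n%:R + 2^-1) * x - x / 2 = n%:R * x); last by field.
by rewrite addrC subrK.
Qed.

Let sum_sin N x : 2 * sin (x / 2) * (\sum_(n < N) sin (n.+1%:R * x)) =
  cos (x / 2) - cos ((N%:R + 2^-1) * x).
Proof.
elim: N => [|N IH].
  by rewrite big_ord0 mulr0 add0r mulrC subrr.
rewrite big_ord_recr/= mulrDr IH.
rewrite (_ : (N%:R + 2^-1) * x = N.+1%:R * x - x / 2); last by rewrite -natr1; field.
rewrite (_ : (N.+1%:R + 2^-1) * x = N.+1%:R * x + x / 2); last by field.
by rewrite cosB cosD; ring.
Qed.

Let altsum alpha n : R := \sum_(k < n) (-1) ^+ k * ((k%:R + alpha)^-1 + (k.+1%:R - alpha)^-1).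

Let sin_pi_nat n x : sin (pi * (n%:R + x)) = (-1) ^+ n * sin (pi * x).
Proof.
elim: n => [|n IH]; first by rewrite add0r mul1r.
rewrite -natr1 (_ : pi * (n%:R + 1 + x) = pi * (n%:R + x) + pi); last by ring.
by rewrite sinDpi IH exprS; ring.
Qed.

(** Primitive, vanishing at 0, of a sum of cosines. At x = pi the sines of nonzero integer frequency
    vanish and the others become alternating multiples of sin (pi alpha); the frequency 0 in the
    term k = 0 has primitive x, which produces the pi. *)
Let tail alpha n x : R := \sum_(k < n) (prim (k%:R + alpha) x + prim (k.+1%:R - alpha) x
   - prim k.+1%:R x - prim k%:R x).

Let tail_pi alpha n : 0 < alpha < 1 ->
  tail alpha n.+1 pi = sin (pi * alpha) * altsum alpha n.+1 - pi.
Proof.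
move=> /andP[a0 a1].
have E k : prim (k%:R + alpha) pi + prim (k.+1%:R - alpha) pi
   - prim k.+1%:R pi - prim k%:R pi =
   sin (pi * alpha) * ((-1) ^+ k * ((k%:R + alpha)^-1 + (k.+1%:R - alpha)^-1)) -
   (if k == 0%N then pi else 0).
  rewrite /prim.
  have kp : (k%:R + alpha) != 0 :> R by rewrite gt_eqF// ltr_wpDl.
  have kp' : (k.+1%:R - alpha) != 0 :> R.
    by rewrite gt_eqF// subr_gt0 (lt_le_trans a1)// ler1n.
  rewrite (negbTE kp) (negbTE kp') !pnatr_eq0/=.
  rewrite ![_ * pi]mulrC sin_pi_nat (sin_pi_nat k.+1).
  rewrite mulrN sinN.
  have sinnat m : sin (pi * m%:R) = 0 :> R.
    by rewrite -[m%:R]addr0 sin_pi_nat mulr0 sin0 mulr0.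
  rewrite !sinnat mul0r.
  move: kp kp'; set u := k%:R + alpha; set v := k.+1%:R - alpha => kp kp'.
  by case: (k == 0%N); rewrite exprS ?mul0r; field; rewrite kp kp'.
rewrite /tail (eq_bigr _ (fun i _ => E (val i))) sumrB -mulr_sumr.
by congr (_ - _); rewrite big_ord_recl/= big1 ?addr0.
Qed.

Let sin_half_le beta x : 0 <= beta <= 1 -> 0 < x < pi ->
  0 <= sin (beta * (x / 2)) <= sin (x / 2).
Proof.
move=> /andP[b0 b1] /andP[x0 xpi].
have x2 : 0 < x / 2 by rewrite divr_gt0.
have bx0 : 0 <= beta * (x / 2) by rewrite mulr_ge0// ltW.
have bx1 : beta * (x / 2) <= x / 2 by rewrite ger_pMl.
have xp : x / 2 <= pi / 2 by rewrite ler_pM2r ?invr_gt0// ltW.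
have pp : pi / 2 <= pi :> R by rewrite ler_pdivrMr// ler_peMr ?pi_ge0// ler1n.
apply/andP; split.
  by apply: sin_ge0_pi; rewrite bx0 (le_trans bx1)// (le_trans xp).
move: bx1; rewrite le_eqVlt => /predU1P[-> //|bx1].
by apply/ltW; rewrite ltr_sin// in_itv/=; lra.
Qed.

(** The derivative is d times a sum of the kernels [Delta], and d is at most 2 sin (c / 2) ^ 2,
    which cancels the denominator of the summed kernel. The derivative is thus at most 2 in absolute
    value, and the mean value theorem on [0, pi] concludes. Bounding sums over n instead of single
    terms replaces the Riemann-Lebesgue lemma. *)
Let tails_bounded alpha N : 0 < alpha < 1 ->
  `|\sum_(n < N) tail alpha n.+1 pi| <= 2 * pi.
Proof.
move=> a01.
pose df x := \sum_(n < N) \sum_(k < n.+1) (cos ((k%:R + alpha) * x)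
  + cos ((k.+1%:R - alpha) * x) - cos (k.+1%:R * x) - cos (k%:R * x)).
have dF (x : R) : is_derive x 1 (fun y => \sum_(n < N) tail alpha n.+1 y) (df x).
  rewrite /tail /df.
  have -> : (fun y => \sum_(n < N) \sum_(k < n.+1) (prim (k%:R + alpha) y
    + prim (k.+1%:R - alpha) y - prim k.+1%:R y - prim k%:R y)) =
    \sum_(n < N) \sum_(k < n.+1) (prim (k%:R + alpha)
    + prim (k.+1%:R - alpha) - prim k.+1%:R - prim k%:R).
    apply/funext => y; rewrite fct_sumE; apply: eq_bigr => n _.
    by rewrite fct_sumE.
  apply: is_derive_sum => n; apply: is_derive_sum => k.
  by apply: is_deriveB; [apply: is_deriveB; [apply: is_deriveD|]|]; exact: is_derive_prim.
have F0 : \sum_(n < N) tail alpha n.+1 0 = 0.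
  have prim0 s : prim s 0 = 0.
    by rewrite /prim; case: (s == 0) => //; rewrite mulr0 sin0 mul0r.
  rewrite big1// => n _; rewrite /tail big1// => k _.
  by rewrite !prim0 !subr0 addr0.
have [c cpi] := MVT (pi_gt0 R) (fun x _ => dF x) (derivable_within_continuous (fun x _ => @ex_derive _ _ _ _ _ _ _ (dF x))).
rewrite F0 !subr0 => ->.
rewrite normrM (gtr0_norm (pi_gt0 R)) ler_pM2r ?pi_gt0//.
move: cpi; rewrite in_itv/= => cpi.
(* With z = (k + 1/2) c, the four arguments are z plus or minus (alpha - 1/2) c and z plus or minus
   c / 2, so the cosines combine into 2 cos z times [d]. *)
pose d := 2 * sin (alpha * (c / 2)) * sin ((1 - alpha) * (c / 2)).
have dE : d = cos ((alpha - 2^-1) * c) - cos (c / 2).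
  have -> : (alpha - 2^-1) * c = alpha * (c / 2) - (1 - alpha) * (c / 2) by field.
  have -> : cos (c / 2) = cos (alpha * (c / 2) + (1 - alpha) * (c / 2)).
    by congr cos; field.
  by rewrite !cosD cosN sinN /d; ring.
have -> : df c = d * \sum_(n < N) Delta n.+1 c.
  rewrite mulr_sumr; apply: eq_bigr => n _; rewrite /Delta mulr_sumr.
  apply: eq_bigr => k _; rewrite dE.
  set z := (k%:R + 2^-1) * c.
  rewrite (_ : (k%:R + alpha) * c = z + (alpha - 2^-1) * c); last by rewrite /z; ring.
  rewrite (_ : (k.+1%:R - alpha) * c = z - (alpha - 2^-1) * c); last by rewrite /z -natr1; field.
  rewrite (_ : k.+1%:R * c = z + c / 2); last by rewrite /z -natr1; field.
  rewrite (_ : k%:R * c = z - c / 2); last by rewrite /z; field.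
  by rewrite !cosD !cosN !sinN; ring.
have h : 2 * sin (c / 2) ^+ 2 * \sum_(n < N) Delta n.+1 c =
    cos (c / 2) - cos ((N%:R + 2^-1) * c).
  rewrite -sum_sin !mulr_sumr; apply: eq_bigr => n _.
  by rewrite -Delta_sin; ring.
have d0 : 0 <= d <= 2 * sin (c / 2) ^+ 2.
  have /andP[u0 u1] := @sin_half_le alpha c ltac:(lra) cpi.
  have /andP[v0 v1] := @sin_half_le (1 - alpha) c ltac:(lra) cpi.
  rewrite /d !mulr_ge0//= -mulrA ler_pM2l// expr2 ler_pM//.
case/andP: d0 => d0 d1.
rewrite normrM (ger0_norm d0).
apply: (@le_trans _ _ (2 * sin (c / 2) ^+ 2 * `|\sum_(n < N) Delta n.+1 c|)).
  exact: ler_wpM2r.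
have -> : 2 * sin (c / 2) ^+ 2 * `|\sum_(n < N) Delta n.+1 c| =
    `|2 * sin (c / 2) ^+ 2 * \sum_(n < N) Delta n.+1 c|.
  by rewrite [RHS]normrM ger0_norm// mulr_ge0// sqr_ge0.
rewrite h (le_trans (ler_normB _ _))// [leRHS](_ : 2 = 1 + 1 :> R)//.
by rewrite lerD// cos_max.
Qed.

(* The arithmetic means of [altsum alpha n * sin (pi * alpha)] tend to [pi],
   their distance to [pi] being at most [2 * pi / N]. *)
Lemma alternating_harmonic_cvg alpha (l : R) : 0 < alpha < 1 ->
  (\sum_(k < n) (-1) ^+ k * ((k%:R + alpha)^-1 + (k.+1%:R - alpha)^-1))
    @[n --> \oo] --> l ->
  sin (pi * alpha) * l = pi.
Proof.
move=> a01 cl.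
have cT : tail alpha n.+1 pi @[n --> \oo] --> sin (pi * alpha) * l - pi.
  have -> : (fun n => tail alpha n.+1 pi) = (fun n => sin (pi * alpha) * altsum alpha n.+1 - pi).
    by apply/funext => n; rewrite tail_pi.
  apply: cvgB; last exact: cvg_cst.
  apply: cvgMr.
  by rewrite -cvg_shiftS in cl.
have c0 : arithmetic_mean (fun n => tail alpha n.+1 pi) n @[n --> \oo] --> (0 : R).
  apply/norm_cvg0P.
  apply: (@squeeze_cvgr _ _ _ _ (cst 0) (fun n => n.+1%:R^-1 * (2 * pi))).
  - apply: nearW => n; rewrite normr_ge0/= normrM ger0_norm ?invr_ge0//.
    by rewrite ler_wpM2l ?invr_ge0// seriesEord/= tails_bounded.
  - exact: cvg_cst.
  - rewrite -(mul0r (2 * pi)); apply: cvgMl; exact: cvg_harmonic.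
apply/eqP; rewrite -subr_eq0; apply/eqP.
by rewrite -(cvg_lim _ (cesaro cT))// -[RHS](cvg_lim _ c0).
Qed.
End reflection.

(** [powR] with exponent -1 inverts nonnegative numbers, hence the detour through the square; at 0
    both sides are 0. *)
Lemma measurable_invr (R : realType) : measurable_fun [set: R] (@GRing.inv R).
Proof.
rewrite (_ : GRing.inv = fun x : R => x * (x ^+ 2) `^ (-1)).
  apply: measurable_funM => //.
  pose h := @measurableT_comp _ _ _ _ _ _ (fun y : R => y `^ (-1)) _ (fun x : R => x ^+ 2).
  by apply: h; [exact: measurable_powR|exact: measurable_funX].
apply/funext => x; rewrite powR_inv1 ?sqr_ge0//.
by have [->|x0] := eqVneq x 0; [rewrite invr0 mul0r|field].
Qed.

Lemma measurable_fun_invr d (T : measurableType d) (R : realType) (D : set T) (f : T -> R) :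
  measurable_fun D f -> measurable_fun D (fun x => (f x)^-1).
Proof. by move=> mf; apply: measurableT_comp => //; exact: measurable_invr. Qed.

Section power_integrals.
Context {R : realType}.
Notation mu := (@lebesgue_measure R).
Implicit Types (a b s : R).

Lemma harmonic_powR_cvg0 s : 0 < s -> (n.+1%:R^-1 `^ s : R) @[n --> \oo] --> (0 : R).
Proof.
move=> s0; have /cvg_at_rightP := powR_cvg0 s0; apply.
split; first by move=> n; rewrite invr_gt0.
exact: cvg_harmonic.
Qed.

Lemma integral_powR a b s : 0 < a < b -> s != 0 ->
  (\int[mu]_(x in `[a, b]) (x `^ (s - 1))%:E = ((b `^ s - a `^ s) / s)%:E)%E.
Proof.
move=> /andP[a0 ab] s0.
have cont (r x : R) : 0 < x -> {for x, continuous (fun y : R => y `^ r)}.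
  by move=> x0; apply: differentiable_continuous; apply/derivable1_diffP/derivable_powR; rewrite in_itv/= x0.
have der (x : R) : 0 < x -> is_derive x 1 (fun x => s^-1 * x `^ s) (x `^ (s - 1)).
  move=> x0; have ? := is_derive1_powR s x0.
  by apply: is_derive_eq; rewrite /GRing.scale/=; field.
rewrite (@continuous_FTC2 _ _ (fun x => s^-1 * x `^ s))//.
- by rewrite -EFinB mulrC; congr EFin; ring.
- apply: continuous_in_subspaceT => x; rewrite inE/= in_itv/= => /andP[ax _].
  by apply: cont; rewrite (lt_le_trans a0).
- split.
  + move=> x; rewrite in_itv/= => /andP[ax _].
    by case: (der x (lt_trans a0 ax)).
  + by apply: cvg_at_right_filter; apply: cvgMr; exact: cont.
  + by apply: cvg_at_left_filter; apply: cvgMr; apply: cont; rewrite (lt_trans a0).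
- move=> x; rewrite in_itv/= => /andP[ax _]; rewrite derive1E.
  by case: (der x (lt_trans a0 ax)).
Qed.

Lemma integral_powR01 s : 0 < s ->
  (\int[mu]_(x in `]0%R, 1%R]) (x `^ (s - 1))%:E = (s^-1)%:E)%E.
Proof.
move=> s0.
have mf D : measurable_fun D (fun x : R => (x `^ (s - 1))%:E).
  by apply/measurable_EFinP; apply: measurable_funTS; exact: measurable_powR.
(* The shift by 2 keeps the left endpoint below 1 for n = 0, as [integral_powR] requires. *)
pose F (n : nat) := [set` `[(n.+2%:R : R)^-1, 1]].
have E : `]0, 1]%classic = \bigcup_n F n :> set R.
  apply/seteqP; split => x /=; rewrite in_itv/=.
    move=> /andP[x0 x1]; exists (Num.truncn x^-1) => //; rewrite /F/= in_itv/= x1 andbT.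
    have h : x^-1 <= (Num.truncn x^-1).+2%:R.
      by rewrite ltW// (lt_trans (truncnS_gt _))// ltr_nat.
    by rewrite -[leRHS]invrK lef_pV2 ?posrE ?invr_gt0.
  move=> [n _]; rewrite /F/= in_itv/= => /andP[x0 ->]; rewrite andbT.
  by apply: lt_le_trans x0; rewrite invr_gt0.
have ndF : nondecreasing_seq F.
  apply/nondecreasing_seqP => n; rewrite subsetEset/F => x/=; rewrite !in_itv/=.
  by move=> /andP[h ->]; rewrite andbT (le_trans _ h)// lef_pV2 ?posrE// ler_nat.
have cF : (\int[mu]_(x in F i) (x `^ (s - 1))%:E)%E @[i --> \oo] -->
    (\int[mu]_(x in \bigcup_i F i) (x `^ (s - 1))%:E)%E.
  apply: (@ge0_nondecreasing_set_cvg_integral _ (measurableTypeR R) R) => //.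
  - by move=> i; exact: measurable_itv.
  - by move=> i; exact: mf.
  - by move=> i x _; rewrite lee_fin powR_ge0.
rewrite E -(cvg_lim _ cF)//; apply/cvg_lim => //.
have -> : (fun i => \int[mu]_(x in F i) (x `^ (s - 1))%:E)%E =
   (fun n => ((1 - n.+2%:R^-1 `^ s) / s)%:E).
  apply/funext => n; rewrite integral_powR ?powR1//; last exact: lt0r_neq0.
  by rewrite invr_gt0/= invf_lt1 ?ltr0n// ltr1n.
apply/cvg_EFin; first exact: nearW.
rewrite -[X in _ --> X]mul1r -[X in X * _]subr0.
apply: cvgMl; apply: cvgB; first exact: cvg_cst.
by have := harmonic_powR_cvg0 s0; rewrite -cvg_shiftS.
Qed.

Lemma integral_powR1y s : 0 < s ->
  (\int[mu]_(x in `[1%R, +oo[) (x `^ (- s - 1))%:E = (s^-1)%:E)%E.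
Proof.
move=> s0.
have mf D : measurable_fun D (fun x : R => (x `^ (- s - 1))%:E).
  by apply/measurable_EFinP; apply: measurable_funTS; exact: measurable_powR.
pose F (n : nat) := [set` `[1, (n.+2%:R : R)]].
have E : `[1, +oo[%classic = \bigcup_n F n :> set R.
  apply/seteqP; split => x /=; rewrite in_itv/= ?andbT.
    move=> x1; exists (Num.truncn x) => //; rewrite /F/= in_itv/= x1/=.
    by rewrite ltW// (lt_trans (truncnS_gt _))// ltr_nat.
  by move=> [n _]; rewrite /F/= in_itv/= => /andP[].
have ndF : nondecreasing_seq F.
  apply/nondecreasing_seqP => n; rewrite subsetEset/F => x/=; rewrite !in_itv/=.
  by move=> /andP[-> h]; rewrite (le_trans h)// ler_nat.
have cF : (\int[mu]_(x in F i) (x `^ (- s - 1))%:E)%E @[i --> \oo] -->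
    (\int[mu]_(x in \bigcup_i F i) (x `^ (- s - 1))%:E)%E.
  apply: (@ge0_nondecreasing_set_cvg_integral _ (measurableTypeR R) R) => //.
  - by move=> i; exact: measurable_itv.
  - by move=> i; exact: mf.
  - by move=> i x _; rewrite lee_fin powR_ge0.
rewrite E -(cvg_lim _ cF)//; apply/cvg_lim => //.
have -> : (fun i => \int[mu]_(x in F i) (x `^ (- s - 1))%:E)%E =
   (fun n => ((1 - n.+2%:R^-1 `^ s) / s)%:E).
  apply/funext => n; rewrite integral_powR ?powR1//; last by rewrite oppr_eq0 lt0r_neq0.
    have -> : n.+2%:R^-1 `^ s = n.+2%:R `^ (- s) :> R.
      by rewrite -powR_inv1// -powRrM mulN1r.
    by congr EFin; field; rewrite lt0r_neq0.
  by rewrite ltr01 ltr1n.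
apply/cvg_EFin; first exact: nearW.
rewrite -[X in _ --> X]mul1r -[X in X * _]subr0.
apply: cvgMl; apply: cvgB; first exact: cvg_cst.
by have := harmonic_powR_cvg0 s0; rewrite -cvg_shiftS.
Qed.

Let alternating_sum (u v : nat -> R) n : (forall n, u n + u n.+1 = v n) ->
  \sum_(k < n) (-1) ^+ k * v k = u 0%N - (-1) ^+ n * u n.
Proof.
move=> uv; elim: n => [|n IH]; first by rewrite big_ord0 mul1r subrr.
by rewrite big_ord_recr/= IH -uv exprS; ring.
Qed.

(** The alternating sum telescopes up to its last term, which 0 <= [u n] <= [v n] sends to 0. *)
Let cvg_alternating_sum (u v : nat -> R) :
  (forall n, 0 <= u n) -> (forall n, u n + u n.+1 = v n) -> v n @[n --> \oo] --> 0 ->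
  \sum_(k < n) (-1) ^+ k * v k @[n --> \oo] --> u 0%N.
Proof.
move=> u0 uv v0.
have -> : (fun n => \sum_(k < n) (-1) ^+ k * v k) = (fun n => u 0%N - (-1) ^+ n * u n).
  by apply/funext => n; exact: alternating_sum.
rewrite -[X in _ --> X]subr0; apply: cvgB; first exact: cvg_cst.
apply/norm_cvg0P; apply: (@squeeze_cvgr _ _ _ _ (cst 0) v) => //; last exact: cvg_cst.
apply: nearW => n; rewrite normr_ge0 normrM normrX normrN1 expr1n mul1r ger0_norm//=.
by rewrite -uv lerDl.
Qed.

Let cvg_inv_nat (c : R) (v : nat -> R) : 0 < c -> (forall n, v n = (n%:R + c)^-1) ->
  v n @[n --> \oo] --> 0.
Proof.
move=> c0 vE; rewrite -cvg_shiftS.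
apply: (@squeeze_cvgr _ _ _ _ (cst 0) (@harmonic R)); [|exact: cvg_cst|exact: cvg_harmonic].
apply: nearW => n; rewrite /= vE; apply/andP; split.
  by rewrite invr_ge0 addr_ge0// ltW.
by rewrite lef_pV2 ?posrE ?addr_gt0// lerDl ltW.
Qed.

(* The integrals [m n] of [x `^ (n - alpha) / (1 + x)] over ]0, 1] satisfy
   [m n + m n.+1 = (n.+1 - alpha)^-1], and similarly for [m' n] over [1, +oo[ :
   this expands the integral into an alternating series. *)
Lemma integral_powR_div1D (alpha : R) : 0 < alpha < 1 ->
  (\int[mu]_(v in `]0%R, +oo[) (v `^ (- alpha) / (1 + v))%:E = (pi / sin (pi * alpha))%:E)%E.
Proof.
move=> a01; have /andP[a0 a1] := a01.
have mf D r : measurable_fun D (fun x : R => x `^ r / (1 + x)).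
  apply: measurable_funTS; apply: measurable_funM; first exact: measurable_powR.
  by apply: measurable_fun_invr; exact: measurable_funD.
have rec (D : set R) (r : R) : measurable D -> (forall x, D x -> 0 < x) ->
    ((\int[mu]_(x in D) (x `^ r / (1 + x))%:E) + (\int[mu]_(x in D) (x `^ (r + 1) / (1 + x))%:E)
    = \int[mu]_(x in D) (x `^ r)%:E)%E.
  move=> mD D0; rewrite -ge0_integralD//; last 4 first.
  - by move=> x /D0/ltW x0; rewrite lee_fin divr_ge0 ?powR_ge0// addr_ge0.
  - by apply/measurable_EFinP; exact: mf.
  - by move=> x /D0/ltW x0; rewrite lee_fin divr_ge0 ?powR_ge0// addr_ge0.
  - by apply/measurable_EFinP; exact: mf.
  apply: eq_integral => x; rewrite inE => /D0 x0; rewrite -EFinD; congr EFin.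
  rewrite powRD; last by rewrite (lt0r_neq0 x0) implybT.
  by rewrite powRr1 ?(ltW x0)//; field; rewrite gt_eqF// addr_gt0.
have ge0 (D : set R) (r : R) : (forall x, D x -> 0 < x) ->
    (0 <= \int[mu]_(x in D) (x `^ r / (1 + x))%:E)%E.
  by move=> D0; apply: integral_ge0 => x /D0/ltW x0; rewrite lee_fin divr_ge0 ?powR_ge0// addr_ge0.
pose m (n : nat) := (\int[mu]_(x in `]0%R, 1%R]) (x `^ (n%:R - alpha) / (1 + x))%:E)%E.
pose m' (n : nat) := (\int[mu]_(x in `[1%R, +oo[) (x `^ (- (n%:R + alpha)) / (1 + x))%:E)%E.
have D01 (x : R) : `]0, 1]%classic x -> 0 < x by rewrite /= in_itv/= => /andP[].
have D1y (x : R) : `[1, +oo[%classic x -> 0 < x.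
  by rewrite /= in_itv/= andbT; apply: lt_le_trans.
have mE n : (m n + m n.+1 = ((n.+1%:R - alpha)^-1)%:E)%E.
  rewrite /m -(_ : n%:R - alpha + 1 = n.+1%:R - alpha); last by rewrite -natr1; ring.
  rewrite rec// -integral_powR01; last first.
    by rewrite addrAC natr1 subr_gt0 (lt_le_trans a1)// ler1n.
  by apply: eq_integral => x _; rewrite addrK.
have m'E n : (m' n + m' n.+1 = ((n%:R + alpha)^-1)%:E)%E.
  rewrite addeC /m' (_ : - (n%:R + alpha) = - (n.+1%:R + alpha) + 1); last by rewrite -natr1; ring.
  rewrite rec// -integral_powR1y; last by rewrite ltr_wpDl.
  by apply: eq_integral => x _; rewrite -natr1; congr (x `^ _)%:E; ring.
have mfin n : m n \is a fin_num.
  rewrite ge0_fin_numE ?ge0//; apply: (@le_lt_trans _ _ (m n + m n.+1)%E).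
    by rewrite leeDl// ge0.
  by rewrite mE ltry.
have m'fin n : m' n \is a fin_num.
  rewrite ge0_fin_numE ?ge0//; apply: (@le_lt_trans _ _ (m' n + m' n.+1)%E).
    by rewrite leeDl// ge0.
  by rewrite m'E ltry.
have c1 := @cvg_alternating_sum (fine \o m) (fun n => (n.+1%:R - alpha)^-1).
have c2 := @cvg_alternating_sum (fine \o m') (fun n => (n%:R + alpha)^-1).
have {}c1 : \sum_(k < n) (-1) ^+ k * (k.+1%:R - alpha)^-1 @[n --> \oo] --> fine (m 0%N).
  apply: c1 => [n|n|]; first by rewrite fine_ge0// ge0.
    by rewrite /= -fineD// mE.
  by apply: (@cvg_inv_nat (1 - alpha)) => [|n]; [rewrite subr_gt0|rewrite -natr1 addrA].
have {}c2 : \sum_(k < n) (-1) ^+ k * (k%:R + alpha)^-1 @[n --> \oo] --> fine (m' 0%N).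
  apply: c2 => [n|n|]; first by rewrite fine_ge0// ge0.
    by rewrite /= -fineD// m'E.
  exact: (@cvg_inv_nat alpha).
have := @alternating_harmonic_cvg R alpha (fine (m' 0%N) + fine (m 0%N)) a01.
have -> : (fun n => \sum_(k < n) (-1) ^+ k * ((k%:R + alpha)^-1 + (k.+1%:R - alpha)^-1)) =
  (fun n => \sum_(k < n) (-1) ^+ k * (k%:R + alpha)^-1 + \sum_(k < n) (-1) ^+ k * (k.+1%:R - alpha)^-1).
  by apply/funext => n; rewrite -big_split/=; apply: eq_bigr => k _; rewrite mulrDr.
move=> /(_ (cvgD c2 c1)) E.
have s0 : sin (pi * alpha) != 0.
  by apply: contra_eq_neq E => ->; rewrite mul0r lt_eqF// pi_gt0.
have -> : pi / sin (pi * alpha) = fine (m' 0%N) + fine (m 0%N).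
  by apply: (canLR (mulfK s0)); rewrite mulrC E.
rewrite EFinD !fineK//.
rewrite (@itv_bndbnd_setU _ _ _ (BRight (1 : R)))//.
rewrite ge0_integral_setU//=; last 3 first.
- by apply/measurable_EFinP; exact: mf.
- by move=> x [/D01|/=]; [|rewrite in_itv/= andbT => /(lt_trans ltr01)] => x0;
  rewrite lee_fin divr_ge0 ?powR_ge0// addr_ge0// ltW.
- by apply: lt_disjoint => x y/=; rewrite !in_itv/= andbT => /andP[_]; exact: le_lt_trans.
rewrite addeC /m /m'; congr (_ + _)%E.
  rewrite integral_itv_obnd_cbnd; last by apply/measurable_EFinP; exact: mf.
  by apply: eq_integral => x _; rewrite mulr0n add0r.
by apply: eq_integral => x _; rewrite mulr0n sub0r.
by rewrite bnd_simp.
Qed.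
End power_integrals.

(** * The overshoot density and its Laplace transform *)

Lemma tonelli_setX d1 d2 (T1 : measurableType d1) (T2 : measurableType d2) (R : realType)
  (m1 : {sigma_finite_measure set T1 -> \bar R})
  (m2 : {sigma_finite_measure set T2 -> \bar R})
  (A : set T1) (B : set T2) (f : T1 * T2 -> \bar R) :
  measurable A -> measurable B -> measurable_fun [set: T1 * T2] f ->
  (forall z, 0 <= f z)%E ->
  (\int[m1]_(x in A) \int[m2]_(y in B) f (x, y) =
   \int[m2]_(y in B) \int[m1]_(x in A) f (x, y))%E.
Proof.
move=> mA mB mf f0.
pose g := f \_ (A `*` B).
have mg : measurable_fun [set: T1 * T2] g.
  by apply/(measurable_restrictT _ _).1; [exact: measurableX|exact: measurable_funTS].
have g0 z : (0 <= g z)%E by apply: erestrict_ge0.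
have E1 : (\int[m1]_(x in A) \int[m2]_(y in B) f (x, y) = \int[m1]_x \int[m2]_y g (x, y))%E.
  rewrite integral_mkcond; apply: eq_integral => x _; rewrite patchE.
  case: ifPn => xA.
    rewrite integral_mkcond; apply: eq_integral => y _.
    by rewrite /g !patchE in_setX xA.
  by apply/esym/integral0_eq => y _; rewrite /g patchE in_setX (negbTE xA).
have E2 : (\int[m2]_(y in B) \int[m1]_(x in A) f (x, y) = \int[m2]_y \int[m1]_x g (x, y))%E.
  rewrite integral_mkcond; apply: eq_integral => y _; rewrite patchE.
  case: ifPn => yB.
    rewrite integral_mkcond; apply: eq_integral => x _.
    by rewrite /g !patchE in_setX yB andbT.
  by apply/esym/integral0_eq => x _; rewrite /g patchE in_setX (negbTE yB) andbF.
by rewrite E1 E2 fubini_tonelli.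
Qed.

Section exponential_integrals.
Context {R : realType}.
Notation mu := (@lebesgue_measure R).
Implicit Types (a b c : R).

Lemma measurable_expRM c : measurable_fun [set: R] (fun x => expR (- (c * x))).
Proof.
by apply: measurableT_comp; [exact: measurable_expR|apply: measurable_funN; exact: measurable_funM].
Qed.

Lemma integral_expR_y a c : 0 < c ->
  (\int[mu]_(x in `[a, +oo[) (expR (- (c * x)))%:E = (expR (- (c * a)) / c)%:E)%E.
Proof.
move=> c0.
have der (x : R) : is_derive x 1 (fun x : R => - (c^-1 * expR (- (c * x)))) (expR (- (c * x))).
  by apply: is_derive_eq; rewrite /GRing.scale/=; field; rewrite lt0r_neq0.
have cont (x : R) : {for x, continuous (fun x : R => - (c^-1 * expR (- (c * x))))}.
  by apply: differentiable_continuous; apply/derivable1_diffP; case: (der x).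
have conte (x : R) : {for x, continuous (fun x : R => expR (- (c * x)))}.
  apply: differentiable_continuous; apply/derivable1_diffP; exact: ex_derive.
rewrite (@ge0_continuous_FTC2y _ _ (fun x : R => - (c^-1 * expR (- (c * x)))) _ 0).
- by rewrite EFinN oppeK add0e mulrC.
- by move=> x _; exact: expR_ge0.
- exact: continuous_subspaceT.
- rewrite -oppr0 -(mulr0 c^-1); apply: cvgN; apply: cvgMr.
  apply: (@cvg_comp _ _ _ (fun x => c * x) (fun x => expR (- x)) _ (pinfty_nbhs R)); last exact: cvgr_expR.
  exact: gt0_cvgMry.
- by move=> x _; case: (der x).
- exact/cvg_at_right_filter/cont.
- by move=> x _; rewrite derive1E; case: (der x).
Qed.

Lemma integral_expR0y c : 0 < c ->
  (\int[mu]_(x in `]0%R, +oo[) (expR (- (c * x)))%:E = (c^-1)%:E)%E.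
Proof.
move=> c0; rewrite integral_itv_obnd_cbnd; last first.
  by apply/measurable_EFinP; apply: measurable_funTS; exact: measurable_expRM.
by rewrite integral_expR_y// mulr0 oppr0 expR0 mul1r.
Qed.

Lemma integral_expR_co a b c : 0 < c -> a <= b ->
  (\int[mu]_(x in `[a, b[) (expR (- (c * x)))%:E =
   ((expR (- (c * a)) - expR (- (c * b))) / c)%:E)%E.
Proof.
move=> c0 ab.
have := integral_expR_y a c0.
rewrite (@itv_bndbnd_setU _ _ _ (BLeft b))// ge0_integral_setU//=; last 2 first.
- by apply/measurable_EFinP; apply: measurable_funTS; exact: measurable_expRM.
- by apply: lt_disjoint => x y/=; rewrite !in_itv/= andbT => /andP[_]; exact: lt_le_trans.
rewrite integral_expR_y// => E.
rewrite mulrBl EFinB -E -addeA subee ?adde0//.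
Qed.

Lemma ge0_integral_scale c (f : R -> \bar R) : 0 < c ->
  measurable_fun [set: R] f -> (forall x, 0 <= f x)%E ->
  (\int[mu]_(x in `]0%R, +oo[) f x = c%:E * \int[mu]_(x in `]0%R, +oo[) f (c * x)%R)%E.
Proof.
move=> c0 mf f0; rewrite integral_mkcond.
rewrite (ge0_integral_affine 0 c0); last 2 first.
- by apply/(measurable_restrictT _ _).1 => //; exact: measurable_funTS.
- by move=> x; apply: erestrict_ge0.
rewrite [in RHS]integral_mkcond; congr (_ * _)%E.
apply: eq_integral => x _; rewrite addr0 !patchE.
by rewrite !mem_setE !in_itv/= !andbT pmulr_rgt0.
Qed.

Lemma eq_integral0y (f g : R -> \bar R) : (forall x, 0 < x -> f x = g x) ->
  (\int[mu]_(x in `]0%R, +oo[) f x = \int[mu]_(x in `]0%R, +oo[) g x)%E.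
Proof.
by move=> fg; apply: eq_integral => x; rewrite inE/= in_itv/= andbT; exact: fg.
Qed.

End exponential_integrals.

Definition overshoot_density (R : realType) (alpha x r : R) : R :=
  (x / r) `^ alpha / (x + r).

Section overshoot_density.
Context {R : realType}.
Notation mu := (@lebesgue_measure R).
Implicit Types (alpha x r p q : R).

Lemma overshoot_density_ge0 alpha x r : 0 < x -> 0 <= r -> 0 <= overshoot_density alpha x r.
Proof. by move=> x0 r0; rewrite divr_ge0 ?powR_ge0// addr_ge0// ltW. Qed.

Lemma measurable_overshoot_density alpha x : measurable_fun [set: R] (overshoot_density alpha x).
Proof.
apply: measurable_funM; last by apply: measurable_fun_invr; exact: measurable_funD.
pose h := @measurableT_comp _ _ _ _ _ _ (fun y : R => y `^ alpha) _ (fun r => x / r).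
apply: h; first exact: measurable_powR.
by apply: measurable_funM => //; exact: measurable_fun_invr.
Qed.

Let weight alpha (v : R) : R := v `^ (- alpha) / (1 + v).

Let weight_ge0 alpha v : 0 <= v -> 0 <= weight alpha v.
Proof. by move=> v0; rewrite divr_ge0 ?powR_ge0// addr_ge0. Qed.

Let measurable_weight alpha : measurable_fun [set: R] (weight alpha).
Proof.
apply: measurable_funM; first exact: measurable_powR.
by apply: measurable_fun_invr; exact: measurable_funD.
Qed.

(** The substitution r = x v: by self-similarity the density in v does not depend on x. The
    parameter x survives only inside [f], which suits both Tonelli and domination uniform in x. *)
Lemma integral_overshoot_density alpha x (f : R -> \bar R) : 0 < x ->
  measurable_fun [set: R] f -> (forall r, 0 <= f r)%E ->
  (\int[mu]_(r in `]0%R, +oo[) (f r * (overshoot_density alpha x r)%:E) =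
   \int[mu]_(v in `]0%R, +oo[) (f (x * v)%R * (v `^ (- alpha) / (1 + v))%:E))%E.
Proof.
move=> x0 mf f0.
(* The absolute value changes nothing on ]0, +oo[ and makes the function nonnegative on the whole
   line, as the change of variables asks. The same device recurs below. *)
pose g (r : R) : \bar R := (f r * (`|overshoot_density alpha x r|)%:E)%E.
have E : {in `]0%R, +oo[, forall r, g r = (f r * (overshoot_density alpha x r)%:E)%E}.
  move=> r; rewrite in_itv/= andbT => r0; rewrite /g ger0_norm//.
  exact: overshoot_density_ge0 (ltW r0).
rewrite (@eq_integral0y _ _ g); last first.
  by move=> r r0; rewrite E// in_itv/= r0.
rewrite (@ge0_integral_scale _ x)//; last 2 first.
- apply: emeasurable_funM => //; apply/measurable_EFinP; apply: measurableT_comp => //.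
  exact: measurable_overshoot_density.
- by move=> r; rewrite mule_ge0// lee_fin.
rewrite -ge0_integralZl//; last 3 first.
- apply: measurable_funTS; apply: emeasurable_funM.
    by apply: (measurableT_comp mf); exact: measurable_funM.
  apply/measurable_EFinP; apply: measurableT_comp => //.
  apply: (measurableT_comp (measurable_overshoot_density alpha x)).
  exact: measurable_funM.
- by move=> r _; rewrite mule_ge0// lee_fin.
- by rewrite lee_fin ltW.
apply: eq_integral0y => v v0.
rewrite E; last by rewrite in_itv/= mulr_gt0.
rewrite muleCA -EFinM; congr (_ * (_)%:E)%E.
rewrite /overshoot_density.
have -> : (x / (x * v)) `^ alpha = v `^ (- alpha).
  rewrite invfM mulrA divff ?lt0r_neq0// mul1r -(powR_inv1 (ltW v0)) -powRrM.
  by rewrite mulN1r.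
field; rewrite !gt_eqF// ?addr_gt0// ?mulr_gt0//.
Qed.

(** Partial fractions: (p - q) / ((1 + v) (p + q v)) = 1 / (1 + v) - q / (p + q v), and scaling v by
    p / q turns the last term into the known integral times (q / p) ^ alpha. The identity is added
    up instead of subtracted, so that all integrands stay nonnegative until [I] is known to be
    finite. *)
Let fraction_integral alpha p q : 0 < alpha < 1 -> 0 < q -> q < p ->
  (\int[mu]_(v in `]0%R, +oo[) (weight alpha v / (p + q * v))%:E =
   (pi / sin (pi * alpha) * ((1 - (q / p) `^ alpha) / (p - q)))%:E)%E.
Proof.
move=> a01 q0 qp.
have p0 : 0 < p by exact: lt_trans qp.
have mE (c : R) (g : R -> R) : measurable_fun [set: R] g ->
    measurable_fun [set: R] (fun v : R => (c * (g v / (p + q * v)))%:E).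
  move=> mg; apply/measurable_EFinP.
  apply: measurable_funM => //; apply: measurable_funM => //.
  apply: measurable_fun_invr.
  by apply: measurable_funD => //; exact: measurable_funM.
have mE1 (g : R -> R) : measurable_fun [set: R] g ->
    measurable_fun [set: R] (fun v : R => (g v / (p + q * v))%:E).
  by move=> /(mE 1); under eq_fun do rewrite mul1r.
set I := (X in X = _).
have posden (v : R) : 0 < v -> 0 < p + q * v by move=> v0; rewrite addr_gt0// mulr_gt0.
have I0 : (0 <= I)%E.
  apply: integral_ge0 => v; rewrite /= in_itv/= andbT => v0.
  by rewrite lee_fin divr_ge0 ?weight_ge0// ltW// posden.
have J : (\int[mu]_(v in `]0%R, +oo[) (q * (v `^ (- alpha) / (p + q * v)))%:E =
    ((q / p) `^ alpha * (pi / sin (pi * alpha)))%:E)%E.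
  pose g (v : R) := `|q * (v `^ (- alpha) / (p + q * v))|%:E.
  rewrite (@eq_integral0y _ _ g); last first.
    move=> v v0; rewrite /g ger0_norm//.
    by rewrite mulr_ge0 ?(ltW q0)// divr_ge0 ?powR_ge0// ltW// posden.
  have c0 : 0 < p / q by rewrite divr_gt0.
  rewrite (@ge0_integral_scale _ (p / q))//; last 2 first.
  - apply/measurable_EFinP; apply: measurableT_comp => //; apply: measurable_funM => //.
    apply: measurable_funM; first exact: measurable_powR.
    by apply: measurable_fun_invr; apply: measurable_funD => //; exact: measurable_funM.
  - by move=> v; rewrite lee_fin.
  rewrite [RHS]EFinM -(integral_powR_div1D a01).
  rewrite -ge0_integralZl//; last 3 first.
  - apply: measurable_funTS; apply/measurable_EFinP; apply: measurableT_comp => //; apply: measurable_funM => //.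
    apply: measurable_funM.
      pose h := @measurableT_comp _ _ _ _ _ _ (fun y : R => y `^ (-alpha)) _ (fun r => p / q * r).
      by apply: h; [exact: measurable_powR|exact: measurable_funM].
    by apply: measurable_fun_invr; apply: measurable_funD => //; do 2!apply: measurable_funM => //.
  - by move=> v _; rewrite lee_fin.
  - by rewrite lee_fin ltW.
  rewrite -ge0_integralZl//; last 3 first.
  - by apply: measurable_funTS; apply/measurable_EFinP; exact: measurable_weight.
  - by move=> v; rewrite /= in_itv/= andbT => v0; rewrite lee_fin weight_ge0// ltW.
  - by rewrite lee_fin powR_ge0.
  apply: eq_integral0y => v v0.
  have cv0 : 0 < p / q * v by rewrite mulr_gt0.
  rewrite /g ger0_norm; last first.
    by rewrite mulr_ge0 ?(ltW q0)// divr_ge0 ?powR_ge0// ltW// posden.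
  rewrite -!EFinM; congr EFin.
  rewrite powRM ?(ltW c0) ?(ltW v0)//.
  have -> : (q / p) `^ alpha = (p / q) `^ (- alpha).
    by rewrite -[q / p]invf_div -(powR_inv1 (ltW c0)) -powRrM mulN1r.
  by field; rewrite !gt_eqF ?addr_gt0 ?mulr_gt0.
have : (((p - q)%:E * I) + ((q / p) `^ alpha * (pi / sin (pi * alpha)))%:E =
    (pi / sin (pi * alpha))%:E)%E.
  rewrite -J -(integral_powR_div1D a01) -ge0_integralZl//; last 3 first.
  - by apply: measurable_funTS; apply: mE1; exact: measurable_weight.
  - move=> v; rewrite /= in_itv/= andbT => v0.
    by rewrite lee_fin divr_ge0 ?weight_ge0// ltW// posden.
  - by rewrite lee_fin subr_ge0 ltW.
  rewrite -ge0_integralD//; last 4 first.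
  - move=> v; rewrite /= in_itv/= andbT => v0; rewrite mule_ge0//.
      by rewrite lee_fin subr_ge0 ltW.
    by rewrite lee_fin divr_ge0 ?weight_ge0// ltW// posden.
  - apply: measurable_funTS; apply: emeasurable_funM => //; apply: mE1.
    exact: measurable_weight.
  - move=> v; rewrite /= in_itv/= andbT => v0.
    by rewrite lee_fin mulr_ge0 ?(ltW q0)// divr_ge0 ?powR_ge0// ltW// posden.
  - by apply: measurable_funTS; apply: (mE q); exact: measurable_powR.
  apply: eq_integral0y => v v0.
  rewrite -!EFinM -EFinD; congr EFin; rewrite /weight.
  by field; rewrite !gt_eqF ?addr_gt0 ?mulr_gt0 ?subr_gt0.
move: I0; case: I => [i|//|//] I0.
  rewrite -EFinM -EFinD => -[E]; congr EFin.
  have pq : p - q != 0 by rewrite gt_eqF// subr_gt0.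
  move: E; move: (pi / _) (_ `^ alpha) => M k E.
  apply: (mulfI pq); have -> : (p - q) * i = M - k * M by rewrite -{1}E addrK.
  by field.
by rewrite gt0_muley// lte_fin subr_gt0.
Qed.

(** After the scaling, x occurs only in exp (- (p + q v) x); integrating in x before v leaves
    [fraction_integral]. *)
Lemma laplace_overshoot_density alpha p q : 0 < alpha < 1 -> 0 < q -> q < p ->
  (\int[mu]_(x in `]0%R, +oo[) ((expR (- (p * x)))%:E *
     \int[mu]_(r in `]0%R, +oo[) ((expR (- (q * r)))%:E * (overshoot_density alpha x r)%:E)) =
   (pi / sin (pi * alpha) * ((1 - (q / p) `^ alpha) / (p - q)))%:E)%E.
Proof.
move=> a01 q0 qp; have p0 := lt_trans q0 qp.
rewrite -fraction_integral//.
pose f (z : R * R) : \bar R := ((expR (- (p * z.1 + q * (z.1 * z.2))))%:E * (`|weight alpha z.2|)%:E)%E.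
have mf : measurable_fun [set: R * R] f.
  apply: emeasurable_funM; apply/measurable_EFinP.
    apply: (@measurableT_comp _ _ _ _ _ _ (@expR R)); first exact: measurable_expR.
    apply: measurable_funN; apply: measurable_funD; apply: measurable_funM => //.
    exact: measurable_funM.
  apply: measurableT_comp => //; apply: measurableT_comp => //.
have f0 z : (0 <= f z)%E by rewrite mule_ge0// lee_fin expR_ge0.
have L x : `]0, +oo[%classic x -> ((expR (- (p * x)))%:E * \int[mu]_(r in `]0%R, +oo[)
    ((expR (- (q * r)))%:E * (overshoot_density alpha x r)%:E) =
    \int[mu]_(v in `]0%R, +oo[) f (x, v))%E.
  rewrite /= in_itv/= andbT => x0.
  rewrite integral_overshoot_density//; last first.
    by apply/measurable_EFinP; exact: measurable_expRM.
  rewrite -ge0_integralZl//; last 2 first.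
  - apply: measurable_funTS; apply: emeasurable_funM; apply/measurable_EFinP; last exact: measurable_weight.
    pose h := @measurableT_comp _ _ _ _ _ _ (fun y : R => expR (- (q * y))) _ (fun r => x * r).
    by apply: h; [exact: measurable_expRM|exact: measurable_funM].
  - move=> v; rewrite /= in_itv/= andbT => v0.
    by rewrite mule_ge0// lee_fin ?expR_ge0// weight_ge0// ltW.
  apply: eq_integral0y => v v0.
  by rewrite /f/= ger0_norm ?weight_ge0 ?(ltW v0)// muleA -EFinM -expRD opprD.
rewrite (@eq_integral0y _ _ (fun x => \int[mu]_(v in `]0%R, +oo[) f (x, v)))%E; last first.
  by move=> x x0; rewrite L//= in_itv/= x0.
rewrite tonelli_setX//.
apply: eq_integral0y => v v0.
rewrite /f/= ger0_norm ?weight_ge0 ?(ltW v0)//.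
have pv : 0 < p + q * v by rewrite addr_gt0// mulr_gt0.
rewrite (@eq_integral0y _ _ (fun x => (expR (- ((p + q * v) * x)))%:E * (weight alpha v)%:E)%E); last first.
  by move=> x _; congr ((expR (- _))%:E * _)%E; ring.
rewrite ge0_integralZr//; last 2 first.
- by apply/measurable_EFinP; apply: measurable_funTS; exact: measurable_expRM.
- by rewrite lee_fin weight_ge0// ltW.
by rewrite integral_expR0y// -EFinM mulrC.
Qed.

End overshoot_density.

(** * Uniqueness of Laplace transforms *)

Section laplace_uniqueness.
Context {R : realType}.
Notation mu := (@lebesgue_measure R).
Notation D := (`]0%R, +oo[%classic : set (measurableTypeR R)).

Let series_exp_coeff_le (x y : R) n : `|x| <= y -> `|series (exp_coeff x) n| <= expR y.
Proof.
move=> xy; have y0 : 0 <= y by apply: le_trans xy.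
apply: (@le_trans _ _ (series (exp_coeff y) n)).
  rewrite /series/= (le_trans (ler_norm_sum _ _ _))//; apply: ler_sum => i _.
  by rewrite /exp_coeff/= normrM normrX [X in _ * X]ger0_norm ?invr_ge0// ler_wpM2r ?invr_ge0// lerXn2r// nnegrE.
apply: nondecreasing_cvgn_le; last exact: is_cvg_series_exp_coeff.
by apply: nondecreasing_series => k _ _; exact: exp_coeff_ge0.
Qed.

Variable h : R -> R.
Hypothesis mh : measurable_fun [set: R] h.
Hypothesis ih : mu.-integrable D (EFin \o h).
Hypothesis h0 : forall n : nat, (\int[mu]_(x in D) (h x * expR (- (n%:R * x)))%:E = 0)%E.

Let integrable_mul (g : R -> R) : measurable_fun [set: R] g ->
  (forall x, 0 < x -> `|g x| <= 1) -> mu.-integrable D (fun x => (h x * g x)%:E).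
Proof.
move=> mg g1; apply: (le_integrable _ _ _ ih) => //.
  by apply: measurable_funTS; apply/measurable_EFinP; exact: measurable_funM.
move=> x; rewrite /= in_itv/= andbT => x0.
by rewrite !lee_fin normrM ler_piMr// g1.
Qed.

(** The outer exponential expands in powers of exp (- N x), each of which integrates to 0 against
    [h] by [h0]; the partial sums are dominated by [expR lam] times the absolute value of [h]. *)
Let integral_expR_expR (N : nat) (lam : R) : 0 <= lam ->
  (\int[mu]_(x in D) (h x * expR (- (lam * expR (- (N%:R * x)))))%:E = 0)%E.
Proof.
move=> lam0.
pose S (n : nat) (x : R) := h x * series (exp_coeff (- (lam * expR (- (N%:R * x))))) n.
have S0 n : (\int[mu]_(x in D) (S n x)%:E = 0)%E.
  pose c k : R := (- lam) ^+ k / k`!%:R.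
  have SE x : ((S n x)%:E = \sum_(k < n) (c k)%:E * (h x * expR (- ((N * k)%:R * x)))%:E)%E.
    under eq_bigr do rewrite -EFinM.
    rewrite sumEFin; congr EFin; rewrite /S/series/= mulr_sumr big_mkord.
    apply: eq_bigr => k _; rewrite /exp_coeff/= -mulNr exprMn -expRM_natl /c.
    rewrite (_ : k%:R * - (N%:R * x) = - ((N * k)%:R * x)); last by rewrite natrM; ring.
    by ring.
  under eq_integral do rewrite SE.
  have ihk k : mu.-integrable D (fun x => (h x * expR (- (k%:R * x)))%:E).
    apply: integrable_mul; first exact: measurable_expRM.
    by move=> x x0; rewrite ger0_norm ?expR_ge0// expR_le1 oppr_le0 mulr_ge0// ltW.
  rewrite integral_sum//=; last by move=> k; apply: integrableZl.
  by rewrite big1// => k _; rewrite integralZl// h0 mule0.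
have mS n : measurable_fun [set: R] (S n).
  apply: measurable_funM => //; rewrite /series/=.
  apply: measurable_sum => k; rewrite /exp_coeff/=.
  apply: measurable_funM => //; apply: measurable_funX; apply: measurable_funN.
  by apply: measurable_funM => //; exact: measurable_expRM.
have mL : measurable_fun [set: R] (fun x => h x * expR (- (lam * expR (- (N%:R * x))))).
  apply: measurable_funM => //; apply: measurableT_comp; first exact: measurable_expR.
  by apply: measurable_funN; apply: measurable_funM => //; exact: measurable_expRM.
have := @dominated_convergence _ _ _ mu D _ (fun n x => (S n x)%:E)
  (fun x => (h x * expR (- (lam * expR (- (N%:R * x)))))%:E)
  (fun x => (expR lam)%:E * (`|h x|)%:E)%E.
case=> //.
- by move=> n; apply: measurable_funTS; apply/measurable_EFinP; exact: mS.
- by apply: measurable_funTS; apply/measurable_EFinP; exact: mL.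
- apply: aeW => x _; apply: cvg_EFin; first exact: nearW.
  by apply: cvgMr; exact: is_cvg_series_exp_coeff.
- by apply: integrableZl => //; exact: (integrable_norm ih).
- apply: aeW => x n; rewrite /= in_itv/= andbT => x0.
  rewrite lee_fin normrM mulrC ler_wpM2r//; apply: series_exp_coeff_le.
  rewrite normrN ger0_norm ?mulr_ge0 ?expR_ge0//.
  by rewrite ler_piMr// expR_le1 oppr_le0 mulr_ge0// ltW.
move=> _ _; under eq_fun do rewrite S0.
by move=> /cvg_lim <-//; rewrite lim_cst.
Qed.

(* [exp (- exp (N * (s - x)))] tends to the indicator of [s < x], and it is a
   power series in [exp (- N * x)]. *)
Lemma laplace_tail_eq0 (s : R) : 0 < s -> (\int[mu]_(x in `]s, +oo[) (h x)%:E = 0)%E.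
Proof.
move=> s0.
pose k (N : nat) (x : R) := expR (- (expR (N%:R * s) * expR (- (N%:R * x)))).
have mk N : measurable_fun [set: R] (k N).
  apply: measurableT_comp; first exact: measurable_expR.
  by apply: measurable_funN; apply: measurable_funM => //; exact: measurable_expRM.
pose l (x : R) : R := \1_(`]s, +oo[%classic) x.
have ml : measurable_fun [set: R] l by exact: measurable_indic.
have kl x : x != s -> k N x @[N --> \oo] --> l x.
  move=> xs.
  have kE N : k N x = expR (- expR (N%:R * (s - x))).
    by rewrite /k -expRD; congr (expR (- expR _)); ring.
  under eq_fun do rewrite kE.
  have [xls|xgs|xes] := ltgtP x s; last by rewrite xes eqxx in xs.
  - have -> : l x = 0 by rewrite /l indicE memNset//= in_itv/= andbT; apply/negP; rewrite -leNgt ltW.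
    apply: (@cvg_comp _ _ _ (fun N : nat => expR (N%:R * (s - x))) (fun x => expR (- x)) _ (pinfty_nbhs R)); last exact: cvgr_expR.
    apply/cvgryPge => A; near=> N.
    rewrite (le_trans _ (expR_ge1Dx _))// (@le_trans _ _ (N%:R * (s - x)))// ?lerDr//.
    rewrite -ler_pdivrMr ?subr_gt0//.
    by near: N; exact: nbhs_infty_ger.
  - have -> : l x = 1 by rewrite /l indicE mem_set//= in_itv/= andbT.
    suff : expR (- expR (N%:R * (s - x))) @[N --> \oo] --> expR (- (0 : R)) by rewrite oppr0 expR0.
    apply: continuous_cvg; first exact: continuous_expR.
    apply: cvgN; under eq_fun do rewrite expRM_natl.
    by apply: cvg_expr; rewrite ger0_norm ?expR_ge0// expR_lt1 subr_lt0.
have k1 N x : `|k N x| <= 1.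
  by rewrite ger0_norm ?expR_ge0// expR_le1 oppr_le0 mulr_ge0// expR_ge0.
have := @dominated_convergence _ _ _ mu D _ (fun n x => (h x * k n x)%:E)
  (fun x => (h x * l x)%:E) (fun x => (`|h x|)%:E).
case=> //.
- move=> n; apply: measurable_funTS; apply/measurable_EFinP.
  by apply: measurable_funM => //; exact: mk.
- by apply: measurable_funTS; apply/measurable_EFinP; apply: measurable_funM.
(* At x = s the kernels are constantly exp (- 1), which is not the value of [l], but a point is a
   null set. *)
- exists [set s]; split=> //; first exact: lebesgue_measure_set1.
  move=> x /=; apply: contra_notP => xs _.
  apply: cvg_EFin; first exact: nearW.
  by apply: cvgMr; apply: kl; apply/eqP.
- exact: (integrable_norm ih).
- by apply: aeW => x n _; rewrite lee_fin normrM ler_piMr.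
move=> _ _; under eq_fun do rewrite integral_expR_expR ?expR_ge0//.
move=> /cvg_lim; rewrite lim_cst// => /(_ _)/esym <- //.
rewrite [LHS]integral_mkcond [RHS]integral_mkcond; apply: eq_integral => x _; rewrite !patchE /l indicE.
case: ifPn => xs; first by rewrite mulr1 ifT// inE/= in_itv/= andbT; move: xs; rewrite inE/= in_itv/= andbT; apply: lt_trans.
by rewrite mulr0; case: ifP.
Unshelve. all: by end_near. Qed.
End laplace_uniqueness.

Section laplace_unique.
Context {R : realType}.
Notation mu := (@lebesgue_measure R).

(** If f s > g s, right-continuity keeps f - g bounded below by a positive constant just after s,
    while the integral of the tilted difference vanishes on every tail, hence on a short interval
    ]s, b']. *)
Let laplace_le (f g : R -> R) (p0 : R) :
  measurable_fun [set: R] f -> measurable_fun [set: R] g ->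
  (forall x, 0 < x -> 0 <= f x) -> (forall x, 0 < x -> 0 <= g x) ->
  (forall s, 0 < s -> f x @[x --> s^'+] --> f s) ->
  (forall s, 0 < s -> g x @[x --> s^'+] --> g s) ->
  (forall p, p0 < p ->
    (\int[mu]_(x in `]0%R, +oo[) (expR (- (p * x)) * f x)%:E < +oo)%E) ->
  (forall p, p0 < p ->
    (\int[mu]_(x in `]0%R, +oo[) (expR (- (p * x)) * f x)%:E =
     \int[mu]_(x in `]0%R, +oo[) (expR (- (p * x)) * g x)%:E)%E) ->
  forall s, 0 < s -> f s <= g s.
Proof.
move=> mf mg f0 g0 cf cg fi fg s s0.
rewrite leNgt; apply/negP => gf.
pose p := p0 + 1.
have pn (n : nat) : p0 < p + n%:R by rewrite /p -addrA ltrDl ltr_wpDr.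
(* The tilt by exp (- p x) makes the difference integrable, and the equality of the transforms at p
   + n says that it is orthogonal to exp (- n x), for each natural n. *)
pose h x := expR (- (p * x)) * (f x - g x).
have mh : measurable_fun [set: R] h.
  apply: measurable_funM; first exact: measurable_expRM.
  exact: measurable_funB.
have int1 (u : R -> R) q : measurable_fun [set: R] u -> (forall x, 0 < x -> 0 <= u x) ->
   (\int[mu]_(x in `]0%R, +oo[) (expR (- (q * x)) * u x)%:E < +oo)%E ->
   mu.-integrable (`]0%R, +oo[%classic : set R) (fun x => (expR (- (q * x)) * u x)%:E).
  move=> mu_ u0 ui; apply/integrableP; split.
    by apply: measurable_funTS; apply/measurable_EFinP; apply: measurable_funM => //; exact: measurable_expRM.
  rewrite (eq_integral0y (g := fun x => (expR (- (q * x)) * u x)%:E))// => x x0.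
  by rewrite /= ger0_norm// mulr_ge0 ?expR_ge0// u0.
have intf n := int1 f (p + n%:R) mf f0 (fi _ (pn n)).
have intg n : mu.-integrable (`]0%R, +oo[%classic : set R) (fun x => (expR (- ((p + n%:R) * x)) * g x)%:E).
  by apply: int1 => //; rewrite -fg// fi.
have hE (n : nat) x : (h x * expR (- (n%:R * x)))%:E =
    ((expR (- ((p + n%:R) * x)) * f x)%:E - (expR (- ((p + n%:R) * x)) * g x)%:E)%E.
  have -> : expR (- ((p + n%:R) * x)) = expR (- (p * x)) * expR (- (n%:R * x)).
    by rewrite -expRD; congr expR; ring.
  by rewrite -EFinB; congr EFin; rewrite /h; ring.
have h00 n : (\int[mu]_(x in `]0%R, +oo[) (h x * expR (- (n%:R * x)))%:E = 0)%E.
  under eq_integral do rewrite hE.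
  rewrite integralB_EFin//; last 2 first.
  - exact: intf.
  - exact: intg.
  rewrite fg// subee//; apply: integrable_fin_num => //; exact: intg.
have ih : mu.-integrable (`]0%R, +oo[%classic : set R) (EFin \o h).
  have := integrableB _ (intf 0%N) (intg 0%N) => /(_ (measurable_itv _)).
  apply: eq_integrable => // x _ /=; rewrite -hE mul0r oppr0 expR0 mulr1//.
have tail := laplace_tail_eq0 mh ih h00.
have [b /= sb hb] : exists2 b, s < b & forall x, s <= x < b -> (f s - g s) / 2 <= f x - g x.
  have e0 : 0 < (f s - g s) / 2 by rewrite divr_gt0// subr_gt0.
  have cfg : (f \- g) x @[x --> s^'+] --> f s - g s by apply: cvgB; [exact: cf|exact: cg].
  move/cvgrPdist_lt in cfg.
  have [e /= e1 H] := cfg _ e0; exists (s + e); first by rewrite ltrDl.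
  move=> x /andP[]; rewrite le_eqVlt => /predU1P[<- _|sx xb].
    by rewrite ler_pdivrMr// ler_peMr ?ler1n// subr_ge0 ltW.
  have := H x; rewrite /= ltr0_norm ?subr_lt0// opprB ltrBlDl => /(_ xb sx).
  by rewrite ltr_norml => /andP[_]; lra.
pose b' := (s + b) / 2.
have sb' : s < b' by rewrite /b'; lra.
have b'b : b' < b by rewrite /b'; lra.
have : (\int[mu]_(x in `]s, b']) (h x)%:E = 0)%E.
  have := tail s s0.
  rewrite (@itv_bndbnd_setU _ _ _ (BRight b'))// ?bnd_simp//; last exact: ltW.
  rewrite integral_setU//=; last 2 first.
  - by apply: measurable_funTS; apply/measurable_EFinP.
  - by apply: lt_disjoint => x y/=; rewrite !in_itv/= andbT => /andP[_]; exact: le_lt_trans.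
  by rewrite (tail b')// ?adde0// (lt_trans s0).
(* [p] may be negative, so the exponential may be smallest at either end of [s, b']. *)
pose m := (f s - g s) / 2 * Num.min (expR (- (p * s))) (expR (- (p * b'))).
have m0 : 0 < m.
  by rewrite mulr_gt0 ?divr_gt0 ?subr_gt0// lt_min !expR_gt0.
apply/eqP; rewrite gt_eqF//.
apply: (@lt_le_trans _ _ (\int[mu]_(x in `]s, b']) m%:E)%E).
  rewrite integral_cst//= lebesgue_measure_itv/= lte_fin sb'.
  by rewrite -EFinD -EFinM lte_fin mulr_gt0// subr_gt0.
have hm x : s < x <= b' -> m <= h x.
  move=> /andP[sx xb']; rewrite /m mulrC ler_pM//.
  - by rewrite divr_ge0// subr_ge0 ltW.
  - rewrite ge_min !ler_expR !lerN2; apply/orP.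
    have [p_0|p_0] := leP 0 p; [right|left].
      by rewrite ler_wpM2l.
    by rewrite ler_wnM2l// ltW.
  - by apply: hb; rewrite ltW//= (le_lt_trans xb').
apply: ge0_le_integral => //.
- by move=> x _; rewrite lee_fin ltW.
- apply/measurable_EFinP; exact: measurable_funTS.
Qed.

Lemma laplace_unique (f g : R -> R) (p0 : R) :
  measurable_fun [set: R] f -> measurable_fun [set: R] g ->
  (forall x, 0 < x -> 0 <= f x) -> (forall x, 0 < x -> 0 <= g x) ->
  (forall s, 0 < s -> f x @[x --> s^'+] --> f s) ->
  (forall s, 0 < s -> g x @[x --> s^'+] --> g s) ->
  (forall p, p0 < p ->
    (\int[mu]_(x in `]0%R, +oo[) (expR (- (p * x)) * f x)%:E < +oo)%E) ->
  (forall p, p0 < p ->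
    (\int[mu]_(x in `]0%R, +oo[) (expR (- (p * x)) * f x)%:E =
     \int[mu]_(x in `]0%R, +oo[) (expR (- (p * x)) * g x)%:E)%E) ->
  forall s, 0 < s -> f s = g s.
Proof.
move=> mf mg f0 g0 cf cg fi fg s s0; apply/eqP; rewrite eq_le.
rewrite (laplace_le mf mg f0 g0 cf cg fi fg)//=.
apply: (@laplace_le g f p0) => // p pp; first by rewrite -(fg _ pp); exact: fi.
by rewrite -(fg _ pp).
Qed.
End laplace_unique.

(** * Discretization of time *)

Section independence.
Context d (T : measurableType d) (R : realType) (P : probability T R).

(** Independence on rectangles identifies the joint law with the product law, to which Tonelli
    applies. *)
Lemma integralM_indep (X Z : {RV P >-> R}) (f h : R -> \bar R) :
  (forall U V : set R, measurable U -> measurable V ->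
    P (X @^-1` U `&` Z @^-1` V) = P (X @^-1` U) * P (Z @^-1` V))%E ->
  measurable_fun [set: R] f -> measurable_fun [set: R] h ->
  (forall x, 0 <= f x)%E -> (forall x, 0 <= h x)%E ->
  (\int[P]_w (f (X w) * h (Z w)) = \int[P]_w f (X w) * \int[P]_w h (Z w))%E.
Proof.
move=> XZ mf mh f0 h0.
have mXZ : measurable_fun [set: T] (fun w => (X w, Z w)) by exact: measurable_fun_pair.
have mfh : measurable_fun [set: R * R] (fun z => f z.1 * h z.2)%E.
  by apply: emeasurable_funM; apply: measurableT_comp.
have fh0 z : (0 <= f z.1 * h z.2)%E by rewrite mule_ge0.
rewrite -(ge0_integral_image P mXZ mfh fh0).
have E A : measurable A ->
    (distribution P X \x distribution P Z)%E A = image_measure P mXZ A.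
  by apply: product_measure_unique => U V mU mV; rewrite -XZ.
rewrite (eq_measure_integral (distribution P X \x distribution P Z)%E); last first.
  by move=> A mA _; exact/esym/E.
rewrite fubini_tonelli1//.
transitivity (\int[distribution P X]_x (f x * \int[distribution P Z]_y h y))%E.
  by apply: eq_integral => x _; rewrite /fubini_F/= ge0_integralZl.
rewrite ge0_integralZr//; last by apply: integral_ge0.
by rewrite !ge0_integral_distribution.
Qed.

(** The indicator is treated as a random variable: its preimages are the empty set, [S], the
    complement of [S] and everything, so the product rule for [S] and its complement suffices. *)
Lemma integral_indic_indep (X : {RV P >-> R}) (S : set T) (f : R -> \bar R) :
  measurable S ->
  (forall U : set R, measurable U -> P (X @^-1` U `&` S) = P (X @^-1` U) * P S)%E ->
  (forall U : set R, measurable U -> P (X @^-1` U `&` ~` S) = P (X @^-1` U) * P (~` S))%E ->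
  measurable_fun [set: R] f -> (forall x, 0 <= f x)%E ->
  (\int[P]_w (f (X w) * (\1_S w)%:E) = \int[P]_w f (X w) * P S)%E.
Proof.
move=> mS XS XCS mf f0.
pose Z : {RV P >-> R} := mindic R mS.
have XZ (U V : set R) : measurable U -> measurable V ->
    (P (X @^-1` U `&` Z @^-1` V) = P (X @^-1` U) * P (Z @^-1` V))%E.
  move=> mU mV; have -> : Z @^-1` V = (\1_S : T -> R) @^-1` V by [].
  rewrite preimage_indic; case: ifPn => _; case: ifPn => _.
  - by rewrite setIT probability_setT mule1.
  - by rewrite XS.
  - by rewrite XCS.
  - by rewrite setI0 measure0 mule0.
(* Truncation at 0 provides a function of [Z w] that is nonnegative on all of R. *)
have E w : (\1_S w)%:E = (Num.max (Z w) 0)%:E.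
  by rewrite /Z/= mindicE max_l// indicE.
under eq_integral do rewrite E.
rewrite (@integralM_indep X Z f (fun x => (Num.max x 0)%:E))//; last 2 first.
- by apply/measurable_EFinP; exact: measurable_maxr.
- by move=> x; rewrite lee_fin le_max lexx orbT.
congr (_ * _)%E; under eq_integral do rewrite -E.
by rewrite integral_indic// setIT.
Qed.
End independence.

Section increments.
Context d (T : measurableType d) (R : realType) (P : probability T R).
Implicit Types (X : R -> {RV P >-> R}) (f : R -> \bar R).

Definition increment_rv X (s t : R) : {RV P >-> R} := (X t - X s)%R.

Lemma increment_rvE X s t : increment X s t = increment_rv X s t :> (T -> R).
Proof. by []. Qed.

Lemma measurable_increment X s t : measurable_fun [set: T] (increment X s t).
Proof. by rewrite increment_rvE. Qed.

Lemma integral_stationary X s t f : stationary_increments X -> 0 <= s -> 0 <= t ->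
  measurable_fun [set: R] f -> (forall x, 0 <= f x)%E ->
  (\int[P]_w f (increment X s (s + t) w) = \int[P]_w f (increment X 0 t w))%E.
Proof.
move=> statX s0 t0 mf f0.
transitivity (\int[distribution P (increment_rv X s (s + t))]_y f y)%E.
  by rewrite ge0_integral_distribution.
transitivity (\int[distribution P (increment_rv X 0 t)]_y f y)%E; last first.
  by rewrite ge0_integral_distribution.
apply: eq_measure_integral => A mA _.
exact: statX.
Qed.

Lemma integral_increment0 X t f : {ae P, forall w, X 0 w = 0} ->
  measurable_fun [set: R] f -> (forall x, 0 <= f x)%E ->
  (\int[P]_w f (increment X 0 t w) = \int[P]_w f (X t w))%E.
Proof.
move=> X0 mf f0; apply: ge0_ae_eq_integral => //.
- by apply: measurableT_comp => //; exact: measurable_increment.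
- exact: measurableT_comp.
- by apply: filterS X0 => w X0w _; rewrite /increment X0w subr0.
Qed.

Lemma indep_increments2 X s t U V : independent_increments X -> 0 < s -> s < t ->
  measurable U -> measurable V ->
  (P (increment X 0 s @^-1` U `&` increment X s t @^-1` V) =
   P (increment X 0 s @^-1` U) * P (increment X s t @^-1` V))%E.
Proof.
move=> indX s0 st mU mV.
(* [independent_increments] speaks of infinite increasing sequences of times, so 0, s, t is
   continued by t + 1, t + 2, ... *)
pose tt (k : nat) : R := if k is k'.+1 then if k' is k''.+1 then t + k''%:R else s else 0.
pose UU (k : nat) : set R := if k is 0%N then U else V.
have := indX 2 tt UU; rewrite !big_ord_recl !big_ord0/= setIT mule1 addr0; apply => //.
- move=> [|[|k]] //=; first by rewrite addr0.
  by rewrite ltrD2l ltr_nat.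
- by case.
Qed.

End increments.

Section stable_increments.
Context d (T : measurableType d) (R : realType) (P : probability T R).
Variables (alpha c : R) (D : R -> {RV P >-> R}).
Hypothesis stD : stable_subordinator alpha c D.

Let levyD := stable_levy stD.

Lemma laplace_stable t u : 0 <= t -> 0 <= u ->
  (\int[P]_w (expR (- (u * D t w)))%:E = (expR (- (t * c * u `^ alpha)))%:E)%E.
Proof. by move=> t0 u0; have := stable_laplace stD t0 u0; rewrite expectation.unlock. Qed.

Let mexp u : measurable_fun [set: R] (fun x : R => (expR (- (u * x)))%:E).
Proof. by apply/measurable_EFinP; exact: measurable_expRM. Qed.

Lemma laplace_stable_increment s t u : 0 <= s -> s <= t -> 0 <= u ->
  (\int[P]_w (expR (- (u * increment D s t w)))%:E =
   (expR (- ((t - s) * c * u `^ alpha)))%:E)%E.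
Proof.
move=> s0 st u0.
have {1}-> : t = s + (t - s) by rewrite addrC subrK.
rewrite (@integral_stationary _ _ _ P D s (t - s) (fun x => (expR (- (u * x)))%:E))//; last 2 first.
- exact: levy_stationary levyD.
- by rewrite subr_ge0.
rewrite (@integral_increment0 _ _ _ P D (t - s) (fun x => (expR (- (u * x)))%:E))//; last first.
  exact: levy_start levyD.
by rewrite laplace_stable// subr_ge0.
Qed.

(** (p - q) D_s + q D_t = p D_s + q (D_t - D_s), a sum of independent variables. The cases s = 0 and
    s = t are treated apart because independence is stated for strictly increasing times. *)
Lemma laplace_stable2 s t p q : 0 <= s -> s <= t -> 0 <= q -> q <= p ->
  (\int[P]_w (expR (- ((p - q) * D s w)) * expR (- (q * D t w)))%:E =
   (expR (- (s * c * p `^ alpha)) * expR (- ((t - s) * c * q `^ alpha)))%:E)%E.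
Proof.
move=> s0 st q0 qp; have p0 := le_trans q0 qp.
have e0 (u x : R) : (0 <= (expR (- (u * x)))%:E)%E by rewrite lee_fin expR_ge0.
have split w : (expR (- ((p - q) * D s w)) * expR (- (q * D t w))) =
    expR (- (p * D s w)) * expR (- (q * increment D s t w)).
  by rewrite -!expRD; congr expR; rewrite /increment; ring.
under eq_integral do rewrite split.
have [s0'|s_gt0] := leP s 0.
  have {s0 s0'}s0 : s = 0 by apply/eqP; rewrite eq_le s0'.
  move: st; rewrite {}s0 => t0.
  rewrite [RHS]EFinM -(laplace_stable_increment (lexx 0) t0 q0) !mul0r oppr0 expR0 mul1e.
  apply: ge0_ae_eq_integral => //.
  - apply/measurable_EFinP; apply: measurable_funM.
      by apply: (measurableT_comp (measurable_expRM p)).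
    by apply: (measurableT_comp (measurable_expRM q)); exact: measurable_increment.
  - by apply: (measurableT_comp (mexp q)); exact: measurable_increment.
  - have := levy_start levyD; apply: filterS => w D0 _.
    by rewrite D0 mulr0 oppr0 expR0 mul1r.
have [ts|lt_st] := leP t s.
  have E : t = s by apply/eqP; rewrite eq_le st ts.
  rewrite E subrr !mul0r oppr0 expR0 mulr1 -laplace_stable//.
  by apply: eq_integral => w _; rewrite /increment subrr mulr0 oppr0 expR0 mulr1.
have := @integralM_indep _ _ _ P (increment_rv D 0 s) (increment_rv D s t)
  (fun x => (expR (- (p * x)))%:E) (fun x => (expR (- (q * x)))%:E).
move=> /(_ _ (mexp p) (mexp q) (e0 p) (e0 q)) indE.
rewrite EFinM -laplace_stable// -(laplace_stable_increment s0 st q0).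
rewrite -(@integral_increment0 _ _ _ P D s (fun x => (expR (- (p * x)))%:E))//; last first.
  exact: levy_start levyD.
rewrite -indE; last first.
  by move=> U V mU mV; apply: indep_increments2 => //; exact: levy_independent levyD.
apply: ge0_ae_eq_integral => //.
- apply/measurable_EFinP; apply: measurable_funM.
    by apply: (measurableT_comp (measurable_expRM p)).
  by apply: (measurableT_comp (measurable_expRM q)); exact: measurable_increment.
- apply: emeasurable_funM.
    by apply: (measurableT_comp (mexp p)).
  by apply: (measurableT_comp (mexp q)).
- have := levy_start levyD; apply: filterS => w D0 _.
  by rewrite -!increment_rvE EFinM /increment D0 subr0.
Qed.

End stable_increments.

(** * The random walk obtained by sampling the subordinator on a lattice *)

Section lattice.
Context d (T : measurableType d) (R : realType) (P : probability T R).
Variables (alpha c : R) (D : R -> {RV P >-> R}).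
Hypothesis stD : stable_subordinator alpha c D.
Variable delta : R.
Hypothesis delta_gt0 : 0 < delta.

(** Laplace transform of one step of the walk, that is of [D delta]; its k-th power is the transform
    after k steps. *)
Definition lattice_laplace (u : R) := expR (- (delta * c * u `^ alpha)).

Let S (k : nat) (w : T) : R := D (k%:R * delta) w.
Local Notation a := lattice_laplace.

Let laplace_lattice2 k i p q : 0 <= q -> q <= p ->
  (\int[P]_w (expR (- ((p - q) * S k w)) * expR (- (q * S (k + i) w)))%:E =
   (a p ^+ k * a q ^+ i)%:E)%E.
Proof.
move=> q0 qp; rewrite (laplace_stable2 stD)//; last 2 first.
- by rewrite mulr_ge0// ltW.
- by rewrite ler_wpM2r ?(ltW delta_gt0)// ler_nat leq_addr.
congr EFin; rewrite /a -!expRM_natl; congr (expR _ * expR _); last rewrite natrD.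
  by ring.
by ring.
Qed.

Let mexpS u k : measurable_fun [set: T] (fun w => expR (- (u * S k w))).
Proof. exact: (measurableT_comp (measurable_expRM u)). Qed.

Let integrable_lattice2 k i p q : 0 <= q -> q <= p ->
  P.-integrable [set: T] (fun w => (expR (- ((p - q) * S k w)) * expR (- (q * S (k + i) w)))%:E).
Proof.
move=> q0 qp; apply/integrableP; split.
  by apply/measurable_EFinP; apply: measurable_funM; exact: mexpS.
under eq_integral do rewrite gee0_abs ?lee_fin ?mulr_ge0 ?expR_ge0//.
by rewrite laplace_lattice2// ltry.
Qed.

(** The integrand is the integral of exp (- (p x + q t)) over the pairs with x in [S_k, S_{k+1}[ and
    x + t in [S_m, S_{m+1}[, m = k + j + 1, computed path by path. Expanding the product leaves four
    expectations of the form covered by [laplace_lattice2]. *)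
Lemma expectation_lattice_cells k j p q : 0 < q -> q < p ->
  (\int[P]_w ((expR (- ((p - q) * S k w)) - expR (- ((p - q) * S k.+1 w))) / (p - q) *
    ((expR (- (q * S (k + j.+1)%N w)) - expR (- (q * S (k + j.+1).+1 w))) / q))%:E =
   (a p ^+ k * (a q - a p) / (p - q) * (a q ^+ j * (1 - a q) / q))%:E)%E.
Proof.
move=> q0 qp; have q0' := ltW q0; have qp' := ltW qp.
pose e k i w := expR (- ((p - q) * S k w)) * expR (- (q * S (k + i) w)).
have ie k' i : P.-integrable [set: T] (fun w => (e k' i w)%:E) by exact: integrable_lattice2.
have ee k' i : (\int[P]_w (e k' i w)%:E = (a p ^+ k' * a q ^+ i)%:E)%E by exact: laplace_lattice2.
have E w : ((expR (- ((p - q) * S k w)) - expR (- ((p - q) * S k.+1 w))) / (p - q) *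
    ((expR (- (q * S (k + j.+1)%N w)) - expR (- (q * S (k + j.+1).+1 w))) / q))%:E =
    (((p - q) * q)^-1%:E * (((e k j.+1 w)%:E - (e k.+1 j w)%:E) -
      ((e k j.+2 w)%:E - (e k.+1 j.+1 w)%:E)))%E.
  rewrite -!EFinB -EFinM; congr EFin; rewrite /e !addSn !addnS.
  by field; rewrite !gt_eqF// subr_gt0.
under eq_integral do rewrite E.
have i1 := integrableB _ (ie k j.+1) (ie k.+1 j) => //.
have i2 := integrableB _ (ie k j.+2) (ie k.+1 j.+1) => //.
rewrite integralZl//; last by apply: integrableB => //; [exact: i1|exact: i2].
rewrite integralB//; [|exact: i1|exact: i2].
rewrite !integralB_EFin//; [|exact: ie|exact: ie|exact: ie|exact: ie].
clearbody e.
rewrite !ee -!EFinB -EFinM; congr EFin.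
have pq : p - q != 0 by rewrite gt_eqF// subr_gt0.
move: (a p) (a q) => ap aq; rewrite !exprS; field; rewrite pq gt_eqF//.
Qed.

Lemma expectation_lattice_cell j q : 0 < q ->
  (\int[P]_w ((expR (- (q * S j w)) - expR (- (q * S j.+1 w))) / q)%:E =
   (a q ^+ j * (1 - a q) / q)%:E)%E.
Proof.
move=> q0; have q0' := ltW q0.
pose e k w := expR (- (q * S k w)).
have ie k : P.-integrable [set: T] (fun w => (e k w)%:E).
  have := integrable_lattice2 k 0 q0' (lexx q).
  by apply: eq_integrable => // w _; rewrite subrr mul0r oppr0 expR0 mul1r addn0.
have ee k : (\int[P]_w (e k w)%:E = (a q ^+ k)%:E)%E.
  have := laplace_lattice2 k 0 q0' (lexx q); rewrite mulr1 => <-.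
  by apply: eq_integral => w _; rewrite subrr mul0r oppr0 expR0 mul1r addn0.
have E w : ((expR (- (q * S j w)) - expR (- (q * S j.+1 w))) / q)%:E =
    (q^-1%:E * ((e j w)%:E - (e j.+1 w)%:E))%E.
  by rewrite -EFinB -EFinM mulrC.
under eq_integral do rewrite E.
clearbody e.
rewrite integralZl//; last by apply: integrableB => //; exact: ie.
rewrite integralB_EFin//; [|exact: ie|exact: ie].
rewrite !ee -EFinB -EFinM; congr EFin.
by rewrite exprS; field; rewrite gt_eqF.
Qed.

End lattice.

Lemma measurable_set_leltr d (T : measurableType d) (R : realType) (f g h : T -> R) :
  measurable_fun [set: T] f -> measurable_fun [set: T] g -> measurable_fun [set: T] h ->
  measurable [set x | f x <= g x < h x].
Proof.
move=> mf mg mh.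
have -> : [set x | f x <= g x < h x] =
    ([set: T] `&` (fun x => f x <= g x) @^-1` [set true]) `&`
    ([set: T] `&` (fun x => g x < h x) @^-1` [set true]).
  rewrite !setTI; apply/seteqP; split => x /=; first by move=> /andP[-> ->].
  by move=> [-> ->].
by apply: measurableI; [exact: measurable_fun_ler|exact: measurable_fun_ltr].
Qed.

Lemma measurable_integral_snd d1 d2 (T1 : measurableType d1) (T2 : measurableType d2)
  (R : realType) (m2 : {sigma_finite_measure set T2 -> \bar R})
  (B : set T2) (f : T1 * T2 -> \bar R) :
  measurable B -> measurable_fun [set: T1 * T2] f -> (forall z, 0 <= f z)%E ->
  measurable_fun [set: T1] (fun x => \int[m2]_(y in B) f (x, y))%E.
Proof.
move=> mB mf f0; have mTB : measurable ([set: T1] `*` B) by exact: measurableX.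
rewrite (_ : (fun _ => _) = fubini_F m2 (f \_ ([set: T1] `*` B))).
  apply: measurable_fun_fubini_tonelli_F.
    by apply/(measurable_restrictT _ _).1; [exact: mTB|exact: measurable_funTS].
  by move=> z; apply: erestrict_ge0.
apply/funext => x; rewrite /fubini_F [LHS]integral_mkcond; apply: eq_integral => y _.
by rewrite !patchE in_setX in_setT.
Qed.

Lemma measurable_integral_fst d1 d2 (T1 : measurableType d1) (T2 : measurableType d2)
  (R : realType) (m1 : {sigma_finite_measure set T1 -> \bar R})
  (A : set T1) (f : T1 * T2 -> \bar R) :
  measurable A -> measurable_fun [set: T1 * T2] f -> (forall z, 0 <= f z)%E ->
  measurable_fun [set: T2] (fun y => \int[m1]_(x in A) f (x, y))%E.
Proof.
move=> mA mf f0.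
apply: (@measurable_integral_snd _ _ _ _ _ m1 A (fun z => f (z.2, z.1))) => //.
by apply: (measurableT_comp mf); exact: measurable_fun_pair.
Qed.

Section cells.
Context {R : realType}.
Notation mu := (@lebesgue_measure R).

Lemma integral_expR_indic (a b c : R) : 0 < c -> 0 <= a -> a <= b ->
  (\int[mu]_(x in `]0%R, +oo[) (expR (- (c * x)) * \1_[set y | (a <= y < b)%R] x)%:E =
   ((expR (- (c * a)) - expR (- (c * b))) / c)%:E)%E.
Proof.
move=> c0 a0 ab.
have mI : measurable [set y : R | a <= y < b] by exact: measurable_set_leltr.
rewrite integral_itv_obnd_cbnd; last first.
  apply: measurable_funTS; apply/measurable_EFinP; apply: measurable_funM.
    exact: measurable_expRM.
  exact: measurable_indic.
rewrite -integral_expR_co// [LHS]integral_mkcond [RHS]integral_mkcond.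
apply: eq_integral => x _; rewrite !patchE !mem_setE !in_itv/= andbT indicE.
case: ifPn => x0.
  have -> : (x \in [set y | a <= y < b]) = (a <= x < b).
    by apply/idP/idP; rewrite inE.
  by case: ifPn => _; rewrite ?mulr1 ?mulr0.
by rewrite ifF//; apply: contraNF x0 => /andP[ax _]; rewrite (le_trans a0).
Qed.

End cells.

Section lattice_cells.
Context d (T : measurableType d) (R : realType) (P : probability T R).
Notation mu := (@lebesgue_measure R).
Variables (alpha c : R) (D : R -> {RV P >-> R}).
Hypothesis stD : stable_subordinator alpha c D.
Variable delta : R.
Hypothesis delta_gt0 : 0 < delta.

Local Notation a := (lattice_laplace alpha c delta).

(** On this event the first passage time over x, rounded up to the lattice, is (k + 1) [delta]; this
    is the origin of the index shifts in the series below. *)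
Definition cell (k : nat) (x : R) : set T :=
  [set w | D (k%:R * delta) w <= x < D (k.+1%:R * delta) w].

Lemma measurable_cell k x : measurable (cell k x).
Proof. exact: measurable_set_leltr. Qed.

Let good : {ae P, forall w, D 0 w = 0 /\ forall s t : R, 0 <= s -> s <= t -> D s w <= D t w}.
Proof.
have := stable_nondecreasing stD; have := levy_start (stable_levy stD).
by apply: filterS2 => w.
Qed.

Let good_lattice w : D 0 w = 0 -> (forall s t : R, 0 <= s -> s <= t -> D s w <= D t w) ->
  forall k i, 0 <= D (k%:R * delta) w <= D ((k + i)%:R * delta) w.
Proof.
move=> D0 nD k i; have kd : 0 <= k%:R * delta by rewrite mulr_ge0// ltW.
apply/andP; split; first by have := nD _ _ (lexx 0) kd; rewrite D0.
by apply: nD => //; rewrite ler_wpM2r ?(ltW delta_gt0)// ler_nat leq_addr.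
Qed.

Lemma measurable_cell_snd d' (T' : measurableType d') (u : T' -> R) k :
  measurable_fun [set: T'] u ->
  measurable [set z : T' * T | cell k (u z.1) z.2].
Proof.
move=> mu'; apply: measurable_set_leltr.
- by apply: (measurableT_comp (f := D (k%:R * delta))).
- by apply: (measurableT_comp mu').
- by apply: (measurableT_comp (f := D (k.+1%:R * delta))).
Qed.

(** For a fixed path the cell is an interval of levels t, so Tonelli reduces the claim to an
    expectation of explicit exponentials. *)
Lemma laplace_cell j q : 0 < q ->
  (\int[mu]_(t in `]0%R, +oo[) ((expR (- (q * t)))%:E * P (cell j t)) =
   (a q ^+ j * (1 - a q) / q)%:E)%E.
Proof.
move=> q0.
pose A := [set z : R * T | cell j z.1 z.2].
have mA : measurable A by exact: (@measurable_cell_snd _ _ id).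
pose f (z : R * T) : \bar R := (expR (- (q * z.1)) * \1_A z)%:E.
have mf : measurable_fun [set: R * T] f.
  apply/measurable_EFinP; apply: measurable_funM; last exact: measurable_indic.
  exact: (measurableT_comp (measurable_expRM q)).
have f0 z : (0 <= f z)%E by rewrite lee_fin mulr_ge0 ?expR_ge0.
transitivity (\int[mu]_(t in `]0%R, +oo[) \int[P]_w f (t, w))%E.
  apply: eq_integral0y => t _.
  have <- : (\int[P]_w (\1_(cell j t) w)%:E = P (cell j t))%E.
    by rewrite integral_indic ?setIT//; exact: measurable_cell.
  rewrite -ge0_integralZl//.
  by apply/measurable_EFinP; apply: measurable_indic; exact: measurable_cell.
rewrite tonelli_setX// -(expectation_lattice_cell stD delta_gt0 j q0).
apply: ae_eq_integral => //.
- exact: measurable_integral_fst.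
- apply/measurable_EFinP; apply: measurable_funM => //; apply: measurable_funB.
    exact: (measurableT_comp (measurable_expRM q)).
  exact: (measurableT_comp (measurable_expRM q)).
- have := good; apply: filterS => w [D0 nD] _.
  have /andP[Sj0 _] := good_lattice D0 nD j 0.
  have /andP[_ Sj1] := good_lattice D0 nD j 1; rewrite addn1 in Sj1.
  rewrite -(integral_expR_indic q0 Sj0 Sj1).
  by apply: eq_integral => t _; rewrite /f !indicE.
Qed.

Lemma laplace_cells k j p q : 0 < q -> q < p ->
  (\int[mu]_(x in `]0%R, +oo[) \int[mu]_(t in `]0%R, +oo[)
      ((expR (- (p * x + q * t)))%:E * P (cell k x `&` cell (k + j.+1) (x + t)%R)) =
   (a p ^+ k * (a q - a p) / (p - q) * (a q ^+ j * (1 - a q) / q))%:E)%E.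
Proof.
move=> q0 qp; set m := (k + j.+1)%N.
pose A1 := [set z : (R * T) * R | cell k z.1.1 z.1.2].
pose A2 := [set z : (R * T) * R | cell m (z.1.1 + z.2) z.1.2].
have mD i : measurable_fun [set: (R * T) * R] (fun z => D (i%:R * delta) z.1.2).
  by apply: (measurableT_comp (f := D (i%:R * delta))) => //; exact: measurableT_comp.
have mfst : measurable_fun [set: (R * T) * R] (fun z => z.1.1) by exact: measurableT_comp.
have mA1 : measurable A1 by exact: measurable_set_leltr.
have mA2 : measurable A2 by apply: measurable_set_leltr => //; exact: measurable_funD.
pose f (z : (R * T) * R) : \bar R :=
  (expR (- (p * z.1.1 + q * z.2)) * (\1_A1 z * \1_A2 z))%:E.
have mf : measurable_fun [set: (R * T) * R] f.
  apply/measurable_EFinP; apply: measurable_funM.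
    apply: (measurableT_comp (@measurable_expR R)); apply: measurable_funN.
    by apply: measurable_funD; apply: measurable_funM.
  by apply: measurable_funM; exact: measurable_indic.
have f0 z : (0 <= f z)%E by rewrite lee_fin !mulr_ge0 ?expR_ge0.
pose F (z : R * T) := (\int[mu]_(t in `]0%R, +oo[) f (z, t))%E.
have mF : measurable_fun [set: R * T] F by exact: measurable_integral_snd.
have F0 z : (0 <= F z)%E by apply: integral_ge0.
transitivity (\int[mu]_(x in `]0%R, +oo[) \int[P]_w F (x, w))%E.
  apply: eq_integral0y => x _.
  have <- := @tonelli_setX _ _ _ _ R mu P _ setT (fun z => f ((x, z.2), z.1)).
  - apply: eq_integral0y => t _ /=.
    have mI : measurable (cell k x `&` cell m (x + t)).
      by apply: measurableI; exact: measurable_cell.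
    have <- : (\int[P]_w (\1_(cell k x `&` cell m (x + t)) w)%:E =
               P (cell k x `&` cell m (x + t)))%E.
      by rewrite integral_indic ?setIT.
    rewrite -ge0_integralZl//; last by apply/measurable_EFinP; exact: measurable_indic.
    by apply: eq_integral => w _; rewrite indicI -EFinM.
  - exact: measurable_itv.
  - exact: measurableT.
  - apply: (measurableT_comp mf); apply: measurable_fun_pair => //.
    by apply: measurable_fun_pair.
  - by move=> z.
rewrite tonelli_setX// -(expectation_lattice_cells stD delta_gt0 k j q0 qp).
apply: ae_eq_integral => //.
- exact: measurable_integral_fst.
- have mS u i : measurable_fun [set: T] (fun w => expR (- (u * D (i%:R * delta) w))).
    exact: (measurableT_comp (measurable_expRM u)).
  by apply/measurable_EFinP; apply: measurable_funM; apply: measurable_funM => //;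
    apply: measurable_funB.
- have := good; apply: filterS => w [D0 nD] _.
  have /andP[Sk0 _] := good_lattice D0 nD k 0.
  have /andP[_ Sk1] := good_lattice D0 nD k 1; rewrite addn1 in Sk1.
  have /andP[_ Skm] := good_lattice D0 nD k.+1 j; rewrite addSnnS -/m in Skm.
  have /andP[Sm0 Sm1] := good_lattice D0 nD m 1; rewrite addn1 in Sm1.
  set Sk := D (k%:R * delta) w in Sk0 Sk1 *.
  set Sk' := D (k.+1%:R * delta) w in Sk1 Skm *.
  set Sm := D (m%:R * delta) w in Skm Sm0 Sm1 *.
  set Sm' := D (m.+1%:R * delta) w in Sm1 *.
  have pq0 : 0 < p - q by rewrite subr_gt0.
  rewrite EFinM -(integral_expR_indic pq0 Sk0 Sk1) -ge0_integralZr//; last 2 first.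
  - apply: measurable_funTS; apply/measurable_EFinP; apply: measurable_funM.
      exact: measurable_expRM.
    by apply: measurable_indic; exact: measurable_set_leltr.
  - by rewrite lee_fin divr_ge0 ?(ltW q0)// subr_ge0 ler_expR lerN2 ler_wpM2l// ltW.
  apply: eq_integral0y => x x0.
  have [xk|xk] := boolP (Sk <= x < Sk'); last first.
    rewrite indicE memNset ?mulr0 ?mul0e; last by apply/negP.
    apply: integral0_eq => t _; rewrite /f/= indicE memNset ?mul0r ?mulr0//.
    exact/negP.
  rewrite indicE mem_set// mulr1.
  (* Since m >= k + 1, x lies below [Sm], so the constraint t > 0 cuts nothing off the interval [Sm
     - x, Sm' - x[. *)
  have xSm : x < Sm by case/andP: xk => _ h; exact: lt_le_trans Skm.
  transitivity ((expR (- (p * x)))%:E * \int[mu]_(t in `]0%R, +oo[)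
      (expR (- (q * t)) * \1_[set y | (Sm - x <= y < Sm' - x)%R] t)%:E)%E.
    rewrite -ge0_integralZl//; last first.
      apply: measurable_funTS; apply/measurable_EFinP; apply: measurable_funM.
        exact: measurable_expRM.
      by apply: measurable_indic; exact: measurable_set_leltr.
    apply: eq_integral0y => t t0; rewrite /f/= opprD expRD -EFinM -mulrA.
    congr (_ * (_ * _))%:E; rewrite indicE mem_set// mul1r !indicE; congr ((_ : bool)%:R).
    by apply/idP/idP; rewrite !inE /A2 /cell/= lerBlDl ltrBrDl.
  rewrite integral_expR_indic//; last 2 first.
  - by rewrite subr_ge0 ltW.
  - by rewrite lerB.
  rewrite -!EFinM; congr EFin; rewrite [LHS]mulrA [RHS]mulrA; congr (_ / _).
  rewrite mulrBr [RHS]mulrBr -!expRD; congr (expR _ - expR _); ring.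
Qed.

End lattice_cells.

Lemma nneseries_geometric (R : realType) (z C : R) : 0 <= z < 1 ->
  (\sum_(0 <= k <oo) (z ^+ k * C)%:E = (C / (1 - z))%:E)%E.
Proof.
move=> /andP[z0 z1]; apply/cvg_lim => //.
under eq_fun do rewrite sumEFin.
apply: cvg_EFin; first exact: nearW.
have := @cvg_geometric_series R C z; rewrite ger0_norm// => /(_ z1).
by apply: cvg_trans; apply: near_eq_cvg; apply: nearW => n;
  rewrite /series/=; apply: eq_bigr => k _; rewrite mulrC.
Qed.

Lemma ge0_emeasurable_nneseries d (T : measurableType d) (R : realType) (D : set T)
  (h : nat -> T -> \bar R) :
  (forall k x, D x -> 0 <= h k x)%E -> (forall k, measurable_fun D (h k)) ->
  measurable_fun D (fun x => \sum_(0 <= k <oo) h k x)%E.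
Proof.
move=> h0 mh.
have := @ge0_emeasurable_sum d T R D h xpredT; apply => //.
by move=> k x Dx _; exact: h0.
Qed.

(** * Transforms of the series over cells *)

Section lattice_series.
Context d (T : measurableType d) (R : realType) (P : probability T R).
Notation mu := (@lebesgue_measure R).
Variables (alpha c : R) (D : R -> {RV P >-> R}).
Hypothesis alpha_gt0 : 0 < alpha.
Hypothesis c_gt0 : 0 < c.
Hypothesis stD : stable_subordinator alpha c D.
Variable delta : R.
Hypothesis delta_gt0 : 0 < delta.
Variable gam : nat -> R.
Hypothesis gam01 : forall j, 0 <= gam j <= 1.

Local Notation a := (lattice_laplace alpha c delta).
Local Notation cell := (cell D delta).

Let gam_ge0 j : 0 <= gam j. Proof. by case/andP: (gam01 j). Qed.

(* With [gam j] the mean of [g] at time [j * delta], these are the means of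
   [g (Y t)] and of [g (Y (x + t) - Y x)] when first passage times are rounded
   up to the next multiple of [delta]. *)
Definition lattice_position (t : R) : \bar R :=
  (\sum_(0 <= j <oo) (gam j.+1)%:E * P (cell j t))%E.

Definition lattice_increment (x t : R) : \bar R :=
  (\sum_(0 <= k <oo) \sum_(0 <= j <oo)
    (gam j.+1)%:E * P (cell k x `&` cell (k + j.+1) (x + t)))%E.

Lemma lattice_laplace_itv u : 0 < u -> 0 < a u < 1.
Proof.
move=> u0; rewrite expR_gt0 expR_lt1 oppr_lt0.
by rewrite !mulr_gt0// powR_gt0.
Qed.

Let measurable_prob d' (T' : measurableType d') (A : set (T' * T)) : measurable A ->
  measurable_fun [set: T'] (fun x => P [set w | A (x, w)]).
Proof.
move=> mA.
rewrite (_ : (fun x => _) = (fun x => \int[P]_w (\1_A (x, w))%:E)%E).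
  apply: (@measurable_integral_snd _ _ _ _ _ P setT (fun z => (\1_A z)%:E)) => //.
  by apply/measurable_EFinP; exact: measurable_indic.
apply/funext => x.
have mAx : measurable [set w | A (x, w)].
  have := measurable_xsection x mA; congr (measurable _).
  by apply/seteqP; split => w; rewrite /xsection/= inE.
transitivity (\int[P]_w (\1_[set w | A (x, w)] w)%:E)%E.
  by rewrite integral_indic// setIT.
by apply: eq_integral => w _; rewrite !indicE.
Qed.

Lemma measurable_prob_cell k : measurable_fun [set: R] (fun t => P (cell k t)).
Proof.
apply: (@measurable_prob _ _ [set z : R * T | cell k z.1 z.2]).
exact: (@measurable_cell_snd _ _ _ _ _ _ _ _ id).
Qed.

Lemma measurable_prob_cells k m :
  measurable_fun [set: R * R] (fun z => P (cell k z.1 `&` cell m (z.1 + z.2))).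
Proof.
apply: (@measurable_prob _ _ [set z : (R * R) * T | (cell k z.1.1 `&` cell m (z.1.1 + z.1.2)) z.2]).
apply: measurableI; first exact: (@measurable_cell_snd _ _ _ _ _ _ _ _ fst).
apply: (@measurable_cell_snd _ _ _ _ _ _ _ _ (fun z : R * R => z.1 + z.2)).
exact: measurable_funD.
Qed.

Lemma measurable_lattice_position : measurable_fun [set: R] lattice_position.
Proof.
apply: ge0_emeasurable_nneseries => [k x _|k]; first by rewrite mule_ge0// lee_fin.
by apply: emeasurable_funM => //; exact: measurable_prob_cell.
Qed.

Lemma measurable_lattice_increment :
  measurable_fun [set: R * R] (fun z => lattice_increment z.1 z.2).
Proof.
apply: ge0_emeasurable_nneseries => [k x _|k].
  by apply: nneseries_ge0 => j _ _; rewrite mule_ge0// lee_fin.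
apply: ge0_emeasurable_nneseries => [j x _|j]; first by rewrite mule_ge0// lee_fin.
by apply: emeasurable_funM => //; exact: measurable_prob_cells.
Qed.

Lemma laplace_lattice_position q : 0 < q ->
  (\int[mu]_(t in `]0%R, +oo[) ((expR (- (q * t)))%:E * lattice_position t) =
   \sum_(0 <= j <oo) (gam j.+1 * (a q ^+ j * ((1 - a q) / q)))%:E)%E.
Proof.
move=> q0.
transitivity (\int[mu]_(t in `]0%R, +oo[) \sum_(0 <= j <oo)
   ((gam j.+1)%:E * ((expR (- (q * t)))%:E * P (cell j t))))%E.
  apply: eq_integral0y => t _; rewrite -nneseriesZl; last first.
    by move=> j _; rewrite mule_ge0// lee_fin.
  by apply: eq_eseriesr => j _; rewrite muleCA.
have m1 j : measurable_fun [set: R] (fun t => (expR (- (q * t)))%:E * P (cell j t))%E.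
  apply: emeasurable_funM; last exact: measurable_prob_cell.
  by apply/measurable_EFinP; exact: measurable_expRM.
rewrite integral_nneseries//; last 2 first.
- by move=> j; apply: measurable_funTS; apply: emeasurable_funM => //; exact: m1.
- by move=> j t _; rewrite !mule_ge0// lee_fin ?expR_ge0.
apply: eq_eseriesr => j _.
rewrite ge0_integralZl//; last 3 first.
- by apply: measurable_funTS; exact: m1.
- by move=> t _; rewrite mule_ge0// lee_fin expR_ge0.
- by rewrite lee_fin.
by rewrite (laplace_cell stD)// -EFinM -!mulrA.
Qed.

(** The transform of each pair of cells is a factor in k times a factor in j: the series in k is
    geometric of ratio [a p], and the series in j is the one of [laplace_lattice_position]. *)
Lemma laplace_lattice_increment p q : 0 < q -> q < p ->
  (\int[mu]_(x in `]0%R, +oo[) \int[mu]_(t in `]0%R, +oo[)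
     ((expR (- (p * x + q * t)))%:E * lattice_increment x t) =
   ((a q - a p) / (1 - a p) / (p - q))%:E *
   \int[mu]_(t in `]0%R, +oo[) ((expR (- (q * t)))%:E * lattice_position t))%E.
Proof.
move=> q0 qp; have p0 := lt_trans q0 qp.
have /andP[ap0 ap1] := lattice_laplace_itv p0.
have /andP[aq0 aq1] := lattice_laplace_itv q0.
pose h k j (z : R * R) := ((gam j.+1)%:E * ((expR (- (p * z.1 + q * z.2)))%:E *
   P (cell k z.1 `&` cell (k + j.+1) (z.1 + z.2)%R)))%E.
have h0 k j z : (0 <= h k j z)%E by rewrite !mule_ge0// lee_fin ?expR_ge0.
have mexp2 : measurable_fun [set: R * R] (fun z : R * R => (expR (- (p * z.1 + q * z.2)))%:E).
  apply/measurable_EFinP.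
  apply: (measurableT_comp (@measurable_expR R)); apply: measurable_funN.
  by apply: measurable_funD; apply: measurable_funM.
have mh k j : measurable_fun [set: R * R] (h k j).
  apply: emeasurable_funM => //; apply: emeasurable_funM => //.
  exact: measurable_prob_cells.
have mhx k j x : measurable_fun [set: R] (fun t => h k j (x, t)).
  by apply: (measurableT_comp (mh k j)); exact: measurable_fun_pair.
pose H k z := (\sum_(0 <= j <oo) h k j z)%E.
have H0 k z : (0 <= H k z)%E by exact: nneseries_ge0.
have mH k : measurable_fun [set: R * R] (H k) by exact: ge0_emeasurable_nneseries.
have mHx k x : measurable_fun [set: R] (fun t => H k (x, t)).
  by apply: (measurableT_comp (mH k)); exact: measurable_fun_pair.
have E x t : ((expR (- (p * x + q * t)))%:E * lattice_increment x t =
    \sum_(0 <= k <oo) H k (x, t))%E.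
  rewrite -nneseriesZl; last first.
    by move=> k _; apply: nneseries_ge0 => j _ _; rewrite mule_ge0// lee_fin.
  apply: eq_eseriesr => k _; rewrite -nneseriesZl; last first.
    by move=> j _; rewrite mule_ge0// lee_fin.
  by apply: eq_eseriesr => j _; rewrite muleCA.
pose X := (\sum_(0 <= j <oo) (gam j.+1 * (a q ^+ j * ((1 - a q) / q)))%:E)%E.
have X0 : (0 <= X)%E.
  apply: nneseries_ge0 => j _ _.
  by rewrite lee_fin !mulr_ge0 ?exprn_ge0 ?invr_ge0 ?(ltW aq0) ?(ltW q0)// subr_ge0 ltW.
(* Weights at most 1 bound the series by a geometric one; finiteness lets [X] act as a real constant
   in the sum over k. *)
have Xfin : X \is a fin_num.
  rewrite ge0_fin_numE//; apply: (@le_lt_trans _ _ ((1 - a q) / q / (1 - a q))%:E); last by rewrite ltry.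
  rewrite -nneseries_geometric ?(ltW aq0)//; apply: lee_nneseries => j _.
    by rewrite lee_fin !mulr_ge0 ?exprn_ge0 ?invr_ge0 ?(ltW aq0) ?(ltW q0)// subr_ge0 ltW.
  rewrite lee_fin ler_piMl ?(andP (gam01 _)).2//.
  by rewrite !mulr_ge0 ?exprn_ge0 ?invr_ge0 ?(ltW aq0) ?(ltW q0)// subr_ge0 ltW.
have int_H k : (\int[mu]_(x in `]0%R, +oo[) \int[mu]_(t in `]0%R, +oo[) H k (x, t) =
   (a p ^+ k * ((a q - a p) / (p - q)))%:E * X)%E.
  transitivity (\int[mu]_(x in `]0%R, +oo[) \sum_(0 <= j <oo) \int[mu]_(t in `]0%R, +oo[) h k j (x, t))%E.
    apply: eq_integral0y => x _; rewrite integral_nneseries//.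
    by move=> j; apply: measurable_funTS; exact: mhx.
  rewrite integral_nneseries//; last 2 first.
  - move=> j; apply: measurable_funTS.
    by apply: (@measurable_integral_snd _ _ _ _ _ mu _ (h k j)); [exact: measurable_itv|exact: mh|exact: h0].
  - by move=> j x _; exact: integral_ge0.
  rewrite -nneseriesZl; last first.
    move=> j _.
    by rewrite lee_fin !mulr_ge0 ?exprn_ge0 ?invr_ge0 ?(ltW aq0) ?(ltW q0)// subr_ge0 ltW.
  apply: eq_eseriesr => j _.
  pose h' (z : R * R) := ((expR (- (p * z.1 + q * z.2)))%:E *
   P (cell k z.1 `&` cell (k + j.+1) (z.1 + z.2)%R))%E.
  have mh' : measurable_fun [set: R * R] h'.
    by apply: emeasurable_funM => //; exact: measurable_prob_cells.
  have h'0 z : (0 <= h' z)%E by rewrite mule_ge0// lee_fin expR_ge0.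
  transitivity (\int[mu]_(x in `]0%R, +oo[) ((gam j.+1)%:E * \int[mu]_(t in `]0%R, +oo[) h' (x, t)))%E.
    apply: eq_integral0y => x _; rewrite -ge0_integralZl ?lee_fin//.
    by apply: measurable_funTS; apply: (measurableT_comp mh'); exact: measurable_fun_pair.
  rewrite ge0_integralZl ?lee_fin//; last 2 first.
  - apply: measurable_funTS.
    exact: (@measurable_integral_snd _ _ _ _ _ mu _ h').
  - by move=> x _; exact: integral_ge0.
  rewrite (laplace_cells stD delta_gt0 k j q0 qp) -!EFinM; congr EFin; ring.
transitivity (\int[mu]_(x in `]0%R, +oo[) \sum_(0 <= k <oo) \int[mu]_(t in `]0%R, +oo[) H k (x, t))%E.
  apply: eq_integral0y => x _; rewrite -integral_nneseries//.
    by apply: eq_integral0y => t _; exact: E.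
  by move=> k; apply: measurable_funTS; exact: mHx.
rewrite integral_nneseries//; last 2 first.
- move=> k; apply: measurable_funTS.
  by apply: (@measurable_integral_snd _ _ _ _ _ mu _ (H k)); [exact: measurable_itv|exact: mH|exact: H0].
- by move=> k x _; exact: integral_ge0.
under eq_eseriesr do rewrite int_H.
rewrite laplace_lattice_position// -/X -(fineK Xfin).
under eq_eseriesr do rewrite muleC.
rewrite nneseriesZl; last first.
  move=> k _; rewrite lee_fin mulr_ge0 ?exprn_ge0 ?(ltW ap0)// divr_ge0 ?subr_ge0 ?(ltW qp)//.
  rewrite ler_expR lerN2 ler_wpM2l// ?mulr_ge0 ?(ltW delta_gt0) ?(ltW c_gt0)//.
  by rewrite ge0_ler_powR ?nnegrE// ltW.
rewrite nneseries_geometric ?(ltW ap0)// muleC; congr (_%:E * _)%E.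
by field; rewrite !gt_eqF ?subr_gt0.
Qed.

End lattice_series.

(** * Passage to the limit *)

Section first_passage.
Context {R : realType}.
Implicit Types (y : R -> R) (s t : R).

(** The path properties of [D], true almost surely, under which the infimum below is over a nonempty
    set and every nonnegative level falls in a cell. *)
Definition unbounded_nondecreasing y :=
  [/\ y 0 = 0, (forall s t, 0 <= s -> s <= t -> y s <= y t) &
      forall M : R, exists n : nat, M < y n%:R].

(** The pathwise form of [inverse_process], convertible to it when [y] is a path of the process. *)
Definition first_passage y t := inf [set s | 0 <= s /\ t < y s].

Variable y : R -> R.
Hypothesis gy : unbounded_nondecreasing y.

Lemma has_inf_first_passage t : has_inf [set s | 0 <= s /\ t < y s].
Proof.
have [_ _ unb] := gy; split.
  by have [n tn] := unb t; exists n%:R; split.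
by exists 0 => s [].
Qed.

Lemma first_passage_ge0 t : 0 <= first_passage y t.
Proof. by apply: lb_le_inf; [case: (has_inf_first_passage t)|move=> s []]. Qed.

Lemma first_passage_le t s : 0 <= s -> t < y s -> first_passage y t <= s.
Proof. by move=> s0 ts; apply: ge_inf => //; case: (has_inf_first_passage t). Qed.

Lemma first_passage_ge t s : 0 <= s -> y s <= t -> s <= first_passage y t.
Proof.
have [_ nd _] := gy.
move=> s0 ys; apply: lb_le_inf; first by case: (has_inf_first_passage t).
move=> r [r0 tr]; rewrite leNgt; apply/negP => rs.
by have := lt_le_trans tr (nd _ _ r0 (ltW rs)); rewrite ltNge ys.
Qed.

(** A time s close to the infimum with t < y s remains admissible for levels slightly above t: first
    passage times are right-continuous in the level. *)
Lemma first_passage_cvg t (u : nat -> R) : (forall n, t <= u n) ->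
  u n @[n --> \oo] --> t ->
  first_passage y (u n) @[n --> \oo] --> first_passage y t.
Proof.
move=> tu cu; apply/cvgrPdist_lt => e e0.
have [s [s0 ts] se] := inf_adherent e0 (has_inf_first_passage t).
have mono n : first_passage y t <= first_passage y (u n).
  apply: lb_le_inf; first by case: (has_inf_first_passage (u n)).
  by move=> r [r0 ur]; apply: first_passage_le => //; exact: le_lt_trans ur.
have : \forall n \near \oo, u n < y s by move/cvgrPdist_lt : cu => /(_ (y s - t));
  rewrite subr_gt0 => /(_ ts); apply: filterS => n; rewrite ltr_distlC => /andP[_]; rewrite addrC subrK.
apply: filterS => n us.
rewrite ler0_norm ?subr_le0// opprB ltrBlDr (le_lt_trans (first_passage_le s0 us))//.
by rewrite addrC.
Qed.

Variable delta : R.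
Hypothesis delta_gt0 : 0 < delta.

Lemma lattice_index t : 0 <= t ->
  exists k : nat, y (k%:R * delta) <= t < y (k.+1%:R * delta).
Proof.
have [y0 nd unb] := gy => t0.
have ex : exists n : nat, t < y (n%:R * delta).
  have [n tn] := unb t; exists (Num.truncn (n%:R / delta)).+1.
  rewrite (lt_le_trans tn)// nd// -ler_pdivrMr// ltW// truncnS_gt//.
(* The least such index is positive because y 0 = 0 <= t, and its predecessor indexes the cell. *)
case: (ex_minnP ex) => -[|k] tk mink; first by rewrite mul0r y0 ltNge t0 in tk.
exists k; rewrite tk andbT leNgt; apply/negP => /mink.
by rewrite ltnn.
Qed.

Lemma lattice_index_le t k s k' : y (k%:R * delta) <= t < y (k.+1%:R * delta) ->
  t <= s -> y (k'%:R * delta) <= s < y (k'.+1%:R * delta) -> (k <= k')%N.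
Proof.
have [_ nd _] := gy.
move=> /andP[kt _] ts /andP[_ sk']; rewrite leqNgt; apply/negP => kk'.
have := le_trans kt ts; rewrite leNgt (lt_le_trans sk')// nd//.
  by rewrite mulr_ge0// ltW.
by rewrite ler_wpM2r ?(ltW delta_gt0)// ler_nat.
Qed.

(** Rounding from above, with error at most the mesh, is what lets right-continuity of the paths of
    [A] act in the limit. *)
Lemma lattice_index_first_passage t k : y (k%:R * delta) <= t < y (k.+1%:R * delta) ->
  first_passage y t <= k.+1%:R * delta <= first_passage y t + delta.
Proof.
move=> /andP[kt tk]; rewrite first_passage_le//=; last by rewrite mulr_ge0// ltW.
rewrite -natr1 mulrDl mul1r lerD2r first_passage_ge// mulr_ge0// ltW//.
Qed.

End first_passage.

(** The filter [l^'+] leaves out l itself, whereas the sequences of times and levels used below may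
    take the value l. *)
Lemma cvg_right_continuous (R : realType) (f : R -> R) (l : R) (u : nat -> R) :
  f x @[x --> l^'+] --> f l -> (forall n, l <= u n) -> u n @[n --> \oo] --> l ->
  f (u n) @[n --> \oo] --> f l.
Proof.
move=> /cvgrPdist_lt cf lu cu; apply/cvgrPdist_lt => e e0.
have [r /= r0 fr] := cf _ e0.
have : \forall n \near \oo, `|l - u n| < r by move/cvgrPdist_lt : cu; apply.
apply: filterS => n lun; have := lu n; rewrite le_eqVlt => /predU1P[<-|llu].
  by rewrite subrr normr0.
exact: fr.
Qed.

Lemma nneseries_single (R : realType) (f : nat -> \bar R) k0 :
  (forall k, 0 <= f k)%E -> (forall k, k != k0 -> f k = 0%E) ->
  (\sum_(0 <= k <oo) f k = f k0)%E.
Proof.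
move=> f0 fk; rewrite (@nneseriesD1 _ f k0)// eseries0 ?adde0// => k _ kk0.
exact: fk.
Qed.

Section stable_paths.
Context d (T : measurableType d) (R : realType) (P : probability T R).
Variables (alpha c : R) (D : R -> {RV P >-> R}).
Hypothesis c_gt0 : 0 < c.
Hypothesis stD : stable_subordinator alpha c D.

(* [E (\sum_n exp (- D_n)) = \sum_n exp (- n c)] is finite, so [D_n] is
   almost surely unbounded. *)
Lemma stable_unbounded : {ae P, forall w, forall M : R, exists n : nat, M < D n%:R w}.
Proof.
pose f (w : T) : \bar R := (\sum_(0 <= n <oo) (expR (- (1 * D n%:R w)))%:E)%E.
have m1 n : measurable_fun [set: T] (fun w => (expR (- (1 * D n%:R w)))%:E).
  by apply/measurable_EFinP; exact: (measurableT_comp (measurable_expRM 1)).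
have f0 w : (0 <= f w)%E by apply: nneseries_ge0 => n _ _; rewrite lee_fin expR_ge0.
have : P.-integrable [set: T] f.
  apply/integrableP; split; first exact: ge0_emeasurable_nneseries.
  under eq_integral do rewrite gee0_abs//.
  rewrite integral_nneseries//.
  under eq_eseriesr.
    move=> n _; rewrite (laplace_stable stD)// powR1 mulr1 -mulrN.
    rewrite expRM_natl -[X in X%:E]mulr1.
    over.
  by rewrite nneseries_geometric ?ltry// expR_ge0 expR_lt1 oppr_lt0.
move=> /(integrable_ae measurableT); apply: filterS => w /(_ I) fw M.
apply: contrapT => /forallNP DM.
have DM' n : D n%:R w <= M by rewrite leNgt; apply/negP/DM.
have lb (n : nat) : ((n%:R * expR (- M))%:E <= f w)%E.
  apply: le_trans (nneseries_lim_ge n _); last by move=> k _ _; rewrite lee_fin expR_ge0.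
  rewrite sumEFin lee_fin big_mkord mulr_natl -[X in _ *+ X <= _](card_ord n) -sumr_const.
  by apply: ler_sum => i _; rewrite mul1r ler_expR lerN2.
have := lb (Num.truncn (fine (f w) / expR (- M))).+1.
rewrite -(fineK fw) lee_fin leNgt -ltr_pdivrMr ?expR_gt0//.
by rewrite truncnS_gt.
Qed.

Lemma stable_good_paths : {ae P, forall w, unbounded_nondecreasing (D ^~ w)}.
Proof.
have := stable_nondecreasing stD; have := levy_start (stable_levy stD).
have := stable_unbounded; apply: filterS3 => w; by split.
Qed.

End stable_paths.

Section process_sigma_algebra.
Context d (T : measurableType d) (R : realType) (P : probability T R).
Variable X : R -> {RV P >-> R}.

Let G : set (set T) := [set S | exists t : R, 0 <= t /\
       exists U : set R, measurable U /\ S = X t @^-1` U].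

(** Giving [T] the sigma-algebra generated by the process turns membership in it into measurability,
    so that the general closure lemmas apply. *)
Let measurable_X t : 0 <= t ->
  measurable_fun [set: g_sigma_algebraType G] (X t : g_sigma_algebraType G -> R).
Proof.
move=> t0 _ U mU; apply: sub_sigma_algebra; exists t; split => //.
by exists U; split => //; rewrite setTI.
Qed.

Lemma process_sigma_algebra_increment s t U : 0 <= s -> 0 <= t -> measurable U ->
  process_sigma_algebra X (increment X s t @^-1` U).
Proof.
move=> s0 t0 mU.
have : measurable_fun [set: g_sigma_algebraType G] (increment X s t : g_sigma_algebraType G -> R).
  by apply: measurable_funB; exact: measurable_X.
by move=> /(_ measurableT _ mU); rewrite setTI.
Qed.

Lemma process_sigma_algebra_cells delta k m x y : 0 < delta ->
  process_sigma_algebra X (cell X delta k x `&` cell X delta m y).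
Proof.
move=> d0; have kd (i : nat) : 0 <= i%:R * delta by rewrite mulr_ge0// ltW.
have : @measurable _ (g_sigma_algebraType G) (cell X delta k x `&` cell X delta m y).
  by apply: measurableI; apply: measurable_set_leltr => //; exact: measurable_X.
by [].
Qed.

Lemma process_sigma_algebraC S : process_sigma_algebra X S ->
  process_sigma_algebra X (~` S).
Proof.
by move=> mS; exact: (@measurableC _ (g_sigma_algebraType G) S mS).
Qed.

End process_sigma_algebra.

(** * Means over rounded passage times and their limits for small mesh *)

Section lattice_approximation.
Context d (T : measurableType d) (R : realType) (P : probability T R).
Variables (alpha c : R) (A D Y : R -> {RV P >-> R}).
Hypothesis c_gt0 : 0 < c.
Hypothesis levyA : levy_process A.
Hypothesis stD : stable_subordinator alpha c D.
Hypothesis indAD : independent_processes A D.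
Hypothesis YE : time_changed A (inverse_process D) Y.
Variable g : R -> R.
Hypothesis cg : continuous g.
Hypothesis g01 : forall x, 0 <= g x <= 1.
Hypothesis g0 : g 0 = 0.

Let g_ge0 x : 0 <= g x. Proof. by case/andP: (g01 x). Qed.
Let g_le1 x : g x <= 1. Proof. by case/andP: (g01 x). Qed.
Let mg : measurable_fun [set: R] g. Proof. exact: continuous_measurable_fun. Qed.
Let mgE : measurable_fun [set: R] (EFin \o g). Proof. exact/measurable_EFinP. Qed.

(** The increment from time 0 replaces the value of [A] because stationarity delivers means in this
    form, [A 0] being 0 only almost surely. *)
Definition lattice_weight (delta : R) (j : nat) : R :=
  fine (\int[P]_w (g (increment A 0 (j%:R * delta) w))%:E).

Let mean_le1 (X : T -> R) : measurable_fun [set: T] X ->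
  (0 <= \int[P]_w (g (X w))%:E <= 1)%E.
Proof.
move=> mX; apply/andP; split; first by apply: integral_ge0 => w _; rewrite lee_fin.
rewrite -(probability_setT P) -[leRHS]mul1e -integral_cst//.
apply: ge0_le_integral => //.
- by move=> w _; rewrite lee_fin.
- exact: (measurableT_comp mgE).
- by move=> w _; rewrite lee_fin.
Qed.

Let lattice_weightE delta j : (lattice_weight delta j)%:E =
  (\int[P]_w (g (increment A 0 (j%:R * delta) w))%:E)%E.
Proof.
have /andP[i0 i1] := mean_le1 (measurable_increment A 0 (j%:R * delta)).
by rewrite fineK// ge0_fin_numE// (le_lt_trans i1)// ltry.
Qed.

Lemma lattice_weight01 delta j : 0 <= lattice_weight delta j <= 1.
Proof. by rewrite -!lee_fin lattice_weightE mean_le1//; exact: measurable_increment. Qed.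

Section fixed_mesh.
Variable delta : R.
Hypothesis delta_gt0 : 0 < delta.
Local Notation cell := (cell D delta).
Local Notation gam := (lattice_weight delta).

Let kd (i : nat) : 0 <= i%:R * delta. Proof. by rewrite mulr_ge0// ltW. Qed.

(** The cells belong to the sigma-algebra of [D] and are therefore independent of the increment of
    [A], whose mean depends only on its length by stationarity. All times involved are
    deterministic, which is the gain of the lattice. *)
Let integral_increment_cells (k m i j : nat) x y :
  (\int[P]_w ((g (increment A (i%:R * delta) ((i + j)%:R * delta) w))%:E *
     (\1_(cell k x `&` cell m y) w)%:E) =
   (gam j)%:E * P (cell k x `&` cell m y))%E.
Proof.
rewrite lattice_weightE.
have -> : (i + j)%:R * delta = i%:R * delta + j%:R * delta by rewrite natrD mulrDl.
have gE0 z : (0 <= (EFin \o g) z)%E by rewrite lee_fin.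
rewrite -(integral_stationary (levy_stationary levyA) (kd i) (kd j) mgE gE0).
have sA U : measurable U -> process_sigma_algebra A
    (increment A (i%:R * delta) (i%:R * delta + j%:R * delta) @^-1` U).
  by move=> mU; apply: process_sigma_algebra_increment => //; rewrite addr_ge0.
apply: (@integral_indic_indep _ _ _ P (increment_rv A (i%:R * delta) (i%:R * delta + j%:R * delta)) _ (EFin \o g)) => //.
- by apply: measurableI; exact: measurable_cell.
- by move=> U mU; apply: indAD; [exact: sA|exact: process_sigma_algebra_cells].
- move=> U mU; apply: indAD; first exact: sA.
  by apply: process_sigma_algebraC; exact: process_sigma_algebra_cells.
Qed.

(* For almost every path exactly one pair of cells contributes, except that none
   does when [x] and [x + t] share a cell; the value is then [g 0 = 0]. The odd
   shape [(0 + j.+1)%:R] below makes the terms instances of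
   [integral_increment_cells]. *)
Definition increment_functional x t (w : T) : \bar R :=
  (\sum_(0 <= k <oo) \sum_(0 <= j <oo)
    ((g (increment A (k.+1%:R * delta) ((k.+1 + j.+1)%:R * delta) w))%:E *
     (\1_(cell k x `&` cell (k + j.+1) (x + t)) w)%:E))%E.

Definition position_functional t (w : T) : \bar R :=
  (\sum_(0 <= j <oo)
    ((g (increment A (0%:R * delta) ((0 + j.+1)%:R * delta) w))%:E *
     (\1_(cell j t `&` cell j t) w)%:E))%E.

Let mterm i j k m x y : measurable_fun [set: T] (fun w =>
  ((g (increment A (i%:R * delta) ((i + j)%:R * delta) w))%:E *
     (\1_(cell k x `&` cell m y) w)%:E)%E).
Proof.
apply: emeasurable_funM.
  by apply: (measurableT_comp mgE); exact: measurable_increment.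
apply/measurable_EFinP; apply: measurable_indic.
by apply: measurableI; exact: measurable_cell.
Qed.

Let term_ge0 i j k m x y w : (0 <=
  ((g (increment A (i%:R * delta) ((i + j)%:R * delta) w))%:E *
     (\1_(cell k x `&` cell m y) w)%:E))%E.
Proof. by rewrite mule_ge0// lee_fin. Qed.

Lemma measurable_increment_functional x t :
  measurable_fun [set: T] (increment_functional x t).
Proof.
apply: ge0_emeasurable_nneseries => [k w _|k]; first exact: nneseries_ge0.
by apply: ge0_emeasurable_nneseries => [j w _|j].
Qed.

Lemma measurable_position_functional t :
  measurable_fun [set: T] (position_functional t).
Proof. by apply: ge0_emeasurable_nneseries => [j w _|j]. Qed.

Lemma integral_increment_functional x t :
  (\int[P]_w increment_functional x t w = lattice_increment D delta gam x t)%E.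
Proof.
rewrite integral_nneseries//; last 2 first.
- by move=> k; apply: ge0_emeasurable_nneseries => [j w _|j].
- by move=> k w _; exact: nneseries_ge0.
apply: eq_eseriesr => k _; rewrite integral_nneseries//.
by apply: eq_eseriesr => j _; exact: integral_increment_cells.
Qed.

Lemma integral_position_functional t :
  (\int[P]_w position_functional t w = lattice_position D delta gam t)%E.
Proof.
rewrite integral_nneseries//.
by apply: eq_eseriesr => j _; rewrite integral_increment_cells setIid.
Qed.

Let indic_cell w k0 x k : unbounded_nondecreasing (D ^~ w) ->
  cell k0 x w -> k != k0 -> ~ cell k x w.
Proof.
move=> gw ck0 kk0 ck; move/eqP: kk0; apply; apply/eqP; rewrite eqn_leq.
by rewrite (lattice_index_le gw delta_gt0 ck (lexx x) ck0)
  (lattice_index_le gw delta_gt0 ck0 (lexx x) ck).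
Qed.

Lemma increment_functional_value x t w : unbounded_nondecreasing (D ^~ w) ->
  0 <= x -> 0 <= t -> exists k m : nat,
  [/\ cell k x w, cell m (x + t) w &
      increment_functional x t w = (g (increment A (k.+1%:R * delta) (m.+1%:R * delta) w))%:E].
Proof.
move=> gw x0 t0.
have [k ck] := lattice_index gw delta_gt0 x0.
have [m cm] := lattice_index gw delta_gt0 (addr_ge0 x0 t0).
have km : (k <= m)%N by apply: (lattice_index_le gw delta_gt0 ck _ cm); rewrite lerDl.
exists k, m; split => //; rewrite /increment_functional.
rewrite (@nneseries_single _ _ k); last 2 first.
- by move=> i; exact: nneseries_ge0.
- move=> i ik; apply: eseries0 => j _ _.
  by rewrite indicE memNset ?mule0// => -[/(indic_cell gw ck ik)].
have [mk|km'] := leqP m k.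
  have {km mk} E : m = k by apply/eqP; rewrite eqn_leq mk.
  rewrite E /increment subrr g0; apply: eseries0 => j _ _.
  rewrite indicE memNset ?mule0// => -[_]; apply: (indic_cell gw cm).
  by rewrite E -[X in _ != X]addn0 eqn_add2l.
(* The summand j stands for the pair of cells k and k + j + 1. *)
rewrite (@nneseries_single _ _ (m - k).-1); last 2 first.
- by [].
- move=> j jm; rewrite indicE memNset ?mule0// => -[_]; apply: (indic_cell gw cm).
  apply: contra_neq jm => <-; by rewrite addnC addnK.
have -> : (k + (m - k).-1.+1)%N = m by rewrite prednK ?subn_gt0// subnKC// ltnW.
have -> : (k.+1 + (m - k).-1.+1)%N = m.+1.
  by rewrite prednK ?subn_gt0// addSn subnKC// ltnW.
by rewrite indicE mem_set// mule1.
Qed.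

Lemma position_functional_value t w : unbounded_nondecreasing (D ^~ w) -> 0 <= t ->
  exists k : nat, cell k t w /\
    position_functional t w = (g (increment A 0 (k.+1%:R * delta) w))%:E.
Proof.
move=> gw t0; have [k ck] := lattice_index gw delta_gt0 t0.
exists k; split => //; rewrite /position_functional (@nneseries_single _ _ k); last 2 first.
- by [].
- move=> j jk; rewrite indicE memNset ?mule0// => -[+ _].
  exact: (indic_cell gw ck jk).
by rewrite indicE mem_set// mule1 mul0r.
Qed.

End fixed_mesh.

Let mesh (n : nat) : R := n.+1%:R^-1.
Let mesh_gt0 n : 0 < mesh n. Proof. by rewrite invr_gt0. Qed.

(** The rounded times lie between the passage time and the passage time plus the mesh, so
    right-continuity of the path of [A] applies even if it jumps there. *)
Lemma lattice_time_cvg w t (k : nat -> nat) : unbounded_nondecreasing (D ^~ w) ->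
  cadlag (A ^~ w) ->
  (forall n, cell D (mesh n) (k n) t w) ->
  A ((k n).+1%:R * mesh n) w @[n --> \oo] --> A (inverse_process D t w) w.
Proof.
move=> gw [rA _] ck.
apply: (@cvg_right_continuous _ (A ^~ w) _ (fun n => (k n).+1%:R * mesh n)).
- exact: rA (first_passage_ge0 gw t).
- by move=> n; case/andP: (lattice_index_first_passage gw (mesh_gt0 n) (ck n)).
- apply: (@squeeze_cvgr _ _ _ _ (cst (inverse_process D t w)) (fun n => inverse_process D t w + mesh n)).
  + by apply: nearW => n; exact: (lattice_index_first_passage gw (mesh_gt0 n) (ck n)).
  + exact: cvg_cst.
  + rewrite -[X in _ --> X]addr0; apply: cvgD; first exact: cvg_cst.
    exact: cvg_harmonic.
Qed.

(** On almost every path the rounded increments converge to that of [Y]; continuity of [g] and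
    dominated convergence with bound 1 carry this over to the means. *)
Lemma lattice_increment_cvg x t : 0 <= x -> 0 <= t ->
  lattice_increment D (mesh n) (lattice_weight (mesh n)) x t @[n --> \oo] -->
  (\int[P]_w (g (increment Y x (x + t) w))%:E)%E.
Proof.
move=> x0 t0.
under eq_fun do rewrite -integral_increment_functional//.
have xt0 : 0 <= x + t by rewrite addr_ge0.
have good : {ae P, forall w, [/\ unbounded_nondecreasing (D ^~ w), cadlag (A ^~ w),
    Y x w = A (inverse_process D x w) w & Y (x + t) w = A (inverse_process D (x + t) w) w]}.
  have h1 := stable_good_paths c_gt0 stD; have h2 := levy_cadlag levyA.
  have h3 := YE x0; have h4 := YE xt0.
  move: h1; apply: filterS2 (filterI h2 (filterI h3 h4)) => w [? [? ?]] ?; by split.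
have [] := @dominated_convergence _ _ _ P [set: T] measurableT
  (fun n => increment_functional (mesh n) x t)
  (fun w => (g (increment Y x (x + t) w))%:E) (cst 1%E).
- by move=> n; exact: measurable_increment_functional.
- by apply: (measurableT_comp mgE); exact: measurable_increment.
- move: good; apply: filterS => w [gw cA Yx Yxt] _.
  have /choice[k /choice[m km]] n := increment_functional_value (mesh_gt0 n) gw x0 t0.
  have kx n : cell D (mesh n) (k n) x w by case: (km n).
  have mx n : cell D (mesh n) (m n) (x + t) w by case: (km n).
  rewrite (_ : (fun n => _) = (fun n => (g (increment A ((k n).+1%:R * mesh n) ((m n).+1%:R * mesh n) w))%:E)); last first.
    by apply/funext => n; case: (km n).
  apply: cvg_EFin; first exact: nearW.
  apply: continuous_cvg; first exact: cg.
  rewrite /increment Yx Yxt; apply: cvgB; exact: lattice_time_cvg.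
- exact: finite_measure_integrable_cst.
- move: good; apply: filterS => w [gw cA Yx Yxt] n _.
  have [k [m [_ _ ->]]] := increment_functional_value (mesh_gt0 n) gw x0 t0.
  by rewrite gee0_abs ?lee_fin.
by [].
Qed.

Lemma lattice_position_cvg t : 0 <= t ->
  lattice_position D (mesh n) (lattice_weight (mesh n)) t @[n --> \oo] -->
  (\int[P]_w (g (Y t w))%:E)%E.
Proof.
move=> t0.
under eq_fun do rewrite -integral_position_functional//.
have good : {ae P, forall w, [/\ unbounded_nondecreasing (D ^~ w), cadlag (A ^~ w),
    A 0 w = 0 & Y t w = A (inverse_process D t w) w]}.
  have h1 := stable_good_paths c_gt0 stD; have h2 := levy_cadlag levyA.
  have h3 := levy_start levyA; have h4 := YE t0.
  move: h1; apply: filterS2 (filterI h2 (filterI h3 h4)) => w [? [? ?]] ?; by split.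
have [] := @dominated_convergence _ _ _ P [set: T] measurableT
  (fun n => position_functional (mesh n) t)
  (fun w => (g (Y t w))%:E) (cst 1%E).
- by move=> n; exact: measurable_position_functional.
- exact: (measurableT_comp mgE).
- move: good; apply: filterS => w [gw cA A0 Yt] _.
  have /choice[k kP] n := position_functional_value (mesh_gt0 n) gw t0.
  have kx n : cell D (mesh n) (k n) t w by case: (kP n).
  rewrite (_ : (fun n => _) = (fun n => (g (increment A 0 ((k n).+1%:R * mesh n) w))%:E)); last first.
    by apply/funext => n; case: (kP n).
  apply: cvg_EFin; first exact: nearW.
  apply: continuous_cvg; first exact: cg.
  rewrite /increment Yt A0; under eq_fun do rewrite subr0.
  exact: lattice_time_cvg.
- exact: finite_measure_integrable_cst.
- move: good; apply: filterS => w [gw cA _ _] n _.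
  have [k [_ ->]] := position_functional_value (mesh_gt0 n) gw t0.
  by rewrite gee0_abs ?lee_fin.
by [].
Qed.

End lattice_approximation.

(** * Right-continuity and measurability in time of the means *)

Section time_changed_means.
Context d (T : measurableType d) (R : realType) (P : probability T R).
Variables (alpha c : R) (A D Y : R -> {RV P >-> R}).
Hypothesis c_gt0 : 0 < c.
Hypothesis levyA : levy_process A.
Hypothesis stD : stable_subordinator alpha c D.
Hypothesis indAD : independent_processes A D.
Hypothesis YE : time_changed A (inverse_process D) Y.
Variable g : R -> R.
Hypothesis cg : continuous g.
Hypothesis g01 : forall x, 0 <= g x <= 1.
Hypothesis g0 : g 0 = 0.

Let g_ge0 x : 0 <= g x. Proof. by case/andP: (g01 x). Qed.
Let g_le1 x : g x <= 1. Proof. by case/andP: (g01 x). Qed.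
Let mg : measurable_fun [set: R] g. Proof. exact: continuous_measurable_fun. Qed.
Let mgE : measurable_fun [set: R] (EFin \o g). Proof. exact/measurable_EFinP. Qed.

Lemma mean_itv01 (X : T -> R) : measurable_fun [set: T] X ->
  (0 <= \int[P]_w (g (X w))%:E <= 1)%E.
Proof.
move=> mX; apply/andP; split; first by apply: integral_ge0 => w _; rewrite lee_fin.
rewrite -(probability_setT P) -[leRHS]mul1e -integral_cst//.
apply: ge0_le_integral => //.
- by move=> w _; rewrite lee_fin.
- exact: (measurableT_comp mgE).
- by move=> w _; rewrite lee_fin.
Qed.

(* The extension by [0] to negative times makes a convolution with
   [mean_position] an integral over ]0, +oo[. *)
Definition mean_increment (x t : R) : R :=
  if (0 <= x) && (0 <= t) then fine (\int[P]_w (g (increment Y x (x + t) w))%:E) else 0.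

Definition mean_position (t : R) : R :=
  if 0 <= t then fine (\int[P]_w (g (Y t w))%:E) else 0.

Lemma mean_increment01 x t : 0 <= mean_increment x t <= 1.
Proof.
rewrite /mean_increment; case: ifP => _; last by rewrite lexx ler01.
have /andP[i0 i1] := mean_itv01 (measurable_increment Y x (x + t)).
by rewrite -!lee_fin fineK ?i0// ge0_fin_numE// (le_lt_trans i1)// ltry.
Qed.

Lemma mean_position01 t : 0 <= mean_position t <= 1.
Proof.
rewrite /mean_position; case: ifP => _; last by rewrite lexx ler01.
have /andP[i0 i1] := mean_itv01 (measurable_funPT (Y t)).
by rewrite -!lee_fin fineK ?i0// ge0_fin_numE// (le_lt_trans i1)// ltry.
Qed.

Lemma mean_incrementE x t : 0 <= x -> 0 <= t ->
  (mean_increment x t)%:E = (\int[P]_w (g (increment Y x (x + t) w))%:E)%E.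
Proof.
move=> x0 t0; rewrite /mean_increment x0 t0/=.
have /andP[i0 i1] := mean_itv01 (measurable_increment Y x (x + t)).
by rewrite fineK// ge0_fin_numE// (le_lt_trans i1)// ltry.
Qed.

Lemma mean_positionE t : 0 <= t -> (mean_position t)%:E = (\int[P]_w (g (Y t w))%:E)%E.
Proof.
move=> t0; rewrite /mean_position t0.
have /andP[i0 i1] := mean_itv01 (measurable_funPT (Y t)).
by rewrite fineK// ge0_fin_numE// (le_lt_trans i1)// ltry.
Qed.

(** Each time has its own null set outside which [Y] is the time-changed process. Countably many
    times share one, so right-continuity holds almost surely along a given sequence, which is enough
    for the means. *)
Lemma time_changed_cvg (u : nat -> R) (t : R) : 0 <= t -> (forall n, t <= u n) ->
  u n @[n --> \oo] --> t ->
  {ae P, forall w, Y (u n) w @[n --> \oo] --> Y t w}.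
Proof.
move=> t0 tu cu.
have hu : {ae P, forall w n, Y (u n) w = A (inverse_process D (u n) w) w}.
  by apply/ae_foralln => n; apply: YE; exact: le_trans (tu n).
have h1 := stable_good_paths c_gt0 stD; have h2 := levy_cadlag levyA.
have h3 := YE t0.
move: h1; apply: filterS2 (filterI h2 (filterI h3 hu)) => w [[rA _] [Yt Yu]] gw.
rewrite Yt; under eq_fun do rewrite Yu.
apply: (@cvg_right_continuous _ (A ^~ w) _ (fun n => inverse_process D (u n) w)).
- exact: rA (first_passage_ge0 gw t).
- move=> n; apply: lb_le_inf; first by case: (has_inf_first_passage gw (u n)).
  by move=> r [r0 ur]; apply: (first_passage_le gw) => //; exact: le_lt_trans ur.
- exact: first_passage_cvg.
Qed.

Let mean_cvg (X : nat -> T -> R) (X0 : T -> R) :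
  (forall n, measurable_fun [set: T] (X n)) -> measurable_fun [set: T] X0 ->
  {ae P, forall w, X n w @[n --> \oo] --> X0 w} ->
  (\int[P]_w (g (X n w))%:E)%E @[n --> \oo] --> (\int[P]_w (g (X0 w))%:E)%E.
Proof.
move=> mX mX0 XX0.
have [] := @dominated_convergence _ _ _ P [set: T] measurableT
  (fun n w => (g (X n w))%:E) (fun w => (g (X0 w))%:E) (cst 1%E).
- by move=> n; exact: (measurableT_comp mgE).
- exact: (measurableT_comp mgE).
- move: XX0; apply: filterS => w Xw _.
  apply: cvg_EFin; first exact: nearW.
  by apply: continuous_cvg => //; exact: cg.
- exact: finite_measure_integrable_cst.
- by apply: aeW => w n _; rewrite gee0_abs ?lee_fin.
by [].
Qed.

Lemma mean_increment_cvg (u v : nat -> R) (x t : R) : 0 <= x -> 0 <= t ->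
  (forall n, x <= u n) -> (forall n, t <= v n) ->
  u n @[n --> \oo] --> x -> v n @[n --> \oo] --> t ->
  mean_increment (u n) (v n) @[n --> \oo] --> mean_increment x t.
Proof.
move=> x0 t0 xu tv cu cv.
have u0 n := le_trans x0 (xu n); have v0 n := le_trans t0 (tv n).
suff : (mean_increment (u n) (v n))%:E @[n --> \oo] --> (mean_increment x t)%:E.
  by move=> /fine_cvg.
rewrite mean_incrementE//; under eq_fun do rewrite mean_incrementE//.
have h1 := time_changed_cvg x0 xu cu.
have cuv : u n + v n @[n --> \oo] --> x + t by exact: cvgD.
have h2 := @time_changed_cvg (fun n => u n + v n) _ (addr_ge0 x0 t0)
   (fun n => lerD (xu n) (tv n)) cuv.
have h : {ae P, forall w, increment Y (u n) (u n + v n) w @[n --> \oo] -->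
    increment Y x (x + t) w}.
  by move: h2; apply: filterS2 h1 => w c1 c2; exact: cvgB.
apply: (@mean_cvg (fun n => increment Y (u n) (u n + v n)) (increment Y x (x + t))) => //.
- by move=> n; exact: measurable_increment.
- exact: measurable_increment.
Qed.

Lemma mean_position_cvg (v : nat -> R) (t : R) : 0 <= t -> (forall n, t <= v n) ->
  v n @[n --> \oo] --> t ->
  mean_position (v n) @[n --> \oo] --> mean_position t.
Proof.
move=> t0 tv cv; have v0 n := le_trans t0 (tv n).
suff : (mean_position (v n))%:E @[n --> \oo] --> (mean_position t)%:E.
  by move=> /fine_cvg.
rewrite mean_positionE//; under eq_fun do rewrite mean_positionE//.
apply: mean_cvg => //.
exact: time_changed_cvg.
Qed.

Let mesh (n : nat) : R := n.+1%:R^-1.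
Let mesh_gt0 n : 0 < mesh n. Proof. by rewrite invr_gt0. Qed.
Local Notation weight n := (lattice_weight A g (mesh n)).

Lemma lattice_increment_le1 n x t : 0 <= x -> 0 <= t ->
  (0 <= lattice_increment D (mesh n) (weight n) x t <= 1)%E.
Proof.
move=> x0 t0; 
rewrite -(integral_increment_functional levyA indAD cg g01 (mesh_gt0 n)).
apply/andP; split.
  apply: integral_ge0 => w _; apply: nneseries_ge0 => k _ _; apply: nneseries_ge0 => j _ _.
  by rewrite mule_ge0// lee_fin.
rewrite -(probability_setT P) -[leRHS]mul1e -integral_cst//.
apply: ae_ge0_le_integral => //.
- move=> w _; apply: nneseries_ge0 => k _ _; apply: nneseries_ge0 => j _ _.
  by rewrite mule_ge0// lee_fin.
- exact: measurable_increment_functional.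
- move: (stable_good_paths c_gt0 stD); apply: filterS => w gw _.
  have [k [m [_ _ ->]]] := increment_functional_value A g01 g0 (mesh_gt0 n) gw x0 t0.
  by rewrite lee_fin.
Qed.

Lemma lattice_position_le1 n t : 0 <= t ->
  (0 <= lattice_position D (mesh n) (weight n) t <= 1)%E.
Proof.
move=> t0; rewrite -(integral_position_functional levyA indAD cg g01 (mesh_gt0 n)).
apply/andP; split.
  apply: integral_ge0 => w _; apply: nneseries_ge0 => j _ _.
  by rewrite mule_ge0// lee_fin.
rewrite -(probability_setT P) -[leRHS]mul1e -integral_cst//.
apply: ae_ge0_le_integral => //.
- by move=> w _; apply: nneseries_ge0 => j _ _; rewrite mule_ge0// lee_fin.
- exact: measurable_position_functional.
- move: (stable_good_paths c_gt0 stD); apply: filterS => w gw _.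
  have [k [_ ->]] := position_functional_value A g01 (mesh_gt0 n) gw t0.
  by rewrite lee_fin.
Qed.

(** [Y] is not assumed jointly measurable; the mean is measurable in time as a pointwise limit of
    lattice series, which are built from probabilities of cells. The indicator in [f] matches the
    extension by 0. *)
Lemma measurable_mean_position : measurable_fun [set: R] mean_position.
Proof.
apply/measurable_EFinP.
pose f n t := (lattice_position D (mesh n) (weight n) t * (\1_(`[0%R, +oo[%classic) t)%:E)%E.
apply: (emeasurable_fun_cvg f) => [n|t _].
  apply: emeasurable_funM.
    by apply: measurable_lattice_position; exact: lattice_weight01.
  by apply/measurable_EFinP; exact: measurable_indic.
rewrite /f indicE mem_setE in_itv/= andbT; have [t0|t0] := leP 0 t.
  under eq_fun do rewrite mule1.
  by rewrite mean_positionE//; exact: (lattice_position_cvg c_gt0 levyA stD indAD YE cg g01 t0).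
under eq_fun do rewrite mule0.
by rewrite /mean_position leNgt t0/=; exact: cvg_cst.
Qed.

Lemma measurable_mean_increment :
  measurable_fun [set: R * R] (fun z => mean_increment z.1 z.2).
Proof.
apply/measurable_EFinP.
pose f n (z : R * R) := (lattice_increment D (mesh n) (weight n) z.1 z.2 *
  ((\1_(`[0%R, +oo[%classic) z.1)%:E * (\1_(`[0%R, +oo[%classic) z.2)%:E))%E.
apply: (emeasurable_fun_cvg f) => [n|[x t] _].
  apply: emeasurable_funM.
    by apply: measurable_lattice_increment; exact: lattice_weight01.
  have mI : measurable_fun [set: R] (fun x : R => (\1_(`[0%R, +oo[%classic) x)%:E : \bar R).
    by apply/measurable_EFinP; exact: measurable_indic.
  by apply: emeasurable_funM; apply: (measurableT_comp mI).
rewrite /f/= !indicE !mem_setE !in_itv/= !andbT.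
have [x0|x0] := leP 0 x; last first.
  under eq_fun do rewrite mul0e mule0.
  by rewrite /mean_increment leNgt x0/=; exact: cvg_cst.
have [t0|t0] := leP 0 t; last first.
  under eq_fun do rewrite mule0 mule0.
  by rewrite /mean_increment x0 leNgt t0/=; exact: cvg_cst.
under eq_fun do rewrite mule1 mule1.
by rewrite mean_incrementE//; exact: (lattice_increment_cvg c_gt0 levyA stD indAD YE cg g01 g0 x0 t0).
Qed.

End time_changed_means.

(** * Limit of the factor in the transform of the rounded increment *)

Section mesh_limit.
Context {R : realType}.
Implicit Types (alpha c p q x : R).

(** Both bounds come from 1 + y <= exp y, taken at y and at - y for y = x / (n + 1). *)
Lemma sub1_expRN_cvg x : 0 < x ->
  (1 - expR (- (n.+1%:R^-1 * x))) * n.+1%:R @[n --> \oo] --> x.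
Proof.
move=> x0.
apply: (@squeeze_cvgr _ _ _ _ (fun n => x / (1 + n.+1%:R^-1 * x)) (cst x)).
- apply: nearW => n /=; set y := n.+1%:R^-1 * x.
  have y0 : 0 < y by rewrite mulr_gt0// invr_gt0.
  have xE : x = y * n.+1%:R by rewrite /y mulrAC mulVf ?mul1r// pnatr_eq0.
  rewrite xE mulrAC !ler_pM2r//; apply/andP; split; last first.
    by have := expR_ge1Dx (- y); lra.
  rewrite expRN ler_pdivrMr ?addr_gt0//.
  have e1 : 1 + y <= expR y by exact: expR_ge1Dx.
  have e0 : 0 < expR y by exact: expR_gt0.
  have : (expR y)^-1 * (1 + y) <= 1 by rewrite mulrC ler_pdivrMr// mul1r.
  by rewrite mulrBl mul1r; lra.
- rewrite -[X in _ --> X]divr1; apply: cvgMr; apply: cvgV; first exact: oner_neq0.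
  rewrite -[X in _ --> X]addr0; apply: cvgD; first exact: cvg_cst.
  rewrite -(mul0r x); apply: cvgMl; exact: cvg_harmonic.
- exact: cvg_cst.
Qed.

(** Writing a for the transform of one step, the first quotient is 1 - (1 - a q) / (1 - a p);
    numerator and denominator, multiplied by n + 1, tend to c q ^ alpha and c p ^ alpha, and the
    scale c cancels. *)
Lemma lattice_laplace_ratio_cvg alpha c p q : 0 < alpha -> 0 < c -> 0 < q -> q < p ->
  (lattice_laplace alpha c n.+1%:R^-1 q - lattice_laplace alpha c n.+1%:R^-1 p) /
  (1 - lattice_laplace alpha c n.+1%:R^-1 p) / (p - q) @[n --> \oo] -->
  (1 - (q / p) `^ alpha) / (p - q).
Proof.
move=> a0 c0 q0 qp; have p0 := lt_trans q0 qp.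
pose B := c * q `^ alpha; pose A := c * p `^ alpha.
have A0 : 0 < A by rewrite mulr_gt0// powR_gt0.
have B0 : 0 < B by rewrite mulr_gt0// powR_gt0.
apply: cvgMl.
have -> : 1 - (q / p) `^ alpha = 1 - B / A.
  rewrite /A /B -mulf_div divff ?gt_eqF// mul1r powRM ?invr_ge0 ?ltW//.
  by rewrite -powR_inv1 ?(ltW p0)// -powRrM mulN1r powRN.
have -> : (fun n => (lattice_laplace alpha c n.+1%:R^-1 q - lattice_laplace alpha c n.+1%:R^-1 p) /
  (1 - lattice_laplace alpha c n.+1%:R^-1 p)) =
  (fun n => 1 - ((1 - expR (- (n.+1%:R^-1 * B))) * n.+1%:R) / ((1 - expR (- (n.+1%:R^-1 * A))) * n.+1%:R)).
  apply/funext => n; rewrite /lattice_laplace -!mulrA -/A -/B.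
  have d0 : 0 < 1 - expR (- (n.+1%:R^-1 * A)).
    by rewrite subr_gt0 expR_lt1 oppr_lt0 mulr_gt0// invr_gt0.
  move: d0; set u := expR (- (_ * A)); set v := expR (- (_ * B)) => d0.
  by field; rewrite (gt_eqF d0) nat1r pnatr_eq0.
apply: cvgB; first exact: cvg_cst.
apply: cvgM; first exact: sub1_expRN_cvg.
by apply: cvgV; [rewrite gt_eqF|exact: sub1_expRN_cvg].
Qed.

End mesh_limit.

(** * Double Laplace transform of the mean increment *)

Section laplace_means.
Context d (T : measurableType d) (R : realType) (P : probability T R).
Notation mu := (@lebesgue_measure R).
Variables (alpha c : R) (A D Y : R -> {RV P >-> R}).
Hypothesis alpha_gt0 : 0 < alpha.
Hypothesis c_gt0 : 0 < c.
Hypothesis levyA : levy_process A.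
Hypothesis stD : stable_subordinator alpha c D.
Hypothesis indAD : independent_processes A D.
Hypothesis YE : time_changed A (inverse_process D) Y.
Variable g : R -> R.
Hypothesis cg : continuous g.
Hypothesis g01 : forall x, 0 <= g x <= 1.
Hypothesis g0 : g 0 = 0.

Let mesh (n : nat) : R := n.+1%:R^-1.
Let mesh_gt0 n : 0 < mesh n. Proof. by rewrite invr_gt0. Qed.
Local Notation weight n := (lattice_weight A g (mesh n)).
Local Notation F := (mean_increment Y g).
Local Notation H := (mean_position Y g).
Local Notation LI n := (lattice_increment D (mesh n) (weight n)).
Local Notation LP n := (lattice_position D (mesh n) (weight n)).
Local Notation D0 := (`]0%R, +oo[%classic : set (measurableTypeR R)).

Let integrable_exp q (C : R) : 0 < q ->
  mu.-integrable D0 (fun t => (C * expR (- (q * t)))%:E).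
Proof.
move=> q0.
suff ie : mu.-integrable D0 (fun t => (expR (- (q * t)))%:E).
  exact: (@integrableZl _ _ _ mu D0 _ C _ ie).
apply/integrableP; split.
  by apply: measurable_funTS; apply/measurable_EFinP; exact: measurable_expRM.
under eq_integral do rewrite gee0_abs ?lee_fin ?expR_ge0//.
by rewrite integral_expR0y// ltry.
Qed.

Let position_laplace_cvg q : 0 < q ->
  (\int[mu]_(t in `]0%R, +oo[) ((expR (- (q * t)))%:E * LP n t))%E @[n --> \oo] -->
  (\int[mu]_(t in `]0%R, +oo[) (expR (- (q * t)) * H t)%:E)%E.
Proof.
move=> q0.
have [] := @dominated_convergence _ _ _ mu D0 _
  (fun n t => (expR (- (q * t)))%:E * LP n t)%E
  (fun t => (expR (- (q * t)) * H t)%:E) (fun t => (1 * expR (- (q * t)))%:E) => //.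
- move=> n; apply: measurable_funTS; apply: emeasurable_funM.
    by apply/measurable_EFinP; exact: measurable_expRM.
  by apply: measurable_lattice_position; exact: lattice_weight01.
- apply: measurable_funTS; apply/measurable_EFinP; apply: measurable_funM.
    exact: measurable_expRM.
  exact: (measurable_mean_position c_gt0 levyA stD indAD YE cg g01).
- apply: aeW => t; rewrite /= in_itv/= andbT => /ltW t0.
  rewrite EFinM; apply: cvgeZl => //.
  rewrite (mean_positionE Y cg g01 t0).
  exact: (lattice_position_cvg c_gt0 levyA stD indAD YE cg g01 t0).
- exact: integrable_exp.
- apply: aeW => t n; rewrite /= in_itv/= andbT => /ltW t0.
  have /andP[l0 l1] := lattice_position_le1 c_gt0 levyA stD indAD cg g01 n t0.
  rewrite gee0_abs ?mule_ge0 ?lee_fin ?expR_ge0// mul1r.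
  by rewrite -[leRHS]mule1 lee_pmul// lee_fin expR_ge0.
Qed.

(** Dominated convergence is applied in t for fixed x and then in x, the inner integral being
    bounded by exp (- p x) / q. *)
Let increment_laplace_cvg p q : 0 < q -> q < p ->
  (\int[mu]_(x in `]0%R, +oo[) \int[mu]_(t in `]0%R, +oo[)
     ((expR (- (p * x + q * t)))%:E * LI n x t))%E @[n --> \oo] -->
  (\int[mu]_(x in `]0%R, +oo[) \int[mu]_(t in `]0%R, +oo[)
     (expR (- (p * x + q * t)) * F x t)%:E)%E.
Proof.
move=> q0 qp; have p0 := lt_trans q0 qp.
have mexp2 : measurable_fun [set: R * R] (fun z : R * R => expR (- (p * z.1 + q * z.2))).
  apply: (measurableT_comp (@measurable_expR R)); apply: measurable_funN.
  by apply: measurable_funD; apply: measurable_funM.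
pose f n (z : R * R) := ((expR (- (p * z.1 + q * z.2)))%:E * `|LI n z.1 z.2|)%E.
have mf n : measurable_fun [set: R * R] (f n).
  apply: emeasurable_funM => //; apply: measurableT_comp => //.
  by apply: measurable_lattice_increment; exact: lattice_weight01.
have f0 n z : (0 <= f n z)%E by rewrite mule_ge0// lee_fin expR_ge0.
have fE n x t : 0 < x -> 0 < t -> f n (x, t) = ((expR (- (p * x + q * t)))%:E * LI n x t)%E.
  move=> /ltW x0 /ltW t0.
  have /andP[l0 l1] := lattice_increment_le1 c_gt0 levyA stD indAD cg g01 g0 n x0 t0.
  by rewrite /f/= gee0_abs.
pose h (z : R * R) := (expR (- (p * z.1 + q * z.2)) * F z.1 z.2)%:E.
have mF := measurable_mean_increment c_gt0 levyA stD indAD YE cg g01 g0.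
have mh : measurable_fun [set: R * R] h by apply/measurable_EFinP; exact: measurable_funM.
have h0 z : (0 <= h z)%E.
  by rewrite lee_fin mulr_ge0 ?expR_ge0//; case/andP: (mean_increment01 Y cg g01 z.1 z.2).
have f_le n x t : 0 < x -> 0 < t -> (`|f n (x, t)| <= (expR (- (p * x)) * expR (- (q * t)))%:E)%E.
  move=> x0 t0; have /andP[l0 l1] := lattice_increment_le1 c_gt0 levyA stD indAD cg g01 g0 n (ltW x0) (ltW t0).
  rewrite gee0_abs// fE// -expRD -opprD -[leRHS]mule1.
  by rewrite lee_pmul// lee_fin expR_ge0.
have inner_cvg x : 0 < x -> (\int[mu]_(t in `]0%R, +oo[) f n (x, t))%E @[n --> \oo] -->
    (\int[mu]_(t in `]0%R, +oo[) h (x, t))%E.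
  move=> x0.
  have [] := @dominated_convergence _ _ _ mu D0 _
    (fun n t => f n (x, t)) (fun t => h (x, t))
    (fun t => (expR (- (p * x)) * expR (- (q * t)))%:E) => //.
  - move=> n; apply: measurable_funTS; apply: (measurableT_comp (mf n)).
    exact: measurable_fun_pair.
  - by apply: measurable_funTS; apply: (measurableT_comp mh); exact: measurable_fun_pair.
  - apply: aeW => t; rewrite /= in_itv/= andbT => t0.
    under eq_fun do rewrite fE//.
    rewrite /h/= EFinM; apply: cvgeZl => //.
    rewrite (mean_incrementE Y cg g01 (ltW x0) (ltW t0)).
    exact: (lattice_increment_cvg c_gt0 levyA stD indAD YE cg g01 g0 (ltW x0) (ltW t0)).
  - exact: integrable_exp.
  - by apply: aeW => t n; rewrite /= in_itv/= andbT => t0; exact: f_le.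
have [] := @dominated_convergence _ _ _ mu D0 _
  (fun n x => \int[mu]_(t in `]0%R, +oo[) f n (x, t))%E
  (fun x => \int[mu]_(t in `]0%R, +oo[) h (x, t))%E
  (fun x => (q^-1 * expR (- (p * x)))%:E) => //.
- move=> n; apply: measurable_funTS.
  by apply: (@measurable_integral_snd _ _ _ _ _ mu _ (f n)); [exact: measurable_itv|exact: mf|exact: f0].
- apply: measurable_funTS.
  by apply: (@measurable_integral_snd _ _ _ _ _ mu _ h); [exact: measurable_itv|exact: mh|exact: h0].
- by apply: aeW => x; rewrite /= in_itv/= andbT; exact: inner_cvg.
- exact: integrable_exp.
- apply: aeW => x n; rewrite /= in_itv/= andbT => x0.
  rewrite gee0_abs; last exact: integral_ge0.
  rewrite mulrC EFinM -(integral_expR0y q0) -ge0_integralZl//; last first.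
    by apply: measurable_funTS; apply/measurable_EFinP; exact: measurable_expRM.
  apply: ge0_le_integral => //.
  + by apply: measurable_funTS; apply: (measurableT_comp (mf n)); exact: measurable_fun_pair.
  + apply: measurable_funTS; apply: emeasurable_funM => //.
    by apply/measurable_EFinP; exact: measurable_expRM.
  + move=> t; rewrite /= in_itv/= andbT => t0.
    by rewrite -EFinM -(gee0_abs (f0 n _)); exact: f_le.
move=> _ _; apply: cvg_trans; apply: near_eq_cvg; apply: nearW => n.
apply: eq_integral0y => x x0; apply: eq_integral0y => t t0.
exact: fE.
Qed.

Lemma laplace_mean_increment p q : 0 < q -> q < p ->
  (\int[mu]_(x in `]0%R, +oo[) \int[mu]_(t in `]0%R, +oo[)
     (expR (- (p * x + q * t)) * F x t)%:E =
   ((1 - (q / p) `^ alpha) / (p - q))%:E *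
   \int[mu]_(t in `]0%R, +oo[) (expR (- (q * t)) * H t)%:E)%E.
Proof.
move=> q0 qp.
rewrite -(cvg_lim _ (increment_laplace_cvg q0 qp))//; apply/cvg_lim => //.
under eq_fun do rewrite (laplace_lattice_increment alpha_gt0 c_gt0 stD (mesh_gt0 _) (lattice_weight01 A cg g01 _) q0 qp).
have ih0 : (0 <= \int[mu]_(t in `]0%R, +oo[) (expR (- (q * t)) * H t)%:E)%E.
  apply: integral_ge0 => t _; rewrite lee_fin mulr_ge0 ?expR_ge0//.
  by case/andP: (mean_position01 Y cg g01 t).
apply: cvgeM.
- apply: mule_def_fin => //; rewrite ge0_fin_numE//.
  apply: (@le_lt_trans _ _ (\int[mu]_(t in `]0%R, +oo[) (expR (- (q * t)))%:E)%E).
    apply: ge0_le_integral => //.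
    + move=> t _; rewrite lee_fin mulr_ge0 ?expR_ge0//.
      by case/andP: (mean_position01 Y cg g01 t).
    + apply: measurable_funTS; apply/measurable_EFinP; apply: measurable_funM.
        exact: measurable_expRM.
      exact: (measurable_mean_position c_gt0 levyA stD indAD YE cg g01).
    + by apply: measurable_funTS; apply/measurable_EFinP; exact: measurable_expRM.
    + move=> t _; rewrite lee_fin ler_piMr ?expR_ge0//.
      by case/andP: (mean_position01 Y cg g01 t).
  by rewrite integral_expR0y// ltry.
- apply: cvg_EFin; first exact: nearW.
  exact: lattice_laplace_ratio_cvg.
- exact: position_laplace_cvg.
Qed.

End laplace_means.

(** * Inversion of the double Laplace transform *)

Section overshoot_identity.
Context d (T : measurableType d) (R : realType) (P : probability T R).
Notation mu := (@lebesgue_measure R).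
Variables (alpha c : R) (A D Y : R -> {RV P >-> R}).
Hypothesis alpha01 : 0 < alpha < 1.
Hypothesis c_gt0 : 0 < c.
Hypothesis levyA : levy_process A.
Hypothesis stD : stable_subordinator alpha c D.
Hypothesis indAD : independent_processes A D.
Hypothesis YE : time_changed A (inverse_process D) Y.
Variable g : R -> R.
Hypothesis cg : continuous g.
Hypothesis g01 : forall x, 0 <= g x <= 1.
Hypothesis g0 : g 0 = 0.

Local Notation F := (mean_increment Y g).
Local Notation H := (mean_position Y g).
Local Notation D0 := (`]0%R, +oo[%classic : set (measurableTypeR R)).
Local Notation k := (overshoot_density alpha).
Local Notation kappa := (sin (pi * alpha) / pi).

Let alpha_gt0 : 0 < alpha. Proof. by case/andP: alpha01. Qed.
Let sin_gt0 : 0 < sin (pi * alpha).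
Proof.
case/andP: alpha01 => a0 a1; apply: sin_gt0_pi.
by rewrite mulr_gt0 ?pi_gt0//= gtr_pMr// pi_gt0.
Qed.
Let kappa_gt0 : 0 < kappa. Proof. by rewrite divr_gt0 ?pi_gt0. Qed.

Let F_ge0 x t : 0 <= F x t. Proof. by case/andP: (mean_increment01 Y cg g01 x t). Qed.
Let F_le1 x t : F x t <= 1. Proof. by case/andP: (mean_increment01 Y cg g01 x t). Qed.
Let H_ge0 t : 0 <= H t. Proof. by case/andP: (mean_position01 Y cg g01 t). Qed.
Let H_le1 t : H t <= 1. Proof. by case/andP: (mean_position01 Y cg g01 t). Qed.
Let mF : measurable_fun [set: R * R] (fun z => F z.1 z.2).
Proof. exact: (measurable_mean_increment c_gt0 levyA stD indAD YE cg g01 g0). Qed.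
Let mH : measurable_fun [set: R] H.
Proof. exact: (measurable_mean_position c_gt0 levyA stD indAD YE cg g01). Qed.

Let weight (v : R) : R := `|v `^ (- alpha) / (1 + v)|.

Let weight_ge0 v : 0 <= weight v. Proof. exact: normr_ge0. Qed.

Let mweight : measurable_fun [set: R] weight.
Proof.
apply: measurableT_comp => //; apply: measurable_funM; first exact: measurable_powR.
by apply: measurable_fun_invr; exact: measurable_funD.
Qed.

Let weightE v : 0 < v -> weight v = v `^ (- alpha) / (1 + v).
Proof. by move=> v0; rewrite /weight ger0_norm// divr_ge0 ?powR_ge0// addr_ge0// ltW. Qed.

Let weight_mass : (\int[mu]_(v in `]0%R, +oo[) (weight v)%:E = (pi / sin (pi * alpha))%:E)%E.
Proof.
by rewrite -(integral_powR_div1D alpha01); apply: eq_integral0y => v v0; rewrite weightE.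
Qed.

Let integrable_weight : mu.-integrable D0 (fun v => (weight v)%:E).
Proof.
apply/integrableP; split; first by apply: measurable_funTS; apply/measurable_EFinP; exact: mweight.
rewrite (@eq_integral0y _ _ (fun v => (weight v)%:E)) ?weight_mass ?ltry// => v _.
by rewrite gee0_abs// lee_fin weight_ge0.
Qed.

Let ebound (u : R -> R) q : 0 < q -> measurable_fun [set: R] u -> (forall t, 0 <= u t) -> (forall t, u t <= 1) ->
  (0 <= \int[mu]_(t in `]0%R, +oo[) (expR (- (q * t)) * u t)%:E <= (q^-1)%:E)%E.
Proof.
move=> q0 mu' u0 u1; apply/andP; split.
  by apply: integral_ge0 => t _; rewrite lee_fin mulr_ge0 ?expR_ge0 ?weight_ge0.
rewrite -integral_expR0y//; apply: ge0_le_integral => //.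
- by move=> t _; rewrite lee_fin mulr_ge0 ?expR_ge0 ?weight_ge0.
- apply: measurable_funTS; apply/measurable_EFinP; apply: measurable_funM => //.
  exact: measurable_expRM.
- by apply: measurable_funTS; apply/measurable_EFinP; exact: measurable_expRM.
- by move=> t _; rewrite lee_fin ler_piMr ?expR_ge0.
Qed.

Let efine (u : R -> R) q : 0 < q -> measurable_fun [set: R] u -> (forall t, 0 <= u t) -> (forall t, u t <= 1) ->
  (\int[mu]_(t in `]0%R, +oo[) (expR (- (q * t)) * u t)%:E)%E \is a fin_num.
Proof.
move=> q0 mu' u0 u1; have /andP[i0 i1] := ebound q0 mu' u0 u1.
by rewrite ge0_fin_numE// (le_lt_trans i1)// ltry.
Qed.

Let mFx x : measurable_fun [set: R] (F x).
Proof.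
have mx : measurable_fun [set: R] (fun t => (x, t)) by exact: measurable_fun_pair.
exact: (measurableT_comp mF mx).
Qed.

Let integrable_exp q : 0 < q -> mu.-integrable D0 (fun t => (expR (- (q * t)))%:E).
Proof.
move=> q0; apply/integrableP; split.
  by apply: measurable_funTS; apply/measurable_EFinP; exact: measurable_expRM.
under eq_integral do rewrite gee0_abs ?lee_fin ?expR_ge0//.
by rewrite integral_expR0y// ltry.
Qed.

Let phi1 q x : \bar R := (\int[mu]_(t in `]0%R, +oo[) (expR (- (q * t)) * F x t)%:E)%E.
(** Laplace transform at q of [overshoot_density alpha x] after the substitution r = x v. With x
    confined to the exponential, [weight] dominates for all x > 0 at once, which gives continuity in
    x. *)
Let psi q x : \bar R := (\int[mu]_(v in `]0%R, +oo[) (expR (- (q * (x * v))) * weight v)%:E)%E.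
Let Hq q : \bar R := (\int[mu]_(t in `]0%R, +oo[) (expR (- (q * t)) * H t)%:E)%E.

Let mexp2 q : measurable_fun [set: R * R] (fun z : R * R => expR (- (q * (z.1 * z.2)))).
Proof.
apply: (measurableT_comp (@measurable_expR R)); apply: measurable_funN.
by apply: measurable_funM => //; exact: measurable_funM.
Qed.

Let mexpx q x : measurable_fun [set: R] (fun v => expR (- (q * (x * v)))).
Proof.
rewrite (_ : (fun v => _) = (fun v => expR (- ((q * x) * v)))).
  exact: measurable_expRM.
by apply/funext => v; rewrite mulrA.
Qed.

Let psi_le q x : 0 < q -> 0 < x -> (0 <= psi q x <= (pi / sin (pi * alpha))%:E)%E.
Proof.
move=> q0 x0; apply/andP; split.
  by apply: integral_ge0 => v _; rewrite lee_fin mulr_ge0 ?expR_ge0 ?weight_ge0.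
rewrite -weight_mass; apply: ge0_le_integral => //.
- by move=> v _; rewrite lee_fin mulr_ge0 ?expR_ge0 ?weight_ge0.
- apply: measurable_funTS; apply/measurable_EFinP.
  by apply: measurable_funM; [exact: mexpx|exact: mweight].
- by apply: measurable_funTS; apply/measurable_EFinP; exact: mweight.
- move=> v; rewrite /= in_itv/= andbT => v0; rewrite lee_fin ler_piMl//.
  by rewrite expR_le1 oppr_le0 !mulr_ge0// ltW.
Qed.

Let psi_fin q x : 0 < q -> 0 < x -> psi q x \is a fin_num.
Proof.
move=> q0 x0; have /andP[i0 i1] := psi_le q0 x0.
by rewrite ge0_fin_numE// (le_lt_trans i1)// ltry.
Qed.

Let psiE q x : 0 < x ->
  psi q x = (\int[mu]_(r in `]0%R, +oo[) ((expR (- (q * r)))%:E * (k x r)%:E))%E.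
Proof.
move=> x0; rewrite (@integral_overshoot_density _ alpha x (fun r => (expR (- (q * r)))%:E))//.
- by apply: eq_integral0y => v v0; rewrite weightE// EFinM.
- by apply/measurable_EFinP; exact: measurable_expRM.
Qed.

Let phi1_cvg q s : 0 < q -> 0 < s ->
  fine (phi1 q x) @[x --> s^'+] --> fine (phi1 q s).
Proof.
move=> q0 s0; apply/cvg_at_rightP => u [us cu].
have fin x : phi1 q x \is a fin_num by apply: efine.
suff : phi1 q (u n) @[n --> \oo] --> (fine (phi1 q s))%:E by move=> /fine_cvg.
rewrite fineK//.
have [] := @dominated_convergence _ _ _ mu D0 _
  (fun n t => (expR (- (q * t)) * F (u n) t)%:E)
  (fun t => (expR (- (q * t)) * F s t)%:E) (fun t => (expR (- (q * t)))%:E) => //.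
- move=> n; apply: measurable_funTS; apply/measurable_EFinP.
  by apply: measurable_funM; [exact: measurable_expRM|exact: mFx].
- apply: measurable_funTS; apply/measurable_EFinP.
  by apply: measurable_funM; [exact: measurable_expRM|exact: mFx].
- apply: aeW => t; rewrite /= in_itv/= andbT => t0.
  apply: cvg_EFin; first exact: nearW.
  apply: cvgM; first exact: cvg_cst.
  apply: (mean_increment_cvg c_gt0 levyA stD YE cg g01 (v := fun=> t)).
  + exact: ltW.
  + exact: ltW.
  + by move=> n; exact: ltW.
  + by [].
  + exact: cu.
  + exact: cvg_cst.
- exact: integrable_exp.
- apply: aeW => t n _; rewrite gee0_abs lee_fin ?mulr_ge0 ?expR_ge0 ?weight_ge0//.
  by rewrite ler_piMr ?expR_ge0.
Qed.

Let psi_cvg q s : 0 < q -> 0 < s ->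
  fine (psi q x) @[x --> s^'+] --> fine (psi q s).
Proof.
move=> q0 s0; apply/cvg_at_rightP => u [us cu].
have u0 n : 0 < u n by exact: lt_trans (us n).
suff : psi q (u n) @[n --> \oo] --> (fine (psi q s))%:E by move=> /fine_cvg.
rewrite fineK; last exact: psi_fin.
have me x : measurable_fun [set: R] (fun v => expR (- (q * (x * v))) * weight v).
  by apply: measurable_funM; [exact: mexpx|exact: mweight].
have [] := @dominated_convergence _ _ _ mu D0 _
  (fun n v => (expR (- (q * (u n * v))) * weight v)%:E)
  (fun v => (expR (- (q * (s * v))) * weight v)%:E) (fun v => (weight v)%:E) => //.
- by move=> n; apply: measurable_funTS; apply/measurable_EFinP; exact: me.
- by apply: measurable_funTS; apply/measurable_EFinP; exact: me.
- apply: aeW => v; rewrite /= in_itv/= andbT => v0.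
  apply: cvg_EFin; first exact: nearW.
  apply: cvgM; last exact: cvg_cst.
  apply: continuous_cvg; first exact: continuous_expR.
  apply: cvgN; apply: cvgM; first exact: cvg_cst.
  by apply: cvgM; [exact: cu|exact: cvg_cst].
- apply: aeW => v n; rewrite /= in_itv/= andbT => v0.
  rewrite lee_fin ger0_norm ?mulr_ge0 ?expR_ge0 ?weight_ge0//.
  by rewrite ler_piMl// expR_le1 oppr_le0 !mulr_ge0// ltW.
Qed.

(** Inversion in x with q frozen. The transforms in x are compared for p > q, so q is the threshold
    given to [laplace_unique]; [kappa] is the inverse of the factor pi / sin (pi alpha) in the
    transform of the density. *)
Let phi1_psi q x : 0 < q -> 0 < x -> fine (phi1 q x) = kappa * fine (Hq q) * fine (psi q x).
Proof.
move=> q0 x0.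
have Hfin : Hq q \is a fin_num by exact: efine.
have Hq0 : 0 <= fine (Hq q).
  by rewrite fine_ge0//; apply: integral_ge0 => t _; rewrite lee_fin mulr_ge0 ?expR_ge0 ?weight_ge0.
have phi1_fin y : phi1 q y \is a fin_num by apply: efine.
have mphi1 : measurable_fun [set: R] (phi1 q).
  apply: (@measurable_integral_snd _ _ _ _ _ mu _ (fun z : R * R => (expR (- (q * z.2)) * F z.1 z.2)%:E)) => //.
    apply/measurable_EFinP; apply: measurable_funM => //.
    exact: (measurableT_comp (measurable_expRM q)).
  by move=> z; rewrite lee_fin mulr_ge0 ?expR_ge0 ?weight_ge0.
have mpsi : measurable_fun [set: R] (psi q).
  apply: (@measurable_integral_snd _ _ _ _ _ mu _ (fun z : R * R => (expR (- (q * (z.1 * z.2))) * weight z.2)%:E)) => //.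
    apply/measurable_EFinP; apply: measurable_funM; first exact: mexp2.
    exact: (measurableT_comp mweight).
  by move=> z; rewrite lee_fin mulr_ge0 ?expR_ge0 ?weight_ge0.
have L1 p : q < p -> (\int[mu]_(y in `]0%R, +oo[) (expR (- (p * y)) * fine (phi1 q y))%:E =
    ((1 - (q / p) `^ alpha) / (p - q))%:E * Hq q)%E.
  move=> qp; rewrite -(laplace_mean_increment alpha_gt0 c_gt0 levyA stD indAD YE cg g01 g0 q0 qp).
  apply: eq_integral0y => y y0; rewrite EFinM fineK// -ge0_integralZl//; last 2 first.
  - apply: measurable_funTS; apply/measurable_EFinP.
    by apply: measurable_funM; [exact: measurable_expRM|exact: mFx].
  - by move=> t _; rewrite lee_fin mulr_ge0 ?expR_ge0 ?weight_ge0.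
  by apply: eq_integral0y => t _; rewrite -EFinM mulrA -expRD -opprD.
apply: (@laplace_unique R (fun x => fine (phi1 q x)) (fun x => kappa * fine (Hq q) * fine (psi q x)) q) => //.
- by apply: measurableT_comp => //; exact: fine_measurable.
- by apply: measurable_funM => //; apply: measurableT_comp => //; exact: fine_measurable.
- by move=> y y0; rewrite fine_ge0//; apply: integral_ge0 => t _; rewrite lee_fin mulr_ge0 ?expR_ge0 ?weight_ge0.
- move=> y y0; rewrite !mulr_ge0 ?invr_ge0 ?pi_ge0 ?(ltW sin_gt0)//.
  by rewrite fine_ge0//; case/andP: (psi_le q0 y0).
- by move=> s s0; exact: phi1_cvg.
- by move=> s s0; apply: cvgM; [exact: cvg_cst|]; exact: psi_cvg.
- by move=> p qp; rewrite L1// -(fineK Hfin) -EFinM ltry.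
move=> p qp; rewrite L1//.
have lap := laplace_overshoot_density alpha01 q0 qp.
transitivity ((kappa * fine (Hq q))%:E * (pi / sin (pi * alpha) * ((1 - (q / p) `^ alpha) / (p - q)))%:E)%E.
  rewrite -[in LHS](fineK Hfin) -!EFinM; congr EFin.
  have kM : kappa * (pi / sin (pi * alpha)) = 1.
    by rewrite mulrA divfK ?divff// gt_eqF// pi_gt0.
  by rewrite [RHS]mulrACA kM mul1r mulrC.
rewrite -lap -ge0_integralZl//; last 3 first.
- apply: emeasurable_funM.
    by apply: measurable_funTS; apply/measurable_EFinP; exact: measurable_expRM.
  apply: (eq_measurable_fun (psi q)); last exact: measurable_funTS.
  move=> y /set_mem/=; rewrite in_itv/= andbT => y0; exact: psiE.
- move=> y; rewrite /= in_itv/= andbT => y0.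
  rewrite -psiE// mule_ge0// ?lee_fin ?expR_ge0//.
  by case/andP: (psi_le q0 y0).
- by rewrite lee_fin mulr_ge0// ltW.
apply: eq_integral0y => y y0; rewrite -psiE// -(fineK (psi_fin q0 y0)) -!EFinM.
by congr EFin; ring.
Qed.

(** A translation by r: as [H] vanishes at negative times, the part of the integral before r
    contributes nothing. *)
Let laplace_shift q r : 0 < q -> 0 < r ->
  (\int[mu]_(t in `]0%R, +oo[) (expR (- (q * t)) * H (t - r))%:E =
   (expR (- (q * r)))%:E * Hq q)%E.
Proof.
move=> q0 r0.
have mHr : measurable_fun [set: R] (fun t => H (t - r)).
  by apply: (measurableT_comp mH); exact: measurable_funB.
have me (u : R -> R) : measurable_fun [set: R] u ->
    measurable_fun [set: R] (fun t => (expR (- (q * t)) * u t)%:E).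
  move=> mu'; apply/measurable_EFinP; apply: measurable_funM => //.
  exact: measurable_expRM.
have mD0 : measurable D0 by exact: measurable_itv.
pose G (t : R) : \bar R := (expR (- (q * t)) * H (t - r))%:E.
have mGD : measurable_fun D0 G by apply: measurable_funTS; exact: me.
have mGr := (measurable_restrictT G mD0).1 mGD.
rewrite /Hq [X in (_ * X)%E]integral_itv_obnd_cbnd; last first.
  by apply: measurable_funTS; exact: me.
rewrite integral_mkcond.
rewrite (@ge0_integral_affine R 1 r)//; last first.
  move=> t; apply: erestrict_ge0 => {}t _.
  by rewrite lee_fin mulr_ge0 ?expR_ge0.
rewrite mul1e -ge0_integralZl//; last 2 first.
- by apply: measurable_funTS; exact: me.
- by move=> t _; rewrite lee_fin mulr_ge0 ?expR_ge0.
rewrite [RHS]integral_mkcond; apply: eq_integral => t _.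
rewrite !patchE !mem_setE !in_itv/= !andbT mul1r addrK.
have [t0|t0] := leP 0 t.
  rewrite ltr_wpDl// -EFinM; congr EFin; rewrite mulrA -expRD; congr (expR _ * _); ring.
have -> : H t = 0 by rewrite /mean_position leNgt t0.
by rewrite mulr0; case: ifP.
Qed.

Let mk x : measurable_fun [set: R] (fun r => `|k x r|).
Proof. by apply: measurableT_comp => //; exact: measurable_overshoot_density. Qed.

Let kE x r : 0 < x -> 0 < r -> `|k x r| = k x r.
Proof. by move=> x0 r0; rewrite ger0_norm// overshoot_density_ge0// ltW. Qed.

Let integrable_k x : 0 < x -> mu.-integrable D0 (fun r => (`|k x r|)%:E).
Proof.
move=> x0; apply/integrableP; split.
  by apply: measurable_funTS; apply/measurable_EFinP; exact: mk.
rewrite (@eq_integral0y _ _ (fun r => 1 * (k x r)%:E)%E); last first.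
  by move=> r r0; rewrite gee0_abs// kE// mul1e.
rewrite (@integral_overshoot_density _ alpha x (fun=> 1%E))//.
rewrite (@eq_integral0y _ _ (fun v => (weight v)%:E)); last first.
  by move=> v v0; rewrite weightE// mul1e.
by rewrite weight_mass ltry.
Qed.

Let conv x t : \bar R := (\int[mu]_(r in `]0%R, +oo[) (`|k x r| * H (t - r))%:E)%E.

Let mconv x : measurable_fun [set: R] (conv x).
Proof.
apply: (@measurable_integral_snd _ _ _ _ _ mu _ (fun z : R * R => (`|k x z.2| * H (z.1 - z.2))%:E)) => //.
  apply/measurable_EFinP; apply: measurable_funM.
    exact: (measurableT_comp (mk x)).
  by apply: (measurableT_comp mH); exact: measurable_funB.
by move=> z; rewrite lee_fin mulr_ge0.
Qed.

Let mconv_term x t : measurable_fun [set: R] (fun r => `|k x r| * H (t - r)).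
Proof.
apply: measurable_funM; first exact: mk.
by apply: (measurableT_comp mH); exact: measurable_funB.
Qed.

Let conv_fin x t : 0 < x -> conv x t \is a fin_num.
Proof.
move=> x0; apply: integrable_fin_num => //.
apply: (le_integrable _ _ _ (integrable_k x0)) => //.
  by apply: measurable_funTS; apply/measurable_EFinP; exact: mconv_term.
move=> r _; rewrite !gee0_abs ?lee_fin ?mulr_ge0//.
by rewrite ler_piMr.
Qed.

Let conv_cvg x s : 0 < x -> 0 < s ->
  fine (conv x t) @[t --> s^'+] --> fine (conv x s).
Proof.
move=> x0 s0; apply/cvg_at_rightP => u [us cu].
suff : conv x (u n) @[n --> \oo] --> (fine (conv x s))%:E by move=> /fine_cvg.
rewrite fineK; last exact: conv_fin.
have [] := @dominated_convergence _ _ _ mu D0 _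
  (fun n r => (`|k x r| * H (u n - r))%:E)
  (fun r => (`|k x r| * H (s - r))%:E) (fun r => (`|k x r|)%:E) => //.
- by move=> n; apply: measurable_funTS; apply/measurable_EFinP; exact: mconv_term.
- by apply: measurable_funTS; apply/measurable_EFinP; exact: mconv_term.
- apply: aeW => r _; apply: cvg_EFin; first exact: nearW.
  apply: cvgM; first exact: cvg_cst.
  have cur : u n - r @[n --> \oo] --> s - r by apply: cvgB => //; exact: cvg_cst.
  (* For r <= s the argument tends to s - r >= 0 from the right; for r > s it is eventually
     negative, where [H] is 0. *)
  have [rs|sr] := leP r s.
    apply: (mean_position_cvg c_gt0 levyA stD YE cg g01) => //.
      by rewrite subr_ge0.
    by move=> n; rewrite lerD2r ltW.
  have -> : H (s - r) = 0 by rewrite /mean_position leNgt subr_lt0 sr.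
  apply: cvg_near_cst; near=> n.
  rewrite /mean_position leNgt subr_lt0.
  suff -> : u n < r by [].
  by near: n; apply: cvgr_lt cu _ sr.
- exact: integrable_k.
- apply: aeW => r n _; rewrite gee0_abs lee_fin ?mulr_ge0//.
  by rewrite ler_piMr.
Unshelve. all: by end_near. Qed.

(** Inversion in t: by Tonelli and [laplace_shift], the convolution of the density with [H] has the
    product of their transforms as its own, and [phi1_psi] identifies this with the transform of
    [F x]. *)
Lemma mean_increment_density x t : 0 < x -> 0 < t ->
  (F x t)%:E = (kappa%:E * \int[mu]_(r in `]0%R, +oo[) (k x r * H (t - r))%:E)%E.
Proof.
move=> x0 t0.
have -> : (\int[mu]_(r in `]0%R, +oo[) (k x r * H (t - r))%:E = conv x t)%E.
  by apply: eq_integral0y => r r0; rewrite kE.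
rewrite -(fineK (conv_fin t x0)) -EFinM; congr EFin.
have conv0 y : 0 <= fine (conv x y).
  by rewrite fine_ge0//; apply: integral_ge0 => r _; rewrite lee_fin mulr_ge0.
have phi1_fin q : 0 < q -> phi1 q x \is a fin_num by move=> q0; apply: efine.
apply: (@laplace_unique R (F x) (fun t => kappa * fine (conv x t)) 0) => //.
- apply: measurable_funM => //; apply: measurableT_comp => //; exact: fine_measurable.
- by move=> y y0; rewrite mulr_ge0// ltW.
- move=> s s0; apply/cvg_at_rightP => u [us cu].
  apply: (mean_increment_cvg c_gt0 levyA stD YE cg g01 (u := fun=> x)).
  + exact: ltW.
  + exact: ltW.
  + by [].
  + by move=> n; exact: ltW.
  + exact: cvg_cst.
  + exact: cu.
- by move=> s s0; apply: cvgM; [exact: cvg_cst|]; exact: conv_cvg.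
- by move=> q q0; rewrite -/(phi1 q x) -(fineK (phi1_fin q q0)) ltry.
move=> q q0; rewrite -/(phi1 q x) -(fineK (phi1_fin q q0)) phi1_psi//.
have Hfin : Hq q \is a fin_num by exact: efine.
pose f (z : R * R) := (expR (- (q * z.1)) * (kappa * (`|k x z.2| * H (z.1 - z.2))))%:E.
have mf : measurable_fun [set: R * R] f.
  apply/measurable_EFinP; apply: measurable_funM.
    exact: (measurableT_comp (measurable_expRM q)).
  apply: measurable_funM => //; apply: measurable_funM.
    exact: (measurableT_comp (mk x)).
  by apply: (measurableT_comp mH); exact: measurable_funB.
have kappa0 := ltW kappa_gt0.
have f0 z : (0 <= f z)%E.
  by rewrite lee_fin; apply: mulr_ge0; [exact: expR_ge0|apply: mulr_ge0; [|exact: mulr_ge0]].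
transitivity (\int[mu]_(t in `]0%R, +oo[) \int[mu]_(r in `]0%R, +oo[) f (t, r))%E; last first.
  apply: eq_integral0y => y y0; rewrite mulrCA mulrA EFinM fineK ?conv_fin//.
  rewrite -ge0_integralZl//; last 3 first.
  - by apply: measurable_funTS; apply/measurable_EFinP; exact: mconv_term.
  - by move=> r _; rewrite lee_fin mulr_ge0.
  - by rewrite lee_fin; apply: mulr_ge0; [|exact: expR_ge0].
  by apply: eq_integral0y => r r0; rewrite /f/= -EFinM; congr EFin; ring.
rewrite tonelli_setX//.
transitivity (\int[mu]_(r in `]0%R, +oo[) ((kappa * fine (Hq q))%:E *
    ((expR (- (q * r)))%:E * (k x r)%:E)))%E; last first.
  apply: eq_integral0y => r r0.
  transitivity ((kappa * k x r)%:E * \int[mu]_(t in `]0%R, +oo[) (expR (- (q * t)) * H (t - r))%:E)%E.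
    by rewrite laplace_shift// -(fineK Hfin) -!EFinM; congr EFin; ring.
  rewrite -ge0_integralZl//; last 3 first.
  - apply: measurable_funTS; apply/measurable_EFinP; apply: measurable_funM.
      exact: measurable_expRM.
    by apply: (measurableT_comp mH); exact: measurable_funB.
  - by move=> y _; rewrite lee_fin mulr_ge0 ?expR_ge0.
  - by rewrite lee_fin; apply: mulr_ge0 => //; rewrite overshoot_density_ge0// ltW.
  by apply: eq_integral0y => y y0; rewrite /f/= kE// -EFinM; congr EFin; ring.
rewrite ge0_integralZl//; last 3 first.
- apply: measurable_funTS; apply: emeasurable_funM; apply/measurable_EFinP.
    exact: measurable_expRM.
  exact: measurable_overshoot_density.
- move=> r; rewrite /= in_itv/= andbT => r0.
  by rewrite mule_ge0 ?lee_fin ?expR_ge0// overshoot_density_ge0// ltW.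
- rewrite lee_fin; apply: mulr_ge0 => //; rewrite fine_ge0//.
  by apply: integral_ge0 => y _; rewrite lee_fin mulr_ge0 ?expR_ge0.
by rewrite -psiE// EFinM fineK// psi_fin.
Qed.

End overshoot_identity.

(** * From continuous functions to Borel sets *)

Section borel_extension.
Context d (T : measurableType d) (R : realType) (P : probability T R).
Notation mu := (@lebesgue_measure R).
Variables (alpha c : R) (A D Y : R -> {RV P >-> R}).
Hypothesis alpha01 : 0 < alpha < 1.
Hypothesis c_gt0 : 0 < c.
Hypothesis levyA : levy_process A.
Hypothesis stD : stable_subordinator alpha c D.
Hypothesis indAD : independent_processes A D.
Hypothesis YE : time_changed A (inverse_process D) Y.

Local Notation k := (overshoot_density alpha).
Local Notation kappa := (sin (pi * alpha) / pi).

Section approximation.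
Variable u : R -> R.
Hypothesis cu : continuous u.
Hypothesis u_ge0 : forall y, 0 <= u y.

(** Continuous functions with values in [0, 1] that increase to the indicator of the open set u > 0
    and vanish where u does; with u 0 = 0 they fall under the continuous case. *)
Definition open_approx (n : nat) (y : R) : R := Num.min 1 (n%:R * u y).

Lemma open_approx01 n y : 0 <= open_approx n y <= 1.
Proof. by rewrite le_min ler01 mulr_ge0//= ge_min lexx. Qed.

Lemma continuous_open_approx n : continuous (open_approx n).
Proof.
move=> y; apply: (@continuous_min _ _ (fun=> 1) (fun y => n%:R * u y)).
  exact: cvg_cst.
by apply: cvgM; [exact: cvg_cst|exact: cu].
Qed.

Lemma open_approx_homo y m n : (m <= n)%N -> open_approx m y <= open_approx n y.
Proof.
by move=> mn; rewrite le_min ge_min lexx/= ge_min ler_wpM2r ?ler_nat ?orbT.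
Qed.

Lemma open_approx_cvg y : open_approx n y @[n --> \oo] --> (\1_[set y | 0 < u y] y : R).
Proof.
rewrite indicE; have [uy|uy] := ltP 0 (u y).
  rewrite mem_set//; apply: cvg_near_cst; near=> n.
  rewrite /open_approx min_l// -ler_pdivrMr//.
  by near: n; exact: nbhs_infty_ger.
have u0 : u y = 0 by apply/eqP; rewrite eq_le uy u_ge0.
rewrite memNset/=; last by rewrite u0 ltxx.
apply: cvg_near_cst; apply: nearW => n.
by rewrite /open_approx u0 mulr0 min_r.
Unshelve. all: by end_near. Qed.

Lemma mean_open_approx_cvg (X : T -> R) : measurable_fun [set: T] X ->
  (\int[P]_w (open_approx n (X w))%:E)%E @[n --> \oo] -->
  P (X @^-1` [set y | 0 < u y]).
Proof.
move=> mX.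
have ma n : measurable_fun [set: R] (open_approx n).
  by apply: continuous_measurable_fun; exact: continuous_open_approx.
have mu0 : measurable [set y | 0 < u y].
  have := @measurable_set_leltr _ _ _ (cst 0) (cst 0) u.
  rewrite (_ : [set x | _ <= _ < _] = [set y | 0 < u y]).
    by apply => //; exact: continuous_measurable_fun.
  by apply/seteqP; split => y /=; rewrite lexx.
have mXu : measurable (X @^-1` [set y | 0 < u y]).
  by rewrite -[X in measurable X]setTI; exact: mX.
have -> : P (X @^-1` [set y | 0 < u y]) =
    (\int[P]_w limn (fun n => (open_approx n (X w))%:E))%E.
  rewrite -[LHS]/(P (X @^-1` [set y | 0 < u y])) -[X in P X]setIT -integral_indic//.
  apply: eq_integral => w _; apply/esym/cvg_lim => //.
  apply: cvg_EFin; first exact: nearW.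
  exact: open_approx_cvg.
apply: cvg_monotone_convergence => //.
- by move=> n; apply/measurable_EFinP; exact: (measurableT_comp (ma n)).
- by move=> n w _; rewrite lee_fin; case/andP: (open_approx01 n (X w)).
- by move=> w _ m n mn; rewrite lee_fin; exact: open_approx_homo.
Qed.

End approximation.

Variables (x t : R).
Hypothesis x_gt0 : 0 < x.
Hypothesis t_gt0 : 0 < t.

Local Notation D0t := (`]0%R, t[%classic : set (measurableTypeR R)).

Let k_ge0 r : D0t r -> 0 <= k x r.
Proof. by rewrite /= in_itv/= => /andP[r0 _]; rewrite overshoot_density_ge0// ltW. Qed.

Let eq_measurable_D0t (f h : R -> \bar R) : (forall r, D0t r -> f r = h r) ->
  measurable_fun D0t f -> measurable_fun D0t h.
Proof. by move=> fh; apply: eq_measurable_fun => r /set_mem /fh. Qed.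

(** Measurability in r is carried along because the closure steps of the Dynkin induction rely on it
    when they split and sum integrals. *)
Definition overshoot_formula (S : set R) : Prop :=
  measurable_fun D0t (fun r => P (Y (t - r) @^-1` S)) /\
  P (increment Y x (x + t) @^-1` S) =
  (kappa%:E * \int[mu]_(r in D0t) ((k x r)%:E * P (Y (t - r) @^-1` S)))%E.

Let formula_continuous (g : R -> R) : continuous g -> (forall y, 0 <= g y <= 1) -> g 0 = 0 ->
  measurable_fun D0t (fun r => \int[P]_w (g (Y (t - r) w))%:E)%E /\
  (\int[P]_w (g (increment Y x (x + t) w))%:E =
  kappa%:E * \int[mu]_(r in D0t) ((k x r)%:E * \int[P]_w (g (Y (t - r) w))%:E))%E.
Proof.
move=> cg g01 g0.
have mH := measurable_mean_position c_gt0 levyA stD indAD YE cg g01.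
have mHt : measurable_fun [set: R] (fun r => mean_position Y g (t - r)).
  by apply: (measurableT_comp mH); exact: measurable_funB.
have HE r : D0t r -> (\int[P]_w (g (Y (t - r) w))%:E = (mean_position Y g (t - r))%:E)%E.
  rewrite /= in_itv/= => /andP[_ rt].
  by rewrite (mean_positionE Y cg g01)// subr_ge0 ltW.
split.
  apply: (@eq_measurable_D0t (fun r => (mean_position Y g (t - r))%:E)).
    by move=> r rD; rewrite HE.
  by apply: measurable_funTS; exact/measurable_EFinP.
rewrite -(mean_incrementE Y cg g01 (ltW x_gt0) (ltW t_gt0)).
rewrite (mean_increment_density alpha01 c_gt0 levyA stD indAD YE cg g01 g0 x_gt0 t_gt0).
congr (_ * _)%E.
(* [mean_position] is 0 at negative times, which truncates the integral at r = t; that endpoint is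
   then dropped as a null set. *)
transitivity (\int[mu]_(r in `]0%R, t]) (k x r * mean_position Y g (t - r))%:E)%E.
  rewrite [LHS]integral_mkcond [RHS]integral_mkcond; apply: eq_integral => r _.
  rewrite !patchE !mem_setE !in_itv/= andbT; case: (ltP 0 r) => //= r0.
  have [//|tr] := leP r t.
  by rewrite /mean_position leNgt subr_lt0 tr mulr0.
rewrite -integral_itv_bndo_bndc; last first.
  apply: measurable_funTS; apply/measurable_EFinP; apply: measurable_funM => //.
  exact: measurable_overshoot_density.
by apply: eq_integral => r /set_mem rD; rewrite EFinM HE.
Qed.

Let formula_open (u : R -> R) : continuous u -> (forall y, 0 <= u y) -> u 0 = 0 ->
  overshoot_formula [set y | 0 < u y].
Proof.
move=> cu u0 u00.
have a0 n : open_approx u n 0 = 0 by rewrite /open_approx u00 mulr0 min_r.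
have fc n := formula_continuous (continuous_open_approx cu (n := n)) (open_approx01 u0 n) (a0 n).
pose q n r := (\int[P]_w (open_approx u n (Y (t - r) w))%:E)%E.
have mq n : measurable_fun D0t (q n) by case: (fc n).
have q0 n r : (0 <= q n r)%E.
  by apply: integral_ge0 => w _; rewrite lee_fin; case/andP: (open_approx01 u0 n (Y (t - r) w)).
have qcvg r : q n r @[n --> \oo] --> P (Y (t - r) @^-1` [set y | 0 < u y]).
  exact: mean_open_approx_cvg.
have mP : measurable_fun D0t (fun r => P (Y (t - r) @^-1` [set y | 0 < u y])).
  by apply: (emeasurable_fun_cvg q).
split => //.
have ma n : measurable_fun [set: R] (open_approx u n).
  by apply: continuous_measurable_fun; exact: continuous_open_approx.
have mk : measurable_fun D0t (fun r => (k x r)%:E).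
  by apply: measurable_funTS; apply/measurable_EFinP; exact: measurable_overshoot_density.
have c1 := mean_open_approx_cvg cu u0 (measurable_increment Y x (x + t)).
rewrite -(cvg_lim _ c1)//; apply/cvg_lim => //.
under eq_fun do rewrite (fc _).2.
apply: cvgeZl => //.
have -> : (\int[mu]_(r in D0t) ((k x r)%:E * P (Y (t - r) @^-1` [set y | (0 < u y)%R])) =
   \int[mu]_(r in D0t) limn (fun n => (k x r)%:E * q n r))%E.
  apply: eq_integral => r _; apply/esym/cvg_lim => //.
  by apply: cvgeZl => //; exact: qcvg.
apply: cvg_monotone_convergence => //.
- by move=> n; exact: (emeasurable_funM mk (mq n)).
- by move=> n r rD; apply: mule_ge0; [rewrite lee_fin k_ge0|exact: q0].
- move=> r rD m n mn; apply: lee_wpmul2l; first by rewrite lee_fin k_ge0.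
  apply: ge0_le_integral => //.
  + by move=> w _; rewrite lee_fin; case/andP: (open_approx01 u0 m (Y (t - r) w)).
  + by apply/measurable_EFinP; exact: (measurableT_comp (ma m)).
  + by apply/measurable_EFinP; exact: (measurableT_comp (ma n)).
  + by move=> w _; rewrite lee_fin; exact: open_approx_homo.
Qed.

(** Sets avoiding 0 are not closed under complement, whereas the class of all [S] for which the
    formula holds once 0 is removed is, and this makes a Dynkin argument possible. *)
Let S0 (S : set R) := S `&` [set y | y != 0].

Let measurable_S0 S : measurable S -> measurable (S0 S).
Proof.
move=> mS; apply: measurableI => //.
rewrite (_ : [set y | y != 0] = ~` [set 0]); first exact: measurableC.
by apply/seteqP; split => y /= /eqP.
Qed.

Let measurable_pre (X : T -> R) S : measurable_fun [set: T] X -> measurable S ->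
  measurable (X @^-1` S).
Proof. by move=> mX mS; rewrite -[X in measurable X]setTI; exact: mX. Qed.

Lemma overshoot_formula_borel (S : set R) : measurable S ->
  overshoot_formula (S0 S).
Proof.
move=> mS.
have mk : measurable_fun D0t (fun r => (k x r)%:E).
  by apply: measurable_funTS; apply/measurable_EFinP; exact: measurable_overshoot_density.
have cabs : continuous (fun y : R => `|y|) by exact: norm_continuous.
(* The line without 0 is the open set where the absolute value is positive. *)
have fT : overshoot_formula (S0 setT).
  have := formula_open cabs (@normr_ge0 _ _) (normr0 _).
  rewrite (_ : [set y | 0 < `|y|] = S0 setT)//.
  apply/seteqP; split => y /=; rewrite normr_gt0; first by split.
  by case.
apply: (@dynkin_induction _ (measurableTypeR R) (@RGenOInfty.G R) (fun S => overshoot_formula (S0 S))).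
- exact: RGenOInfty.measurableE.
- move=> _ _ [a ->] [b ->]; exists (Num.max a b).
  by apply/seteqP; split => y /=; rewrite !in_itv/= !andbT gt_max; [case=> -> ->|move=> /andP[]].
- exact: fT.
- move=> _ [a ->].
  (* Positive exactly on ]a, +oo[ without 0; these rays are stable under intersection and generate
     the Borel sets. *)
  pose u y := Num.min (Num.max 0 (y - a)) `|y|.
  have cu : continuous u.
    move=> y; apply: (@continuous_min _ _ (fun y => Num.max 0 (y - a)) (fun y => `|y|)).
      apply: (@continuous_max _ _ (fun=> 0) (fun y => y - a)); first exact: cvg_cst.
      by apply: cvgB; [exact: cvg_id|exact: cvg_cst].
    exact: cabs.
  have u0 y : 0 <= u y by rewrite le_min le_max lexx normr_ge0.
  have u00 : u 0 = 0 by rewrite /u normr0 min_r// le_max lexx.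
  have := formula_open cu u0 u00.
  rewrite (_ : [set y | 0 < u y] = S0 `]a, +oo[)//.
  apply/seteqP; split => y; rewrite /S0/= lt_min lt_max ltxx/= subr_gt0 normr_gt0 in_itv/= andbT.
    by move=> /andP[].
  by move=> [-> ->].
- move=> S' mS' [mP' fP'].
  have split_S0 (X : T -> R) : measurable_fun [set: T] X ->
      (P (X @^-1` S0 setT) = P (X @^-1` S0 S') + P (X @^-1` S0 (~` S')))%E.
    move=> mX; rewrite -measureU.
    - by rewrite -preimage_setU -setIUl setUv.
    - by apply: measurable_pre => //; exact: measurable_S0.
    - by apply: measurable_pre => //; apply: measurable_S0; exact: measurableC.
    - by rewrite -preimage_setI setIACA setICr set0I preimage_set0.
  have mP'' : measurable_fun D0t (fun r => P (Y (t - r) @^-1` S0 (~` S'))).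
    have [mPT _] := fT.
    apply: (@eq_measurable_D0t (fun r => P (Y (t - r) @^-1` S0 setT) - P (Y (t - r) @^-1` S0 S'))%E).
      move=> r _; rewrite (split_S0 (Y (t - r)))// addeAC subee ?add0e//.
      by apply: fin_num_measure; apply: measurable_pre => //; exact: measurable_S0.
    exact: (emeasurable_funB mPT mP').
  split => //.
  have finI : P (increment Y x (x + t) @^-1` S0 S') \is a fin_num.
    apply: fin_num_measure; apply: measurable_pre; last exact: measurable_S0.
    exact: measurable_increment.
  have := fT.2; rewrite (split_S0 _ (measurable_increment Y x (x + t))).
  have -> : (\int[mu]_(r in D0t) ((k x r)%:E * P (Y (t - r) @^-1` S0 setT)) =
     \int[mu]_(r in D0t) ((k x r)%:E * P (Y (t - r) @^-1` S0 S')) +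
     \int[mu]_(r in D0t) ((k x r)%:E * P (Y (t - r) @^-1` S0 (~` S'))))%E.
    rewrite -ge0_integralD//; last 4 first.
    - by move=> r rD; rewrite mule_ge0// lee_fin k_ge0.
    - exact: (emeasurable_funM mk mP').
    - by move=> r rD; rewrite mule_ge0// lee_fin k_ge0.
    - exact: (emeasurable_funM mk mP'').
    apply: eq_integral => r _; rewrite (split_S0 (Y (t - r)))//.
    by rewrite ge0_muleDr.
  rewrite ge0_muleDr; last 2 first.
  - by apply: integral_ge0 => r rD; rewrite mule_ge0// lee_fin k_ge0.
  - by apply: integral_ge0 => r rD; rewrite mule_ge0// lee_fin k_ge0.
  (* The term for S' is a probability, hence finite, and cancels from both sides. *)
  rewrite -fP' => /(congr1 (fun z => z - P (increment Y x (x + t) @^-1` S0 S'))%E).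
  by rewrite ![(P (increment Y x (x + t) @^-1` S0 S') + _)%E]addeC !addeK.
- move=> F mF tF fF.
  have E (X : T -> R) : measurable_fun [set: T] X ->
      (P (X @^-1` S0 (\bigcup_i F i)) = \sum_(0 <= i <oo) P (X @^-1` S0 (F i)))%E.
    move=> mX; rewrite /S0 setI_bigcupl preimage_bigcup measure_semi_bigcup//.
    - by move=> i; apply: measurable_pre => //; exact: (measurable_S0 (mF i)).
    - move/trivIsetP : tF => tF; apply/trivIsetP => i j _ _ ij.
      by rewrite -preimage_setI setIACA tF// set0I preimage_set0.
    - apply: bigcupT_measurable => i.
      by apply: measurable_pre => //; exact: (measurable_S0 (mF i)).
  have mPi i := (fF i).1.
  split.
    apply: (@eq_measurable_D0t (fun r => \sum_(0 <= i <oo) P (Y (t - r) @^-1` S0 (F i)))%E).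
      by move=> r _; rewrite E.
    by apply: ge0_emeasurable_nneseries.
  rewrite E; last exact: measurable_increment.
  transitivity (\sum_(0 <= i <oo) (kappa%:E * \int[mu]_(r in D0t) ((k x r)%:E * P (Y (t - r) @^-1` S0 (F i)))))%E.
    by apply: eq_eseriesr => i _; exact: (fF i).2.
  rewrite nneseriesZl; last first.
    by move=> i _; apply: integral_ge0 => r rD; rewrite mule_ge0// lee_fin k_ge0.
  congr (_ * _)%E; rewrite -integral_nneseries//; last 2 first.
  - by move=> i; exact: (emeasurable_funM mk (mPi i)).
  - by move=> i r rD; rewrite mule_ge0// lee_fin k_ge0.
  apply: eq_integral => r /set_mem rD; rewrite E// nneseriesZl//.
- suff : (@RGenOInfty.G R).-sigma.-measurable S by [].
  by rewrite -RGenOInfty.measurableE; exact: mS.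
Qed.

End borel_extension.

(** * Asymptotics drawn from the overshoot identity *)

Section asymptotics.
Context d (T : measurableType d) (R : realType) (P : probability T R).
Notation mu := (@lebesgue_measure R).
Variables (alpha c : R) (A D Y : R -> {RV P >-> R}).
Hypothesis alpha01 : 0 < alpha < 1.
Hypothesis c_gt0 : 0 < c.
Hypothesis levyA : levy_process A.
Hypothesis stD : stable_subordinator alpha c D.
Hypothesis indAD : independent_processes A D.
Hypothesis YE : time_changed A (inverse_process D) Y.
Variables (t : R) (B : set R).
Hypothesis t_gt0 : 0 < t.
Hypothesis mB : measurable B.
Hypothesis B0 : ~ B 0.

Local Notation k := (overshoot_density alpha).
Local Notation kappa := (sin (pi * alpha) / pi).
Local Notation D0t := (`]0%R, t[%classic : set (measurableTypeR R)).

Let p (x : R) : \bar R := P (increment Y x (t + x) @^-1` B).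
Let h (r : R) : \bar R := P (Y (t - r) @^-1` B).
Let w (r : R) : R := fine (h r) * r `^ (- alpha).
Let I : \bar R := (\int[mu]_(r in D0t) (w r)%:E)%E.

Let kappa_gt0 : 0 < kappa.
Proof.
case/andP: alpha01 => a0 a1; rewrite divr_gt0 ?pi_gt0//.
by rewrite sin_gt0_pi// mulr_gt0 ?pi_gt0//= gtr_pMr ?pi_gt0.
Qed.

Let h_fin r : h r \is a fin_num.
Proof.
apply: fin_num_measure; rewrite -[X in measurable X]setTI.
exact: (measurable_funPT (Y (t - r))).
Qed.

Let w_ge0 r : 0 <= w r.
Proof. by rewrite mulr_ge0 ?powR_ge0// fine_ge0// measure_ge0. Qed.

Let increment_probability x : 0 < x ->
  measurable_fun D0t h /\
  p x = (kappa%:E * \int[mu]_(r in D0t) ((k x r)%:E * h r))%E.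
Proof.
move=> x0.
have := overshoot_formula_borel alpha01 c_gt0 levyA stD indAD YE x0 t_gt0 mB.
rewrite (_ : B `&` [set y | y != 0] = B).
  by rewrite /overshoot_formula addrC.
by apply/seteqP; split => y /=; [case|split=> //; apply/eqP => y0; apply: B0; rewrite -y0].
Qed.

Let mw : measurable_fun D0t (fun r => (w r)%:E).
Proof.
apply/measurable_EFinP; apply: measurable_funM.
  apply: measurableT_comp => //.
  exact: (increment_probability ltr01).1.
by apply: measurable_funTS; exact: measurable_powR.
Qed.

Let mkh x : 0 < x -> measurable_fun D0t (fun r => (k x r)%:E * h r)%E.
Proof.
move=> x0; apply: emeasurable_funM; last exact: (increment_probability ltr01).1.
by apply: measurable_funTS; apply/measurable_EFinP; exact: measurable_overshoot_density.
Qed.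

Let density_weight x r : 0 < x -> D0t r ->
  ((k x r)%:E * h r = (x / (x + r) * x `^ (alpha - 1) * w r)%:E)%E.
Proof.
rewrite /= in_itv/= => x0 /andP[r0 rt].
case/andP: alpha01 => a0 a1.
rewrite -[in LHS](fineK (h_fin r)) -EFinM; congr (_%:E).
rewrite /w /overshoot_density powRM ?invr_ge0 ?ltW//.
rewrite -(powR_inv1 (ltW r0)) -powRrM mulN1r -(mulr_powRB1 (ltW x0) a0).
by ring.
Qed.

Let integral_lower x : 0 < x ->
  ((x / (x + t) * x `^ (alpha - 1))%:E * I <=
   \int[mu]_(r in D0t) ((k x r)%:E * h r))%E.
Proof.
move=> x0; rewrite /I -ge0_integralZl//; last 2 first.
- by move=> r _; rewrite lee_fin.
- by rewrite lee_fin mulr_ge0 ?powR_ge0// divr_ge0 ?ltW// addr_gt0.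
apply: ge0_le_integral => //.
- move=> r _; rewrite -EFinM lee_fin mulr_ge0// mulr_ge0 ?powR_ge0//.
  by rewrite divr_ge0 ?ltW// addr_gt0.
- by apply: emeasurable_funM => //; exact: measurable_cst.
- exact: mkh.
move=> r rD; rewrite density_weight// -EFinM lee_fin.
move: rD; rewrite /= in_itv/= => /andP[r0 rt].
rewrite ler_wpM2r// ler_wpM2r ?powR_ge0//.
by rewrite ler_wpM2l ?ltW// ltf_pV2 ?posrE ?addr_gt0// ltrD2l.
Qed.

Let integral_upper x : 0 < x ->
  (\int[mu]_(r in D0t) ((k x r)%:E * h r) <= (x `^ (alpha - 1))%:E * I)%E.
Proof.
move=> x0; rewrite /I -ge0_integralZl//; last 2 first.
- by move=> r _; rewrite lee_fin.
- by rewrite lee_fin powR_ge0.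
apply: ge0_le_integral => //.
- move=> r rD; rewrite density_weight// lee_fin.
  move: rD; rewrite /= in_itv/= => /andP[r0 rt].
  by rewrite mulr_ge0// mulr_ge0 ?powR_ge0// divr_ge0 ?ltW// addr_gt0.
- exact: mkh.
- by apply: emeasurable_funM => //; exact: measurable_cst.
move=> r rD; rewrite density_weight// -EFinM lee_fin.
move: rD; rewrite /= in_itv/= => /andP[r0 rt].
rewrite ler_wpM2r// ler_piMl ?powR_ge0//.
by rewrite ler_pdivrMr ?addr_gt0// mul1r lerDl ltW.
Qed.

Let p_fin x : p x \is a fin_num.
Proof.
apply: fin_num_measure; rewrite -[X in measurable X]setTI.
exact: measurable_increment.
Qed.

(** Finiteness comes from the identity itself: at x = 1 a positive multiple of [I] is bounded by a
    probability. *)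
Let I_fin : I \is a fin_num.
Proof.
have I0 : (0 <= I)%E by apply: integral_ge0 => r _; rewrite lee_fin.
rewrite ge0_fin_numE// lt_neqAle leey andbT; apply/eqP => Ioo.
have cst_gt0 : 0 < kappa * (1 / (1 + t) * 1 `^ (alpha - 1)).
  by rewrite mulr_gt0// mulr_gt0 ?powR_gt0// divr_gt0// addr_gt0.
have : ((kappa * (1 / (1 + t) * 1 `^ (alpha - 1)))%:E * I <= p 1)%E.
  rewrite (increment_probability ltr01).2 EFinM -muleA lee_wpmul2l ?integral_lower//.
  by rewrite lee_fin ltW.
rewrite Ioo gt0_muley ?lte_fin// leye_eq => /eqP pE.
by have := p_fin 1; rewrite pE.
Qed.

Let increment_probability_bounds x : 0 < x ->
  x / (x + t) * (kappa * fine I * x `^ (alpha - 1)) <= fine (p x) <=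
  kappa * fine I * x `^ (alpha - 1).
Proof.
move=> x0; rewrite -2!lee_fin fineK// (increment_probability x0).2.
rewrite (_ : x / (x + t) * (kappa * fine I * x `^ (alpha - 1)) =
  kappa * (x / (x + t) * x `^ (alpha - 1) * fine I)); last by ring.
rewrite (_ : kappa * fine I * x `^ (alpha - 1) =
  kappa * (x `^ (alpha - 1) * fine I)); last by ring.
rewrite 2![(kappa * _)%:E]EFinM 2![(_ * fine I)%:E]EFinM fineK//.
by rewrite !lee_wpmul2l ?lee_fin ?(ltW kappa_gt0)// ?integral_lower ?integral_upper.
Qed.

Lemma increment_probability_asymp :
  (forall x : R, 0 < x -> P (increment Y x (t + x) @^-1` B) <> 0%E) ->
  asymp_equiv_pinfty
    (fun x : R => fine (P (increment Y x (t + x) @^-1` B)))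
    (fun x : R => kappa * fine I * x `^ (alpha - 1)).
Proof.
move=> p0.
(* At x = 1 the upper bound is this constant and dominates a nonzero probability. *)
have C_gt0 : 0 < kappa * fine I.
  have /andP[_] := increment_probability_bounds ltr01.
  rewrite powR1 mulr1; apply: lt_le_trans.
  rewrite fine_gt0// lt_neqAle measure_ge0 andbT.
  apply/andP; split; last by rewrite -ge0_fin_numE ?p_fin.
  by rewrite eq_sym; apply/eqP/p0.
apply/cvgrPdist_le => e e0; near=> x.
have x0 : 0 < x by near: x; exact: nbhs_pinfty_gt.
have xt0 : 0 < x + t by rewrite addr_gt0.
have g0 : 0 < kappa * fine I * x `^ (alpha - 1) by rewrite mulr_gt0// powR_gt0.
have /andP[lo up] := increment_probability_bounds x0.
rewrite ger0_norm; last by rewrite subr_ge0 ler_pdivrMr// mul1r.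
apply: (@le_trans _ _ (1 - x / (x + t))).
  by rewrite lerB// ler_pdivlMr.
(* 1 - x / (x + t) = t / (x + t), which is at most [e] as soon as x >= t / e. *)
rewrite -[X in X - _](divff (lt0r_neq0 xt0)) -mulrBl addrC addKr.
rewrite ler_pdivrMr//.
have : t / e <= x by near: x; apply: nbhs_pinfty_ge; rewrite num_real.
rewrite ler_pdivrMr// mulrC => /le_trans; apply.
by rewrite ler_wpM2l ?(ltW e0)// lerDl ltW.
Unshelve. all: by end_near. Qed.

End asymptotics.

Theorem corollary2 (d : measure_display) (T : measurableType d) (R : realType)
  (P : probability T R) (alpha c : R) (A D Y : R -> {RV P >-> R})
  (t : R) (B : set R) :
  0 < alpha -> alpha < 1 -> 0 < c ->
  levy_process A ->
  stable_subordinator alpha c D ->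
  independent_processes A D ->
  time_changed A (inverse_process D) Y ->
  0 < t ->
  measurable B ->
  ~ B 0 ->
  (forall t0 : R, 0 < t0 -> P (increment Y t0 (t + t0) @^-1` B) <> 0%E) ->
  let C : R := sin (pi * alpha) / pi *
    \int[lebesgue_measure]_(r in `]0, t[)
      (fine (P (Y (t - r) @^-1` B)) * r `^ (- alpha)) in
  asymp_equiv_pinfty
    (fun t0 : R => fine (P (increment Y t0 (t + t0) @^-1` B)))
    (fun t0 : R => C * t0 `^ (alpha - 1)).
Proof.
move=> a0 a1 c0 levyA stD indAD YE t0 mB B0 p0.
have a01 : 0 < alpha < 1 by rewrite a0.
(* The real-valued integral in [C] unfolds to [fine] of the extended one. *)
exact: (increment_probability_asymp a01 c0 levyA stD indAD YE t0 mB B0 p0).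
Qed.
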